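(* Let $(N,[\nabla])$ be a two-dimensional projective structure admitting a projective vector field $k$, in the generic situation that (locally) $k\ne0$ and the integral curves of $k$ are not geodesics of $[\nabla]$. Let $(M,g)$ be the associated neutral signature anti-self-dual Einstein four-manifold, let $K$ be the Killing vector of $g$ that is the lift of $k$, and let $(h,\omega)$ be the Einstein–Weyl structure on the space of orbits $W$ of $K$ in $M$ obtained from $(M,g,K)$ by the Jones–Tod reduction. Then the most general Einstein–Weyl structure arising in this way is locally equivalent to $$h=\frac{1}{V}\big((Bq-Ap+q^2)\,dy+dq\big)dy-\Big((pq+A)\,dy+\frac12 dp\Big)^2,\qquad \omega=V(4\,dq+2p\,dp),\qquad V=(B+p^2+q)^{-1},$$ where $(p,q,y)$ are local coordinates on $W$, and $A,B$ are arbitrary functions of $y$.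
   Context: A projective structure $[\nabla]$ on a surface $N$ is an equivalence class of torsion-free affine connections on $TN$ sharing the same unparametrised geodesics. A projective vector field is a vector field whose flow maps unparametrised geodesics to unparametrised geodesics; equivalently $\mathcal{L}_k\Gamma^C_{AB}=\delta^C_A\Upsilon_B+\delta^C_B\Upsilon_A$ for some one-form $\Upsilon$. The four-manifold: for $\nabla\in[\nabla]$ with connection components $\Gamma^C_{AB}$ in coordinates $x^A$, $A=0,1$, $(M,g)$ is locally $T^*N$, with fibre coordinates $z_A$, with the metric $$g= dz_A \odot dx^A - (\Gamma^C_{AB}z_C-z_Az_B-P_{AB})\,dx^A \odot dx^B,$$ where $P_{AB}=R_{(AB)}+\frac13R_{[AB]}$ is the projective Schouten tensor ($R_{AB}$ the Ricci tensor of $\nabla$), and $a\odot b=\frac12(a\otimes b+b\otimes a)$. This metric is Einstein with anti-self-dual Weyl tensor, and projective vector fields $k$ of $[\nabla]$ correspond one-to-one to Killing vectors of $g$ via $$K=k-z_A\frac{\partial k^B}{\partial x^A}\frac{\partial}{\partial z_B}+\Upsilon_A\frac{\partial}{\partial z_A}.$$ Jones–Tod reduction: with $|K|^2=g(K,K)$ (assumed nonzero) and $\mathbf{K}=g(K,\cdot)$, $$h=|K|^{-2}g-|K|^{-4}\mathbf{K}\odot\mathbf{K},\qquad \omega=\frac{2}{|K|^2}\star(\mathbf{K}\wedge d\mathbf{K}),$$ where $\star$ is the Hodge operator of $g$ (orientation and sign conventions being such that the Weyl tensor is anti-self-dual and $(h,\omega)$ is Einstein–Weyl), descend to a Lorentzian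 Einstein–Weyl structure on $W$. Weyl structures: a Weyl structure $(W,\mathcal{D},[h])$ is a conformal class $[h]$ with a torsion-free connection $\mathcal{D}$ such that $\mathcal{D}h=\omega\otimes h$ for a one-form $\omega$; it is determined by a pair $(h,\omega)$, and the pairs $(h,\omega)$ and $(\rho^2h,\omega+2d\ln\rho)$, with $\rho$ a smooth nonvanishing function, define the same Weyl structure. It is Einstein–Weyl if the symmetric part of the Ricci tensor of $\mathcal{D}$ is a scalar (function) multiple of $h$. ''Locally equivalent'' means equal as Weyl structures up to a local diffeomorphism. *)

(* Defs.v *)
From HB Require Import structures.
Set Warnings "-notation-overridden,-notation-incompatible-prefix".
From mathcomp Require Import all_boot all_order all_algebra.
From mathcomp Require Import all_classical all_reals all_analysis.
Set Implicit Arguments.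
Unset Strict Implicit.
Unset Printing Implicit Defensive.
Import Order.TTheory GRing.Theory Num.Theory.
Import numFieldNormedType.Exports.
Local Open Scope classical_set_scope.
Local Open Scope ring_scope.

(* Everything is local, so manifolds are open subsets of R^n and tensor fields
   are given by their components. A vector v is a row vector; a one-form is the
   row vector of its components; a symmetric 2-tensor is a square matrix h with
   h(u, v) = u *m h *m v^T. *)

Section Calculus.
Context {R : realType}.

Definition partial n (i : 'I_n) (f : 'rV[R]_n -> R) : 'rV[R]_n -> R :=
  fun x => 'D_(delta_mx 0 i) f x.

(* C^oo: all iterated partial derivatives exist and are Frechet
   differentiable, hence continuous, at every point of the open set U. *)
Definition smooth_on n (U : set 'rV[R]_n) (f : 'rV[R]_n -> R) : Prop :=
  forall (s : seq 'I_n) (x : 'rV[R]_n), U x ->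
    differentiable (foldr (@partial n) f s) x.

Definition smooth_mx_on n m p (U : set 'rV[R]_n)
    (f : 'rV[R]_n -> 'M[R]_(m, p)) : Prop :=
  forall i j, smooth_on U (fun x => f x i j).

Definition smooth1_on (J : set R) (f : R -> R) : Prop :=
  forall (n : nat) (t : R), J t -> derivable (derive1n n f) t 1.

Definition diffeomorphism n (U V : set 'rV[R]_n)
    (phi : 'rV[R]_n -> 'rV[R]_n) : Prop :=
  [/\ open U, open V, smooth_mx_on U phi &
    exists psi : 'rV[R]_n -> 'rV[R]_n,
      [/\ smooth_mx_on V psi,
          forall x, U x -> V (phi x) /\ psi (phi x) = x &
          forall y, V y -> U (psi y) /\ phi (psi y) = y]].

(* The differential of phi at x sends v to v *m 'J phi x. *)
Definition pullback2 n m (phi : 'rV[R]_n -> 'rV[R]_m)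
    (h : 'rV[R]_m -> 'M[R]_m) (x : 'rV[R]_n) : 'M[R]_n :=
  'J phi x *m h (phi x) *m ('J phi x)^T.

Definition pullback1 n m (phi : 'rV[R]_n -> 'rV[R]_m)
    (w : 'rV[R]_m -> 'rV[R]_m) (x : 'rV[R]_n) : 'rV[R]_n :=
  w (phi x) *m ('J phi x)^T.

(* a (.) b = (a (x) b + b (x) a) / 2 *)
Definition symprod n (a b : 'rV[R]_n) : 'M[R]_n :=
  2^-1 *: (a^T *m b + b^T *m a).

Definition integral_curve n (X : 'rV[R]_n -> 'rV[R]_n) (U : set 'rV[R]_n)
    (a b : R) (c : R -> 'rV[R]_n) : Prop :=
  forall t, a < t < b -> U (c t) /\ is_derive t 1 c (X (c t)).

Definition same_orbit n (X : 'rV[R]_n -> 'rV[R]_n) (U : set 'rV[R]_n)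
    (x y : 'rV[R]_n) : Prop :=
  exists (a b s t : R) (c : R -> 'rV[R]_n),
    [/\ integral_curve X U a b c, a < s < b, a < t < b, c s = x & c t = y].

End Calculus.

Section Connections.
Context {R : realType}.

(* G c a b is the component Gamma^c_{ab} of an affine connection:
   (nabla_a X)^c = d_a X^c + Gamma^c_{ab} X^b. *)
Definition connection n := 'I_n -> 'I_n -> 'I_n -> 'rV[R]_n -> R.

Definition torsion_free n (U : set 'rV[R]_n) (G : connection n) : Prop :=
  forall c a b x, U x -> G c a b x = G c b a x.

Definition smooth_connection n (U : set 'rV[R]_n) (G : connection n) : Prop :=
  forall c a b, smooth_on U (G c a b).

(* R_{ab} = R_{ca}^c_b, where [nabla_a, nabla_b] X^c = R_{ab}^c_d X^d. *)
Definition ricci n (G : connection n) (a b : 'I_n) (x : 'rV[R]_n) : R :=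
  \sum_c (partial c (G c a b) x - partial a (G c c b) x)
  + \sum_c \sum_d (G c c d x * G d a b x - G c a d x * G d c b x).

Definition schouten (G : connection 2) (a b : 'I_2) (x : 'rV[R]_2) : R :=
  2^-1 * (ricci G a b x + ricci G b a x)
  + 3^-1 * (2^-1 * (ricci G a b x - ricci G b a x)).

Definition unparametrised_geodesic n (G : connection n) (a b : R)
    (c : R -> 'rV[R]_n) : Prop :=
  exists f : R -> R, forall t, a < t < b ->
    [/\ derivable c t 1, derivable (derive1 c) t 1, derive1 c t != 0 &
      forall i, derive1n 2 c t 0 i
        + \sum_j \sum_l G i j l (c t) * derive1 c t 0 j * derive1 c t 0 l
        = f t * derive1 c t 0 i].

Definition lie_connection n (G : connection n) (k : 'rV[R]_n -> 'rV[R]_n)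
    (c a b : 'I_n) (x : 'rV[R]_n) : R :=
  let k' i y := k y 0 i in
  \sum_d (k' d x * partial d (G c a b) x - G d a b x * partial d (k' c) x
          + G c d b x * partial a (k' d) x + G c a d x * partial b (k' d) x)
  + partial a (partial b (k' c)) x.

Definition projective_field n (U : set 'rV[R]_n) (G : connection n)
    (k Ups : 'rV[R]_n -> 'rV[R]_n) : Prop :=
  forall c a b x, U x ->
    lie_connection G k c a b x
    = (c == a)%:R * Ups x 0 b + (c == b)%:R * Ups x 0 a.

(* The projective structure [nabla] on U is given by a representative G. The
   one-form Ups is determined by G and k; it is named because the lift of k
   depends on it. *)
Record generic_projective_symmetry (U : set 'rV[R]_2) (G : connection 2)
    (k Ups : 'rV[R]_2 -> 'rV[R]_2) : Prop := {
  gps_open : open U;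
  gps_smooth : smooth_connection U G;
  gps_torsion_free : torsion_free U G;
  gps_smooth_field : smooth_mx_on U k;
  gps_smooth_form : smooth_mx_on U Ups;
  gps_projective : projective_field U G k Ups;
  gps_nonzero : forall x, U x -> k x != 0;
  gps_not_geodesic : forall (a b : R) (c : R -> 'rV[R]_2), a < b ->
    integral_curve k U a b c -> ~ unparametrised_geodesic G a b c
}.

End Connections.

Section FourManifold.
Context {R : realType}.
Implicit Types (G : @connection R 2) (k Ups : 'rV[R]_2 -> 'rV[R]_2).

(* Coordinates on T^*U are (x^0, x^1, z_0, z_1): a point is m : 'rV_(2 + 2)
   with base coordinates lsubmx m and fibre coordinates rsubmx m. *)
Definition cotangent (U : set 'rV[R]_2) : set 'rV[R]_(2 + 2) :=
  [set m | U (lsubmx m)].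

Definition dx (A : 'I_2) : 'rV[R]_(2 + 2) := delta_mx 0 (lshift 2 A).
Definition dz (A : 'I_2) : 'rV[R]_(2 + 2) := delta_mx 0 (rshift 2 A).

Definition metric G (m : 'rV[R]_(2 + 2)) : 'M[R]_(2 + 2) :=
  let x : 'rV[R]_2 := lsubmx m in let z : 'rV[R]_2 := rsubmx m in
  \sum_A symprod (dz A) (dx A)
  - \sum_A \sum_B (\sum_C G C A B x * z 0 C - z 0 A * z 0 B - schouten G A B x)
                    *: symprod (dx A) (dx B).

(* K = k - z_B (d k^B / d x^A) d/dz_A + Ups_A d/dz_A; this is the cotangent
   lift of k, translated in the fibres by Ups. *)
Definition lift_field k Ups (m : 'rV[R]_(2 + 2)) : 'rV[R]_(2 + 2) :=
  let x : 'rV[R]_2 := lsubmx m in let z : 'rV[R]_2 := rsubmx m in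
  row_mx (k x)
    (\row_A (Ups x 0 A - \sum_B z 0 B * partial A (fun y => k y 0 B) x)).

Definition sqnorm (g : 'M[R]_(2 + 2)) (v : 'rV[R]_(2 + 2)) : R :=
  (v *m g *m v^T) 0 0.

Definition ext_d (w : 'rV[R]_(2 + 2) -> 'rV[R]_(2 + 2)) (m : 'rV[R]_(2 + 2))
    (a b : 'I_(2 + 2)) : R :=
  partial a (fun y => w y 0 b) m - partial b (fun y => w y 0 a) m.

Definition wedge12 (w : 'rV[R]_(2 + 2))
    (F : 'I_(2 + 2) -> 'I_(2 + 2) -> R) (a b c : 'I_(2 + 2)) : R :=
  w 0 a * F b c + w 0 b * F c a + w 0 c * F a b.

(* The volume form of g for the orientation dx^0 /\ dz_0 /\ dx^1 /\ dz_1, which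
   is opposite to the coordinate order (x^0, x^1, z_0, z_1); hence the sign.
   With this orientation the Weyl tensor W of g satisfies
   vol_{abpq} W^{ab}_{cd} / 2 = - W_{pqcd}, i.e. it is anti-self-dual. The
   determinant is the Levi-Civita symbol. *)
Definition volume (g : 'M[R]_(2 + 2)) (a b c d : 'I_(2 + 2)) : R :=
  - (Num.sqrt `|\det g|
     * \det (\matrix_(i < 4, j < 4) (tnth [tuple a; b; c; d] i == j)%:R)).

(* (star T)_d = vol_d^{abc} T_{abc} / 3!; with this convention and orientation
   the reduced structure is Einstein-Weyl (for the opposite sign it is not). *)
Definition hodge3 (g : 'M[R]_(2 + 2))
    (T : 'I_(2 + 2) -> 'I_(2 + 2) -> 'I_(2 + 2) -> R) : 'rV[R]_(2 + 2) :=
  let gi := invmx g in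
  \row_d (6^-1 * \sum_a \sum_b \sum_c volume g d a b c
            * \sum_i \sum_j \sum_l gi a i * gi b j * gi c l * T i j l).

Definition killing_norm G k Ups (m : 'rV[R]_(2 + 2)) : R :=
  sqnorm (metric G m) (lift_field k Ups m).

Definition killing_form G k Ups (m : 'rV[R]_(2 + 2)) : 'rV[R]_(2 + 2) :=
  lift_field k Ups m *m metric G m.

Definition jones_tod_h G k Ups (m : 'rV[R]_(2 + 2)) : 'M[R]_(2 + 2) :=
  let N := killing_norm G k Ups m in let kf := killing_form G k Ups m in
  N^-1 *: metric G m - (N ^+ 2)^-1 *: symprod kf kf.

Definition jones_tod_omega G k Ups (m : 'rV[R]_(2 + 2)) : 'rV[R]_(2 + 2) :=
  let kf := killing_form G k Ups in
  (2 / killing_norm G k Ups m)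
    *: hodge3 (metric G m) (wedge12 (kf m) (ext_d kf m)).

(* W is the space of orbits of K in the open set O, with projection pi. *)
Record orbit_space (K : 'rV[R]_(2 + 2) -> 'rV[R]_(2 + 2))
    (O : set 'rV[R]_(2 + 2)) (W : set 'rV[R]_3)
    (pi : 'rV[R]_(2 + 2) -> 'rV[R]_3) : Prop := {
  os_open : open O;
  os_open_base : open W;
  os_onto : pi @` O = W;
  os_smooth : smooth_mx_on O pi;
  os_submersion : forall m, O m -> row_full ('J pi m);
  os_fibres : forall m m', O m -> O m' -> (pi m = pi m' <-> same_orbit K O m m')
}.

End FourManifold.

Section WeylStructures.
Context {R : realType}.

Record weyl_pair n (W : set 'rV[R]_n) (h : 'rV[R]_n -> 'M[R]_n)
    (om : 'rV[R]_n -> 'rV[R]_n) : Prop := {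
  wp_open : open W;
  wp_smooth_h : smooth_mx_on W h;
  wp_smooth_om : smooth_mx_on W om;
  wp_sym : forall x, W x -> (h x)^T = h x;
  wp_nondegenerate : forall x, W x -> h x \in unitmx
}.

Definition weyl_connection n (W : set 'rV[R]_n) (h : 'rV[R]_n -> 'M[R]_n)
    (om : 'rV[R]_n -> 'rV[R]_n) (D : connection n) : Prop :=
  [/\ smooth_connection W D, torsion_free W D &
    forall x, W x -> forall a b c,
      partial a (fun y => h y b c) x
      - \sum_d D d a b x * h x d c - \sum_d D d a c x * h x b d
      = om x 0 a * h x b c].

Definition einstein_weyl n (W : set 'rV[R]_n) (h : 'rV[R]_n -> 'M[R]_n)
    (om : 'rV[R]_n -> 'rV[R]_n) : Prop :=
  weyl_pair W h om /\
  exists (D : connection n) (L : 'rV[R]_n -> R),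
    weyl_connection W h om D /\
    forall x, W x -> forall a b,
      2^-1 * (ricci D a b x + ricci D b a x) = L x * h x a b.

(* Near w1 and w2, (W1, h1, om1) and (W2, h2, om2) are the same Weyl structure
   up to a diffeomorphism phi, with phi w1 = w2. The last equation uses
   d ln rho = rho^-1 d rho, for rho of either sign. *)
Definition locally_equivalent n
    (W1 : set 'rV[R]_n) (h1 : 'rV[R]_n -> 'M[R]_n) (om1 : 'rV[R]_n -> 'rV[R]_n)
    (w1 : 'rV[R]_n)
    (W2 : set 'rV[R]_n) (h2 : 'rV[R]_n -> 'M[R]_n) (om2 : 'rV[R]_n -> 'rV[R]_n)
    (w2 : 'rV[R]_n) : Prop :=
  exists (U1 U2 : set 'rV[R]_n) (phi : 'rV[R]_n -> 'rV[R]_n)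
         (rho : 'rV[R]_n -> R),
    [/\ [/\ U1 w1, U1 `<=` W1, U2 `<=` W2 & phi w1 = w2],
        diffeomorphism U1 U2 phi,
        smooth_on U1 rho,
        forall x, U1 x -> rho x != 0 &
        forall x, U1 x ->
          pullback2 phi h2 x = rho x ^+ 2 *: h1 x /\
          pullback1 phi om2 x
          = om1 x + (2 / rho x) *: \row_i partial i rho x].

(* (h, om) is the Weyl structure that the Jones-Tod tensors of (M, g, K) induce
   on the space W of orbits of K in O. *)
Record jones_tod_reduction (U : set 'rV[R]_2) (G : connection 2)
    (k Ups : 'rV[R]_2 -> 'rV[R]_2)
    (O : set 'rV[R]_(2 + 2)) (pi : 'rV[R]_(2 + 2) -> 'rV[R]_3)
    (W : set 'rV[R]_3) (h : 'rV[R]_3 -> 'M[R]_3)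
    (om : 'rV[R]_3 -> 'rV[R]_3) : Prop := {
  jt_sub : O `<=` cotangent U;
  jt_nonnull : forall m, O m -> killing_norm G k Ups m != 0;
  jt_orbits : orbit_space (lift_field k Ups) O W pi;
  jt_weyl : weyl_pair W h om;
  jt_h : forall m, O m -> pullback2 pi h m = jones_tod_h G k Ups m;
  jt_om : forall m, O m -> pullback1 pi om m = jones_tod_omega G k Ups m
}.

End WeylStructures.

Section NormalForm.
Context {R : realType}.
Implicit Types (A B : R -> R) (w : 'rV[R]_3).

(* Coordinates on R^3 are (p, q, y). *)
Definition cp w : R := w 0 (@Ordinal 3 0 isT).
Definition cq w : R := w 0 (@Ordinal 3 1 isT).
Definition cy w : R := w 0 (@Ordinal 3 2 isT).
Definition dp : 'rV[R]_3 := delta_mx 0 (@Ordinal 3 0 isT).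
Definition dq : 'rV[R]_3 := delta_mx 0 (@Ordinal 3 1 isT).
Definition dy : 'rV[R]_3 := delta_mx 0 (@Ordinal 3 2 isT).

Definition normal_domain (J : set R) B : set 'rV[R]_3 :=
  [set w | J (cy w) /\ B (cy w) + cp w ^+ 2 + cq w != 0].

Definition normal_V B w : R := (B (cy w) + cp w ^+ 2 + cq w)^-1.

Definition normal_h A B w : 'M[R]_3 :=
  let p := cp w in let q := cq w in let a := A (cy w) in let b := B (cy w) in
  let th := (p * q + a) *: dy + 2^-1 *: dp in
  (1 / normal_V B w) *: symprod ((b * q - a * p + q ^+ 2) *: dy + dq) dy
  - symprod th th.

Definition normal_omega B w : 'rV[R]_3 :=
  normal_V B w *: (4 *: dq + (2 * cp w) *: dp).

End NormalForm.

(* Main.v *)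
Require Import Defs.
Set Warnings "-notation-overridden,-notation-incompatible-prefix".
From mathcomp Require Import all_boot all_order fingroup perm all_algebra.
From mathcomp Require Import all_classical all_reals all_analysis.
From mathcomp Require Import ring lra.
From HB Require Import structures.
Set Implicit Arguments.
Unset Strict Implicit.
Unset Printing Implicit Defensive.
Import Order.TTheory GRing.Theory Num.Theory.
Import numFieldNormedType.Exports.
Local Open Scope classical_set_scope.
Local Open Scope ring_scope.

(** Let w = nabla_k k be transverse to k, and let u0 k + u1 w be the expansion of
    nabla_w k. Then e = (2/3) u1 k - w and the one-form be with be(k) = - u1/3 and
    be(e) = u0 + (2/9) u1^2 are determined by nabla and k, and the projectively
    equivalent connection Gh = G + delta be + be delta takes the form
      Gh_k k = - e,   Gh_k e = Gh_e k = 0,   Gh_e e = A k - B e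
    for two functions A and B. The Lie derivatives along k of w and of nabla_w k
    are given by Ups, because k is projective; they show that [k, e] = 0, that
    L_k be = - Ups, and that k annihilates A and B ([adapted_frame_exists]). The
    coframe dual to (k, e) is therefore closed; it is (ds, dy) in suitable
    coordinates, where k = d/ds and A, B are functions of y ([straightening],
    [invariant_descends]). These are the two functions
    of the normal form.

    The transversality of w holds at every point: the area spanned by k and w obeys a
    linear differential equation along the integral curves of k, so that if it
    vanishes at a point, it vanishes along the integral curve through this point,
    which then is a geodesic ([acceleration_transverse]).

    On the cotangent bundle, (s, y) and the values p and q of z + be on k and e are
    coordinates with Jacobian determinant 1, in which the lift of k is d/ds and the
    metric is the one of the model connection nabla_0 d_0 = - d_1,
    nabla_1 d_1 = A d_0 - B d_1 with symmetry d_0 ([metric_adapted_coord],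
    [lift_adapted_coord]; the Schouten tensor is computed in [schouten_symE]). As the
    Jones-Tod tensors are natural under such maps, everything is reduced to the model,
    where |K|^2 = B + p^2 + q = 1/V and a computation gives the pair
      V^2 h,   V (2 dq - 2 p dp - 2 B' dy)
    for h as in the normal form; the rescaling rho = 1/V turns it into the normal form
    ([model_jones_tod_h], [model_jones_tod_omega], [normal_omega_conformal]).

    For an arbitrary reduction over W, a local section of the projection followed by
    (p, q, y) gives a map from W to the domain of the normal form. It pulls the
    nondegenerate tensor h of the normal form back to a multiple of the nondegenerate
    tensor on W, so that it is a local diffeomorphism ([reduction_normal_form]).
    Conversely, the model exists for all A and B, and the Einstein-Weyl equation is
    verified on the explicit Weyl connection ([normal_einstein_weyl]).

    The calculus that carries the argument is developed first: closure properties of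
    smooth functions, the inverse function theorem, primitives of closed one-forms,
    integral curves, and the symmetry of second derivatives. *)

(** * Norms of row vectors and partial derivatives *)

Section RowVectors.
Context {R : realType}.

Lemma normr_coord n (x : 'rV[R]_n) i : `|x 0 i| <= `|x|.
Proof.
rewrite [leRHS]/Num.Def.normr/= mx_normrE.
exact: (le_bigmax _ (fun ij : 'I_1 * 'I_n => `|x ij.1 ij.2|) (0, i)).
Qed.

Lemma normr_le_coord n (x : 'rV[R]_n) c :
  0 <= c -> (forall i, `|x 0 i| <= c) -> `|x| <= c.
Proof.
move=> c0 xc; rewrite [leLHS]/Num.Def.normr/= mx_normrE.
by apply: bigmax_le => // -[i j] _ /=; rewrite ord1.
Qed.

Lemma normr_lt_coord n (x : 'rV[R]_n) c :
  0 < c -> (forall i, `|x 0 i| < c) -> `|x| < c.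
Proof.
move=> c0 xc; rewrite [ltLHS]/Num.Def.normr/= mx_normrE.
by apply: bigmax_lt => // -[i j] _ /=; rewrite ord1.
Qed.

End RowVectors.

Section Differentiation.
Context {R : realType}.
Implicit Types V : normedModType R.

Lemma differentiable_mx V m p (f : V -> 'M[R]_(m, p)) x :
  (forall i j, differentiable (fun y => f y i j) x) -> differentiable f x.
Proof.
move=> df.
have -> : f = \sum_(i < m) \sum_(j < p) (fun y => f y i j *: delta_mx i j).
  apply/funext => y; rewrite [LHS]matrix_sum_delta fct_sumE; apply: eq_bigr => i _.
  by rewrite fct_sumE.
apply: differentiable_sum => i; apply: differentiable_sum => j.
exact/differentiableZl/df.
Qed.

Lemma differentiable_entry V m p (f : V -> 'M[R]_(m, p)) x i j :
  differentiable f x -> differentiable (fun y => f y i j) x.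
Proof.
by move=> df; exact: (differentiable_comp df (differentiable_coord (f x) i j)).
Qed.

Lemma partialE n (i : 'I_n) f (x : 'rV[R]_n) :
  differentiable f x -> partial i f x = 'd f x (delta_mx 0 i).
Proof. by move=> df; rewrite /partial deriveE. Qed.

Lemma jacobianE n m (phi : 'rV[R]_n -> 'rV[R]_m) x i j :
  differentiable phi x -> 'J phi x i j = partial i (fun y => phi y 0 j) x.
Proof.
move=> dphi; have := deriveEjacobian (delta_mx 0 i) dphi.
rewrite -rowE derive_mx; last exact: diff_derivable.
by move=> /rowP /(_ j); rewrite !mxE.
Qed.

Lemma diff_partial n (f : 'rV[R]_n -> R) x v : differentiable f x ->
  'd f x v = \sum_j v 0 j * partial j f x.
Proof.
move=> df; rewrite {1}[v]row_sum_delta linear_sum; apply: eq_bigr => j _.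
by rewrite linearZ /= partialE.
Qed.

Lemma derive_chain V n (F : 'rV[R]_n -> R) (phi : V -> 'rV[R]_n) x v :
  differentiable F (phi x) -> differentiable phi x ->
  'D_v (fun y => F (phi y)) x
  = \sum_j 'D_v (fun y => phi y 0 j) x * partial j F (phi x).
Proof.
move=> dF dphi; rewrite deriveE; last exact: (differentiable_comp dphi dF).
rewrite (_ : (fun y => F (phi y)) = F \o phi)// diff_comp//= diff_partial//.
apply: eq_bigr => j _; congr (_ * _).
by rewrite -deriveE// derive_mx ?mxE//; exact: diff_derivable.
Qed.

Lemma partial_chain n m (i : 'I_n) (F : 'rV[R]_m -> R)
    (phi : 'rV[R]_n -> 'rV[R]_m) x :
  differentiable F (phi x) -> differentiable phi x ->
  partial i (fun y => F (phi y)) x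
  = \sum_j partial i (fun y => phi y 0 j) x * partial j F (phi x).
Proof. exact: derive_chain. Qed.

Lemma near_open n (U : set 'rV[R]_n) x : open U -> U x -> \forall y \near x, U y.
Proof. by move=> oU Ux; exact: open_nbhs_nbhs. Qed.

(** The definition of the differential with explicit remainders, which can be
    estimated by hand. *)
Lemma is_diff_eps V1 V2 (f : V1 -> V2) (df : {linear V1 -> V2}) x :
  continuous df ->
  (forall e, 0 < e -> \forall h \near 0, `|f (h + x) - f x - df h| <= e * `|h|) ->
  is_diff x f df.
Proof.
move=> cdf H.
have E : f \o shift x = cst (f x) + df +o_ 0 id.
  apply/eqaddoP => e e0; near=> h; rewrite /= -[X in `|X|]/(f (h + x) - (f x + df h)).
  by rewrite opprD addrA; near: h; exact: H.
have D : 'd f x = df :> (V1 -> V2) by apply: diff_unique.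
apply: DiffDef => //; apply/diff_locallyP; rewrite D; split => //.
Unshelve. all: by end_near. Qed.

Lemma diff_eps V1 V2 (f : V1 -> V2) x : differentiable f x ->
  forall e, 0 < e ->
  \forall h \near 0, `|f (h + x) - f x - 'd f x h| <= e * `|h|.
Proof.
move=> /diff_locally E e e0.
move: E => /eqaddoP /(_ e e0); apply: filterS => h /=.
by rewrite -[X in `|X|]/(f (h + x) - (f x + 'd f x h)) opprD addrA.
Qed.

Lemma near_eq_differentiable V1 V2 (f g : V1 -> V2) x :
  (\forall y \near x, f y = g y) -> differentiable f x -> differentiable g x.
Proof.
move=> fg df; suff [] : is_diff x g ('d f x) by [].
apply: is_diff_eps; first exact: diff_continuous.
move=> e e0; have E := diff_eps df e0.
have /nbhs_ballP[d /= d0 fgd] := fg.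
near=> h; rewrite -(nbhs_singleton fg).
have <- : f (h + x) = g (h + x).
  apply: fgd; rewrite -ball_normE /= opprD addrCA subrr addr0 normrN.
  by near: h; exact: nbhs0_lt.
by near: h.
Unshelve. all: by end_near. Qed.

End Differentiation.

(** * Closure properties of smooth functions *)

Section Smooth.
Context {R : realType}.

(** Closure properties are proved for finite orders: the derivatives of a product,
    an inverse or a composite involve the functions themselves at one order less,
    so that an induction goes through for [Ck] but not directly for [smooth_on]. *)
Definition Ck n (k : nat) (U : set 'rV[R]_n) (f : 'rV[R]_n -> R) : Prop :=
  forall (s : seq 'I_n) x, (size s <= k)%N -> U x ->
    differentiable (foldr (@partial R n) f s) x.

Lemma smooth_Ck n (U : set 'rV[R]_n) f :
  smooth_on U f <-> forall k, Ck k U f.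
Proof.
split=> [fs k s x _|fk s x]; first exact: fs.
exact: (fk (size s)).
Qed.

Lemma Ck0 n (U : set 'rV[R]_n) f :
  Ck 0 U f <-> forall x, U x -> differentiable f x.
Proof. by split=> [fk x|df [] // x _]; [exact: (fk [::])|exact: df]. Qed.

Lemma CkS n k (U : set 'rV[R]_n) f :
  Ck k.+1 U f <->
  (forall x, U x -> differentiable f x) /\ forall i, Ck k U (partial i f).
Proof.
split=> [fk|[df fk] s x].
  split=> [x|i s x ks]; first exact: (fk [::]).
  have := fk (rcons s i) x; rewrite foldr_rcons; apply.
  by rewrite size_rcons.
case/lastP: s => [|s i]; first by move=> _; exact: df.
rewrite size_rcons foldr_rcons; exact: fk.
Qed.

Lemma Ck_le n k l (U : set 'rV[R]_n) f : (k <= l)%N -> Ck l U f -> Ck k U f.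
Proof. by move=> kl fl s x sk; exact: fl (leq_trans sk kl). Qed.

Lemma Ck_diff n k (U : set 'rV[R]_n) f x :
  Ck k U f -> U x -> differentiable f x.
Proof. by move=> fk; exact: (fk [::]). Qed.

Lemma partial_eq n (U : set 'rV[R]_n) f g : open U ->
  (forall x, U x -> f x = g x) ->
  forall i x, U x -> partial i f x = partial i g x.
Proof.
move=> oU fg i x Ux; apply: near_eq_derive.
by apply: filterS (near_open oU Ux) => y; exact: fg.
Qed.

Lemma Ck_eq n k (U : set 'rV[R]_n) f g : open U ->
  (forall x, U x -> f x = g x) -> Ck k U f -> Ck k U g.
Proof.
move=> oU; elim: k f g => [|k IH] f g fg.
  rewrite !Ck0 => df x Ux; apply: near_eq_differentiable (df x Ux).
  by apply: filterS (near_open oU Ux) => y; exact: fg.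
move=> /CkS [df fk]; apply/CkS; split=> [x Ux|i].
  apply: near_eq_differentiable (df x Ux).
  by apply: filterS (near_open oU Ux) => y; exact: fg.
by apply: IH (fk i) => x Ux; exact: partial_eq fg _ _ Ux.
Qed.

Lemma Ck_cst n k (U : set 'rV[R]_n) (c : R) : Ck k U (fun=> c).
Proof.
elim: k c => [|k IH] c; first by apply/Ck0 => x _; exact: differentiable_cst.
apply/CkS; split=> [x _|i]; first exact: differentiable_cst.
have -> : partial i (fun=> c) = (fun=> 0 : R) by apply/funext => x; exact: derive_cst.
exact: IH.
Qed.

Lemma partialD n (i : 'I_n) (f g : 'rV[R]_n -> R) x :
  differentiable f x -> differentiable g x ->
  partial i (fun y => f y + g y) x = partial i f x + partial i g x.
Proof. by move=> df dg; apply: deriveD; exact: diff_derivable. Qed.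

Lemma partialM n (i : 'I_n) (f g : 'rV[R]_n -> R) x :
  differentiable f x -> differentiable g x ->
  partial i (fun y => f y * g y) x = partial i f x * g x + f x * partial i g x.
Proof.
move=> df dg; rewrite /partial deriveM; [|exact: diff_derivable..].
by rewrite addrC mulrC.
Qed.

Lemma partialN n (i : 'I_n) (f : 'rV[R]_n -> R) x :
  differentiable f x -> partial i (fun y => - f y) x = - partial i f x.
Proof. by move=> df; apply: deriveN; exact: diff_derivable. Qed.

Lemma partialV n (i : 'I_n) (f : 'rV[R]_n -> R) x : f x != 0 ->
  differentiable f x ->
  partial i (fun y => (f y)^-1) x = - (f x)^-1 ^+ 2 * partial i f x.
Proof.
by move=> f0 df; rewrite /partial deriveV ?exprVn//; exact: diff_derivable.
Qed.

Lemma CkD n k (U : set 'rV[R]_n) f g : open U ->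
  Ck k U f -> Ck k U g -> Ck k U (fun x => f x + g x).
Proof.
move=> oU; elim: k f g => [|k IH] f g.
  by rewrite !Ck0 => df dg x Ux; apply: differentiableD; [exact: df|exact: dg].
move=> /CkS [df fk] /CkS [dg gk]; apply/CkS; split=> [x Ux|i].
  by apply: differentiableD; [exact: df|exact: dg].
apply: (Ck_eq oU _ (IH _ _ (fk i) (gk i))) => x Ux.
by rewrite partialD//; [exact: df|exact: dg].
Qed.

Lemma CkM n k (U : set 'rV[R]_n) f g : open U ->
  Ck k U f -> Ck k U g -> Ck k U (fun x => f x * g x).
Proof.
move=> oU; elim: k f g => [|k IH] f g.
  by rewrite !Ck0 => df dg x Ux; apply: differentiableM; [exact: df|exact: dg].
move=> fk1 gk1; move: (fk1) (gk1) => /CkS [df fk] /CkS [dg gk].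
apply/CkS; split=> [x Ux|i].
  by apply: differentiableM; [exact: df|exact: dg].
have fk' := Ck_le (leqnSn k) fk1; have gk' := Ck_le (leqnSn k) gk1.
apply: (Ck_eq oU _ (CkD oU (IH _ _ (fk i) gk') (IH _ _ fk' (gk i)))) => x Ux.
by rewrite partialM//; [exact: df|exact: dg].
Qed.

Lemma CkN n k (U : set 'rV[R]_n) f : open U ->
  Ck k U f -> Ck k U (fun x => - f x).
Proof.
move=> oU fk; have H := CkM oU (@Ck_cst _ k U (-1)) fk; apply: (Ck_eq oU _ H) => x _.
by rewrite mulN1r.
Qed.

Lemma CkV n k (U : set 'rV[R]_n) f : open U -> (forall x, U x -> f x != 0) ->
  Ck k U f -> Ck k U (fun x => (f x)^-1).
Proof.
move=> oU f0; elim: k => [|k IH].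
  by rewrite !Ck0 => df x Ux; apply: differentiableV; [exact: df|exact: f0].
move=> fk1; move: (fk1) => /CkS [df fk].
apply/CkS; split=> [x Ux|i].
  by apply: differentiableV; [exact: df|exact: f0].
have fk' := IH (Ck_le (leqnSn k) fk1).
apply: (Ck_eq oU _ (CkM oU (CkN oU (CkM oU fk' fk')) (fk i))) => x Ux.
by rewrite partialV ?f0//; exact: df.
Qed.

Lemma Ck_sum n k (U : set 'rV[R]_n) (I : Type) (r : seq I) (P : pred I)
    (f : I -> 'rV[R]_n -> R) : open U ->
  (forall i, P i -> Ck k U (f i)) -> Ck k U (fun x => \sum_(i <- r | P i) f i x).
Proof.
move=> oU fk; elim: r => [|i r IH].
  rewrite (_ : (fun x => _) = (fun=> 0)); last by apply/funext => x; rewrite big_nil.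
  exact: Ck_cst.
rewrite (_ : (fun x => _) = (fun x => if P i then f i x + \sum_(j <- r | P j) f j x
    else \sum_(j <- r | P j) f j x)); last by apply/funext => x; rewrite big_cons.
case Pi : (P i) => //.
by apply: CkD => //; exact: fk.
Qed.

Lemma Ck_prod n k (U : set 'rV[R]_n) (I : Type) (r : seq I) (P : pred I)
    (f : I -> 'rV[R]_n -> R) : open U ->
  (forall i, P i -> Ck k U (f i)) -> Ck k U (fun x => \prod_(i <- r | P i) f i x).
Proof.
move=> oU fk; elim: r => [|i r IH].
  rewrite (_ : (fun x => _) = (fun=> 1)); last by apply/funext => x; rewrite big_nil.
  exact: Ck_cst.
rewrite (_ : (fun x => _) = (fun x => if P i then f i x * \prod_(j <- r | P j) f j x
    else \prod_(j <- r | P j) f j x)); last by apply/funext => x; rewrite big_cons.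
case Pi : (P i) => //.
by apply: CkM => //; exact: fk.
Qed.

Lemma Ck_comp n m k (U : set 'rV[R]_n) (W : set 'rV[R]_m) F
    (phi : 'rV[R]_n -> 'rV[R]_m) : open U -> open W ->
  (forall x, U x -> W (phi x)) -> Ck k W F ->
  (forall j, Ck k U (fun x => phi x 0 j)) -> Ck k U (fun x => F (phi x)).
Proof.
move=> oU oW UW; have dphi x l : (forall j, Ck l U (fun x => phi x 0 j)) -> U x ->
    differentiable phi x.
  by move=> phik Ux; apply: differentiable_mx => i j; rewrite ord1;
     exact: Ck_diff (phik j) Ux.
elim: k F => [|k IH] F.
  rewrite !Ck0 => dF phik x Ux; have dp := dphi _ _ phik Ux.
  exact: (differentiable_comp dp (dF _ (UW _ Ux))).
move=> /CkS [dF Fk] phik; apply/CkS; split=> [x Ux|i].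
  have dp := dphi _ _ phik Ux; exact: (differentiable_comp dp (dF _ (UW _ Ux))).
have phik' j : Ck k U (fun x => phi x 0 j) := Ck_le (leqnSn k) (phik j).
apply: (@Ck_eq _ _ _
  (fun x => \sum_j partial i (fun y => phi y 0 j) x * partial j F (phi x))) => //.
  by move=> x Ux; rewrite partial_chain//; [exact/dF/UW|exact: dphi phik Ux].
apply: Ck_sum => // j _; apply: CkM => //; first by have /CkS[_] := phik j.
exact: IH.
Qed.

Lemma partial_coord n (i j : 'I_n) x :
  partial i (fun x => x 0 j) x = (j == i)%:R :> R.
Proof.
rewrite /partial.
have := @derive_mx R _ 1 n id x (delta_mx 0 i) (@derivable_id _ _ _ _).
by rewrite derive_id => /rowP /(_ j); rewrite !mxE eqxx.
Qed.

Lemma partial_cst n (i : 'I_n) (c : R) x : partial i (fun=> c) x = 0.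
Proof. exact: derive_cst. Qed.

Lemma partial_sum n m (i : 'I_n) (F : 'I_m -> 'rV[R]_n -> R) x :
  (forall l, differentiable (F l) x) ->
  partial i (fun y => \sum_l F l y) x = \sum_l partial i (F l) x.
Proof.
move=> dF; rewrite /partial -derive_sum; last by move=> l; exact: diff_derivable.
by congr ('D__ _ _); apply/funext => y; rewrite fct_sumE.
Qed.

Lemma Ck_coord n k (U : set 'rV[R]_n) j : Ck k U (fun x => x 0 j).
Proof.
have dj x : differentiable (fun x : 'rV[R]_n => x 0 j : R) x.
  exact: differentiable_coord.
case: k => [|k]; first by apply/Ck0.
apply/CkS; split=> // i.
have -> : partial i (fun x => x 0 j) = (fun=> (j == i)%:R : R); last exact: Ck_cst.
by apply/funext => x; exact: partial_coord.
Qed.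

End Smooth.

Section SmoothRules.
Context {R : realType} {n : nat} {U : set 'rV[R]_n}.
Hypothesis oU : open U.
Implicit Types f g : 'rV[R]_n -> R.

Lemma smooth_diff f x : smooth_on U f -> U x -> differentiable f x.
Proof. by move=> fs; exact: (fs [::]). Qed.

Lemma smooth_partial f i : smooth_on U f -> smooth_on U (partial i f).
Proof. by move=> fs s x Ux; have := fs (rcons s i) x Ux; rewrite foldr_rcons. Qed.

Lemma smooth_intro f : (forall x, U x -> differentiable f x) ->
  (forall i, smooth_on U (partial i f)) -> smooth_on U f.
Proof.
move=> df fs s x; case/lastP: s => [|s i]; first exact: df.
rewrite foldr_rcons; exact: fs.
Qed.

Lemma smooth_eq f g : (forall x, U x -> f x = g x) ->
  smooth_on U f -> smooth_on U g.
Proof. by move=> fg /smooth_Ck fs; apply/smooth_Ck => k; exact: Ck_eq (fs k). Qed.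

Lemma smooth_cst c : smooth_on U (fun=> c).
Proof. by apply/smooth_Ck => k; exact: Ck_cst. Qed.

Lemma smooth_coord j : smooth_on U (fun x => x 0 j).
Proof. by apply/smooth_Ck => k; exact: Ck_coord. Qed.

Lemma smoothD f g : smooth_on U f -> smooth_on U g ->
  smooth_on U (fun x => f x + g x).
Proof.
by move=> /smooth_Ck fs /smooth_Ck gs; apply/smooth_Ck => k; exact: CkD.
Qed.

Lemma smoothN f : smooth_on U f -> smooth_on U (fun x => - f x).
Proof. by move=> /smooth_Ck fs; apply/smooth_Ck => k; exact: CkN. Qed.

Lemma smoothM f g : smooth_on U f -> smooth_on U g ->
  smooth_on U (fun x => f x * g x).
Proof.
by move=> /smooth_Ck fs /smooth_Ck gs; apply/smooth_Ck => k; exact: CkM.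
Qed.

Lemma smoothX f k : smooth_on U f -> smooth_on U (fun x => f x ^+ k).
Proof.
move=> fs; elim: k => [|k IH]; first exact: smooth_cst.
rewrite (_ : (fun x => _) = (fun x => f x * f x ^+ k)); first exact: smoothM.
by apply/funext => x; rewrite exprS.
Qed.

Lemma smoothV f : (forall x, U x -> f x != 0) -> smooth_on U f ->
  smooth_on U (fun x => (f x)^-1).
Proof. by move=> f0 /smooth_Ck fs; apply/smooth_Ck => k; exact: CkV. Qed.

Lemma smooth_sum I (r : seq I) (P : pred I) (F : I -> 'rV[R]_n -> R) :
  (forall i, P i -> smooth_on U (F i)) ->
  smooth_on U (fun x => \sum_(i <- r | P i) F i x).
Proof.
move=> Fs; apply/smooth_Ck => k; apply: Ck_sum => // i Pi.
by have /smooth_Ck := Fs i Pi.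
Qed.

Lemma smooth_prod I (r : seq I) (P : pred I) (F : I -> 'rV[R]_n -> R) :
  (forall i, P i -> smooth_on U (F i)) ->
  smooth_on U (fun x => \prod_(i <- r | P i) F i x).
Proof.
move=> Fs; apply/smooth_Ck => k; apply: Ck_prod => // i Pi.
by have /smooth_Ck := Fs i Pi.
Qed.

Lemma smooth_comp m (W : set 'rV[R]_m) F (phi : 'rV[R]_n -> 'rV[R]_m) :
  open W -> (forall x, U x -> W (phi x)) -> smooth_on W F ->
  smooth_mx_on U phi -> smooth_on U (fun x => F (phi x)).
Proof.
move=> oW UW /smooth_Ck Fs phis; apply/smooth_Ck => k.
by apply: Ck_comp UW _ _ => // j; have /smooth_Ck := phis 0 j.
Qed.

Lemma smooth_det m (M : 'rV[R]_n -> 'M[R]_m) :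
  smooth_mx_on U M -> smooth_on U (fun x => \det (M x)).
Proof.
move=> Ms; apply: smooth_sum => s _; apply: smoothM; first exact: smooth_cst.
by apply: smooth_prod => i _; exact: Ms.
Qed.

Lemma smooth_mx_diff m p (M : 'rV[R]_n -> 'M[R]_(m, p)) x :
  smooth_mx_on U M -> U x -> differentiable M x.
Proof. by move=> Ms Ux; apply: differentiable_mx => i j; exact: smooth_diff (Ms i j) Ux. Qed.

Lemma smooth_jacobian m (phi : 'rV[R]_n -> 'rV[R]_m) :
  smooth_mx_on U phi -> smooth_mx_on U (jacobian phi).
Proof.
move=> phis i j; have := smooth_partial i (phis 0 j).
by apply: smooth_eq => x Ux; rewrite jacobianE//; exact: smooth_mx_diff Ux.
Qed.

(** By Cramer's formula the entries of the inverse are rational in those of M. *)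
Lemma smooth_invmx m (M : 'rV[R]_n -> 'M[R]_m) : smooth_mx_on U M ->
  (forall x, U x -> M x \in unitmx) -> smooth_mx_on U (fun x => invmx (M x)).
Proof.
move=> Ms Mu i j.
apply: (@smooth_eq (fun x => (\det (M x))^-1 * cofactor (M x) j i)).
  by move=> x Ux; rewrite /invmx (Mu x Ux) !mxE.
apply: smoothM; last first.
  rewrite /cofactor; apply: smoothM; first exact: smooth_cst.
  apply: smooth_det => a b; apply: smooth_eq (Ms (lift j a) (lift i b)) => x _.
  by rewrite !mxE.
apply: smoothV; last exact: smooth_det.
by move=> x Ux; rewrite -unitfE; exact: (Mu x Ux).
Qed.

End SmoothRules.

(** * Mean value inequalities and the inverse function theorem *)

Section MeanValue.
Context {R : realType}.

Lemma mvt_le (f df : R -> R) (a b c : R) : a <= b ->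
  (forall t, a <= t <= b -> is_derive t 1 f (df t)) ->
  (forall t, a <= t <= b -> `|df t| <= c) -> `|f b - f a| <= c * (b - a).
Proof.
move=> ab fd dfc.
have [||t] := @MVT_segment R f df a b ab.
- by move=> t; rewrite in_itv /= => /andP[at_ tb]; apply: fd; rewrite !ltW.
- apply: derivable_within_continuous => t; rewrite in_itv /= => tab.
  by have [] := fd t tab.
rewrite in_itv /= => tab ->; rewrite normrM [X in _ * X]ger0_norm ?subr_ge0//.
by rewrite ler_wpM2r ?subr_ge0 ?dfc.
Qed.

Lemma is_derive_line n (F : 'rV[R]_n -> R) a v (t : R) :
  differentiable F (a + t *: v) ->
  is_derive t 1 (fun s => F (a + s *: v))
    (\sum_j v 0 j * partial j F (a + t *: v)).
Proof.
move=> dF.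
have dl : is_derive t 1 (fun s : R => a + s *: v) v.
  have -> : (fun s : R => a + s *: v) = cst a + ( *:%R^~ v) by apply/funext.
  have D : is_diff t (cst a + ( *:%R^~ v) : R -> _) (0 + ( *:%R^~ v)).
    by apply: is_diffD.
  apply: DeriveDef; first exact: diff_derivable.
  by rewrite deriveE// diff_val -[LHS]/(0 + 1 *: v) scale1r add0r.
have dphi : differentiable (fun s : R => a + s *: v) t by apply/derivable1_diffP.
apply: DeriveDef; first by apply/derivable1_diffP; exact: (differentiable_comp dphi dF).
rewrite derive_chain//; apply: eq_bigr => j _; congr (_ * _).
have dder : derivable (fun s : R => a + s *: v) t 1 by case: dl.
have := derive_mx dder; rewrite (@derive_val _ _ _ _ _ _ _ dl).
by move=> /rowP /(_ j); rewrite !mxE.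
Qed.

Lemma ball_segment n (x0 x y : 'rV[R]_n) r (t : R) : 0 <= t <= 1 ->
  ball x0 r x -> ball x0 r y -> ball x0 r (x + t *: (y - x)).
Proof.
rewrite -!ball_normE /= => /andP[t0 t1] xr yr.
have -> : x0 - (x + t *: (y - x)) = (1 - t) *: (x0 - x) + t *: (x0 - y).
  by apply/rowP => i; rewrite !mxE; ring.
apply: le_lt_trans (ler_normD _ _) _; rewrite !normrZ !ger0_norm ?subr_ge0//.
have [->|tn0] := eqVneq t 0; first by rewrite mul0r subr0 mul1r addr0.
have tp : 0 < t by rewrite lt0r tn0.
have A : (1 - t) * `|x0 - x| <= (1 - t) * r by rewrite ler_wpM2l ?subr_ge0// ltW.
have B : t * `|x0 - y| < t * r by rewrite ltr_pM2l.
apply: lt_le_trans (ler_ltD A B) _.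
by rewrite (_ : (1 - t) * r + t * r = r)//; ring.
Qed.

(** The factor n comes from the norm, which is the largest absolute value of the
    coordinates. *)
Lemma mean_value_ball n (F : 'rV[R]_n -> R) x0 r c :
  (forall x, ball x0 r x -> differentiable F x) ->
  (forall x j, ball x0 r x -> `|partial j F x| <= c) ->
  forall x y, ball x0 r x -> ball x0 r y -> `|F y - F x| <= n%:R * c * `|y - x|.
Proof.
move=> dF Fc x y xr yr.
pose f (t : R) := F (x + t *: (y - x)).
have -> : F y - F x = f 1 - f 0.
  by rewrite /f scale1r scale0r addr0 [x + _]addrC subrK.
have seg t : 0 <= t <= 1 -> ball x0 r (x + t *: (y - x)) by move=> t01; exact: ball_segment.
rewrite -[leRHS]mulr1 -[X in _ * X](subr0 (1 : R)).
apply: (@mvt_le f (fun t => \sum_j (y - x) 0 j * partial j F (x + t *: (y - x)))) => //.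
  by move=> t t01; apply: is_derive_line; exact/dF/seg.
move=> t t01; apply: le_trans (ler_norm_sum _ _ _) _.
rewrite -mulrA mulr_natl -[X in _ *+ X](card_ord n) -sumr_const; apply: ler_sum => j _.
rewrite normrM mulrC; apply: ler_pM => //; first exact/Fc/seg.
exact: normr_coord.
Qed.

Lemma ball_of_near n (P : 'rV[R]_n -> Prop) x0 : (\forall x \near x0, P x) ->
  exists2 r : R, 0 < r & forall x, ball x0 r x -> P x.
Proof. by move=> /nbhs_ballP[r r0 rP]; exists r. Qed.

Lemma open_preim n m (U : set 'rV[R]_n) (V : set 'rV[R]_m) (f : 'rV[R]_n -> 'rV[R]_m) :
  open U -> open V -> (forall x, U x -> differentiable f x) ->
  open [set x | U x /\ V (f x)].
Proof.
move=> oU oV df; rewrite openE => x [Ux Vfx]; apply: filterI.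
  exact: near_open oU Ux.
exact: (differentiable_continuous (df x Ux) (near_open oV Vfx)).
Qed.

Lemma mulmx_bound n m (M : 'M[R]_(n, m)) :
  exists2 c : R, 0 < c & forall v : 'rV[R]_n, `|v *m M| <= c * `|v|.
Proof.
pose s := \sum_i \sum_j `|M i j|; exists (1 + s).
  by rewrite ltr_pwDl// sumr_ge0// => i _; exact: sumr_ge0.
move=> v; apply: normr_le_coord.
  by rewrite mulr_ge0// addr_ge0// sumr_ge0// => i _; apply: sumr_ge0.
move=> j; rewrite mxE; apply: le_trans (ler_norm_sum _ _ _) _.
apply: (@le_trans _ _ (s * `|v|)); last by rewrite ler_wpM2r// lerDr.
rewrite /s mulr_suml; apply: ler_sum => i _; rewrite normrM mulrC.
apply: ler_pM => //; last exact: normr_coord.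
by rewrite (bigD1 j)//= lerDl sumr_ge0.
Qed.

End MeanValue.

Section InverseFunction.
Context {R : realType} {n : nat}.
Variables (U : set 'rV[R]_n) (f : 'rV[R]_n -> 'rV[R]_n) (x0 : 'rV[R]_n).
Hypotheses (oU : open U) (fs : smooth_mx_on U f) (Ux0 : U x0).
Hypothesis (Ju : 'J f x0 \in unitmx).

Let fdiff x : U x -> differentiable f x.
Proof. exact: smooth_mx_diff fs. Qed.

Let unit_near : \forall x \near x0, U x /\ 'J f x \in unitmx.
Proof.
apply: filterI; first exact: (near_open oU Ux0).
have dets := smooth_det oU (smooth_jacobian oU fs).
have c := differentiable_continuous (smooth_diff dets Ux0).
have d0 : \det ('J f x0) != 0 by rewrite -unitfE.
have [e e0 ce] : exists2 e : R, 0 < e & forall x, ball x0 e x -> \det ('J f x) != 0.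
  by apply: ball_of_near; exact: (cvgr_neq0 _ c d0).
apply/nbhs_ballP; exists e; first exact: e0.
by move=> x /ce dx; apply: etrans dx; rewrite -unitfE; exact: unitmxE.
Qed.

Lemma near_continuous_bound (g : 'rV[R]_n -> R) (e : R) : smooth_on U g -> 0 < e ->
  \forall x \near x0, `|g x| <= `|g x0| + e.
Proof.
move=> gs e0; have c := differentiable_continuous (smooth_diff gs Ux0).
move: c => /cvgrPdist_lt /(_ e e0); apply: filterS => x /ltW.
rewrite distrC => xe; rewrite -[g x](subrK (g x0)) addrC.
by apply: le_trans (ler_normD _ _) _; rewrite lerD2l.
Qed.

(** The differential of x - f x *m ('J f x0)^-1 vanishes at x0, so that this map is a
    contraction near x0; hence f cannot shorten distances there by more than a
    constant factor. *)
Lemma inverse_function_estimate : exists (r K : R),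
  [/\ 0 < r, 0 < K,
      forall x, ball x0 r x -> U x /\ 'J f x \in unitmx &
      forall x y, ball x0 r x -> ball x0 r y -> `|y - x| <= K * `|f y - f x|].
Proof.
pose M := invmx ('J f x0); pose g x := x - f x *m M.
have gs : smooth_mx_on U g.
  move=> i j; apply: (@smooth_eq _ _ _ oU (fun x => x i j + - (\sum_l f x i l * M l j))).
    by move=> x _; rewrite !mxE.
  apply: smoothD => //; first by rewrite ord1; exact: smooth_coord.
  apply: smoothN => //; apply: smooth_sum => // l _; apply: smoothM => //.
  exact: smooth_cst.
have g0 i j : partial i (fun x => g x 0 j) x0 = 0.
  have E y : U y -> g y 0 j = y 0 j + - \sum_l f y 0 l * M l j.
    by move=> Uy; rewrite !mxE.
  have sl l : smooth_on U (fun y => f y 0 l * M l j).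
    by apply: smoothM => //; exact: smooth_cst.
  have ssum : smooth_on U (fun y => \sum_l f y 0 l * M l j).
    by apply: smooth_sum => // l _; exact: sl.
  have dl l := smooth_diff (sl l) Ux0.
  rewrite (partial_eq oU E i Ux0) partialD; first last.
  - exact: smooth_diff (smoothN oU ssum) Ux0.
  - exact: differentiable_coord.
  rewrite partialN; last exact: smooth_diff ssum Ux0.
  rewrite partial_sum// partial_coord.
  have <- : (1%:M : 'M[R]_n) i j = (j == i)%:R by rewrite !mxE eq_sym.
  rewrite -(mulmxV Ju) -/M mxE -sumrB; apply: big1 => l _.
  rewrite partialM; [|exact: smooth_diff (fs 0 l) Ux0|exact: differentiable_cst].
  by rewrite partial_cst mulr0 addr0 jacobianE ?subrr//; exact: fdiff.
(* partial derivatives below e make g a contraction with constant n * e <= 1/2 *)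
pose e : R := (2 * (n%:R + 1))^-1.
have e0 : 0 < e by rewrite invr_gt0 mulr_gt0// ltr_wpDl.
have : \forall x \near x0, forall i j, `|partial i (fun x => g x 0 j) x| <= e.
  apply: (@filter_forall _ _ (fun i x => forall j, `|partial i (fun x => g x 0 j) x| <= e) (nbhs x0) _) => i.
  apply: (@filter_forall _ _ (fun j x => `|partial i (fun x => g x 0 j) x| <= e) (nbhs x0) _) => j.
  have H := near_continuous_bound (smooth_partial i (gs 0 j)) e0.
  by apply: filterS H => x; rewrite g0 normr0 add0r.
move=> /(filterI unit_near) /ball_of_near [r r0 rP].
have [K K0 KP] := mulmx_bound M.
exists r, (2 * K); split; [exact: r0|exact: mulr_gt0|move=> x xr; exact: (rP x xr).1|].
move=> x y xr yr.
have gle : `|g y - g x| <= 2^-1 * `|y - x|.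
  apply: normr_le_coord; first by rewrite mulr_ge0.
  move=> j; have -> : (g y - g x) 0 j = g y 0 j - g x 0 j by rewrite !mxE.
  apply: (@le_trans _ _ (n%:R * e * `|y - x|)).
    apply: (@mean_value_ball _ _ (fun x => g x 0 j) x0 r) => [z zr|z i zr| |].
    - by apply: smooth_diff (gs 0 j) _; exact: (rP z zr).1.1.
    - exact: (rP z zr).2.
    - exact: xr.
    - exact: yr.
  apply: ler_wpM2r => //; rewrite /e invfM mulrCA ler_piMr//.
  by rewrite ler_pdivrMr ?mul1r ?lerDl// ltr_wpDl.
have E : y - x = (g y - g x) + (f y - f x) *m M.
  by rewrite /g mulmxBl; apply/rowP => i; rewrite !mxE; ring.
have := ler_normD (g y - g x) ((f y - f x) *m M); rewrite -E => yx.
have := KP (f y - f x); move: gle yx; move: `|_| `|y - x| `|_ *m _| `|_ - _|.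
move=> a b c d; lra.
Qed.

End InverseFunction.

Section InverseFunctionTheorem.
Context {R : realType} {n : nat}.
Variables (U : set 'rV[R]_n) (f : 'rV[R]_n -> 'rV[R]_n).
Hypotheses (oU : open U) (fs : smooth_mx_on U f).

Let fdiff x : U x -> differentiable f x.
Proof. exact: smooth_mx_diff fs. Qed.

(** For y close to f x0, the function |f - y|^2 has an interior minimum on a compact
    ball about x0. At a critical point 'J f annihilates f - y, which is therefore 0. *)
Lemma local_surjectivity (x0 : 'rV[R]_n) (r K : R) : 0 < r -> 0 < K ->
  (forall x : 'rV[R]_n, ball x0 r x -> U x /\ 'J f x \in unitmx) ->
  (forall x y : 'rV[R]_n, ball x0 r x -> ball x0 r y -> `|y - x| <= K * `|f y - f x|) ->
  exists2 d : R, 0 < d & forall y : 'rV[R]_n, ball (f x0) d y -> exists2 x : 'rV[R]_n, ball x0 r x & f x = y.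
Proof.
move=> r0 K0 rU rK; pose d := r / 2 / (K * (n%:R + 2)).
have n2 : 0 < n%:R + 2 :> R by rewrite ltr_wpDl.
have d0 : 0 < d by rewrite divr_gt0 ?mulr_gt0// divr_gt0.
exists d => // y yd.
pose Q (x : 'rV[R]_n) : R := \sum_i (f x 0 i - y 0 i) ^+ 2.
pose A := [set x : 'rV[R]_n | `|x0 - x| <= r / 2].
have Ar x : A x -> ball x0 r x.
  move=> Ax; rewrite -ball_normE /=; apply: le_lt_trans Ax _.
  by rewrite ltr_pdivrMr// ltr_pMr// ltr1n.
have Qs : smooth_on U Q.
  apply: smooth_sum => // i _; apply: smoothX => //; apply: smoothD => //.
  exact: smooth_cst.
have A0 : A x0 by rewrite /A /= subrr normr0 divr_ge0// ltW.
have cA : compact A.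
  have -> : A = closed_ball x0 (r / 2).
    by rewrite closed_ballE ?divr_gt0// /closed_ball_.
  apply: bounded_closed_compact; last exact: closed_ball_closed.
  exists (`|x0| + r / 2); split=> [|M xM x]; first exact: num_real.
  rewrite closed_ballE ?divr_gt0// /closed_ball_ /= => xr.
  have := ler_normB x0 (x0 - x); rewrite opprB addrC subrK => H.
  by apply: le_trans H _; apply: le_trans (ltW xM); rewrite lerD2l.
have cQ : {within A, continuous Q}.
  apply: continuous_in_subspaceT => x; rewrite inE => Ax.
  apply: differentiable_continuous; apply: smooth_diff Qs _.
  exact: (rU _ (Ar _ Ax)).1.
have [|x] := @EVT_min_rV R n Q A _ cA cQ; first by exists x0.
rewrite inE => Ax xmin; exists x; first exact: Ar.
have Qx : Q x <= n%:R * d ^+ 2.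
  apply: (@le_trans _ _ (Q x0)); first by apply: xmin; rewrite inE.
  rewrite /Q mulr_natl -[X in _ *+ X](card_ord n) -sumr_const; apply: ler_sum => i _.
  have B : `|f x0 0 i - y 0 i| <= d.
    move: yd; rewrite -ball_normE /= => yd'; apply: le_trans (ltW yd').
    by have := normr_coord (f x0 - y) i; rewrite !mxE.
  by rewrite -real_normK ?num_real// lerXn2r ?nnegrE// ltW.
have fyd : `|f x - y| <= (n%:R + 1) * d.
  have nd0 : 0 <= (n%:R + 1) * d by rewrite mulr_ge0 ?addr_ge0// ltW.
  apply: normr_le_coord => [//|i]; rewrite -ler_sqr ?nnegrE//.
  rewrite real_normK ?num_real//.
  apply: (@le_trans _ _ (Q x)).
    rewrite /Q (bigD1 i)//= !mxE lerDl; apply: sumr_ge0 => j _; exact: sqr_ge0.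
  apply: le_trans Qx _; rewrite [leRHS]exprMn ler_wpM2r ?sqr_ge0//.
  by have : 0 <= n%:R :> R by []; move: (n%:R : R) => m; nra.
(* the minimum is interior: f would move points of the boundary too far from y *)
have xr : `|x0 - x| < r / 2.
  have H := rK x x0 (Ar _ Ax) (ballxx _ r0).
  apply: le_lt_trans H _.
  have -> : r / 2 = K * ((n%:R + 2) * d).
    by rewrite /d; field; rewrite gt_eqF//= gt_eqF.
  rewrite ltr_pM2l//.
  have -> : f x0 - f x = (f x0 - y) - (f x - y) by rewrite opprB addrA subrK.
  apply: le_lt_trans (ler_normB _ _) _.
  have -> : (n%:R + 2) * d = d + (n%:R + 1) * d by ring.
  apply: ltr_leD; last exact: fyd.
  by move: yd; rewrite -ball_normE.
have dQ j : partial j Q x = 0.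
  pose e := (r / 2 - `|x0 - x|).
  have e0 : 0 < e by rewrite subr_gt0.
  pose q (t : R) := Q (x + t *: delta_mx 0 j).
  have inA t : t \in `](- e), e[%R -> A (x + t *: delta_mx 0 j).
    rewrite in_itv /= -ltr_norml => te; rewrite /A /= opprD addrA.
    apply: le_trans (ler_normB _ _) _; rewrite -lerBrDl normrZ.
    apply: le_trans (ltW te); rewrite -[leRHS]mulr1 ler_wpM2l//.
    apply: normr_le_coord => // i; rewrite mxE eqxx /=.
    by case: (_ == _); rewrite ?normr1 ?normr0.
  have dq t : t \in `](- e), e[%R -> is_derive t 1 q
      (\sum_i (delta_mx 0 j : 'rV[R]_n) 0 i * partial i Q (x + t *: delta_mx 0 j)).
    move=> te; apply: is_derive_line; apply: smooth_diff Qs _.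
    exact: (rU _ (Ar _ (inA t te))).1.
  have z0 : 0 \in `](- e), e[%R by rewrite in_itv /= oppr_lt0 e0.
  have : is_derive (0 : R) 1 q 0.
    apply: (@derive1_at_min R q (- e) e) => //.
    - by apply: (@le_trans _ _ 0); rewrite ?oppr_le0 ltW.
    - by move=> t /dq [].
    - move=> t te; rewrite /q scale0r addr0; apply: xmin; rewrite inE; exact: inA.
  move=> /@derive_val; rewrite (@derive_val _ _ _ _ _ _ _ (dq 0 z0)).
  rewrite (bigD1 j)//= big1 => [|i ij]; last by rewrite mxE (negbTE ij) mul0r.
  by rewrite mxE !eqxx mul1r addr0 scale0r addr0.
have Jx : ('J f x) *m (f x - y)^T = 0.
  apply/colP => j; rewrite !mxE.
  have Ux := (rU _ (Ar _ Ax)).1.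
  have dterm i : differentiable (fun x => f x 0 i - y 0 i) x.
    by apply: differentiableD; [exact: smooth_diff (fs 0 i) Ux|exact: differentiable_cst].
  have E : partial j Q x = \sum_i (2 * ('J f x j i * (f x 0 i - y 0 i))).
    have sq i : (fun x => (f x 0 i - y 0 i) ^+ 2)
        = (fun x => (f x 0 i - y 0 i) * (f x 0 i - y 0 i)).
      by apply/funext => z; rewrite expr2.
    rewrite partial_sum => [|i]; last by rewrite sq; exact: differentiableM.
    apply: eq_bigr => i _; rewrite sq.
    rewrite partialM// partialD; [|exact: smooth_diff (fs 0 i) Ux|exact: differentiable_cst].
    rewrite partial_cst addr0 jacobianE; [ring|exact: fdiff].
  move: (dQ j); rewrite E -mulr_sumr => /eqP; rewrite mulf_eq0 pnatr_eq0 /= => /eqP.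
  by move=> Z; rewrite -[RHS]Z; apply: eq_bigr => i _; rewrite !mxE.
have Ju := (rU _ (Ar _ Ax)).2.
have : (f x - y)^T = 0 by rewrite -(mulKmx Ju (f x - y)^T) Jx mulmx0.
by move=> /(congr1 trmx); rewrite trmxK trmx0 => /eqP; rewrite subr_eq0 => /eqP.
Qed.

(** A Lipschitz right inverse turns the first-order expansion of f into its own. *)
Lemma is_diff_inverse (psi : 'rV[R]_n -> 'rV[R]_n) (V : set 'rV[R]_n) (K : R) y :
  0 < K -> open V -> V y -> U (psi y) -> 'J f (psi y) \in unitmx ->
  (forall z, V z -> f (psi z) = z) ->
  (forall z, V z -> `|psi z - psi y| <= K * `|z - y|) ->
  is_diff y psi (mulmxr (invmx ('J f (psi y)))).
Proof.
move=> K0 oV Vy Ux Ju fpsi psiK; set x := psi y; set M := invmx _.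
have [C C0 CM] := mulmx_bound M.
apply: is_diff_eps => [|e e0].
  move=> v; apply: differentiable_continuous; apply: differentiable_mx => a b.
  apply: (@smooth_diff _ _ setT); last by [].
  apply: (@smooth_eq _ _ _ openT (fun x : 'rV[R]_n => \sum_l x a l * M l b)).
    by move=> z _; rewrite !mxE.
  apply: smooth_sum; first exact: openT.
  move=> l _; apply: smoothM; [exact: openT| |exact: smooth_cst].
  by rewrite ord1; exact: smooth_coord.
pose e' := e / (C * K).
have e'0 : 0 < e' by rewrite divr_gt0// mulr_gt0.
have := diff_eps (fdiff Ux) e'0 => /nbhs_ballP[d /= d0 dP].
have nearV : \forall h \near (0 : 'rV[R]_n), V (h + y).
  have [r r0 rV] := ball_of_near (near_open oV Vy).
  apply/nbhs_ballP; exists r; first exact: r0.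
  move=> h; rewrite -ball_normE /= sub0r normrN => hr; apply: rV.
  by rewrite -ball_normE /= opprD addrCA subrr addr0 normrN.
have nearK : \forall h \near (0 : 'rV[R]_n), `|h| < d / K.
  apply/nbhs_ballP; exists (d / K); first exact: divr_gt0.
  by move=> h; rewrite -ball_normE /= sub0r normrN.
near=> h.
have Vh : V (h + y) by near: h.
pose u := psi (h + y) - x.
have uh : `|u| <= K * `|h| by have := psiK _ Vh; rewrite addrK.
have hu : h = f (u + x) - f x by rewrite /u subrK !fpsi// addrK.
have du : `|f (u + x) - f x - 'd f x u| <= e' * `|u|.
  apply: dP; rewrite -ball_normE /= sub0r normrN.
  apply: le_lt_trans uh _; rewrite mulrC -ltr_pdivlMr//.
  by near: h.
have -> : psi (h + y) - psi y - mulmxr M h = - ((f (u + x) - f x - 'd f x u) *m M).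
  have dE : 'd f x u = u *m 'J f x by rewrite /jacobian mul_rV_lin1.
  rewrite -hu dE mulmxBl (mulmxK Ju) opprB /= /u /x.
  by [].
rewrite normrN; apply: le_trans (CM _) _.
have -> : e = C * (e' * K) by rewrite /e'; field; rewrite !gt_eqF.
rewrite -mulrA ler_pM2l// -mulrA; apply: le_trans du _.
by rewrite ler_pM2l.
Unshelve. all: by end_near. Qed.

(** The Jacobian matrix of the inverse is the inverse of 'J f at the image point, so
    that each order of differentiability of the inverse yields the next. *)
Theorem inverse_function x0 : U x0 -> 'J f x0 \in unitmx ->
  exists U1 V1 : set 'rV[R]_n, [/\ U1 x0, U1 `<=` U & diffeomorphism U1 V1 f].
Proof.
move=> Ux0 Ju; have [r [K [r0 K0 rU rK]]] := inverse_function_estimate oU fs Ux0 Ju.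
have [d d0 dS] := local_surjectivity r0 K0 rU rK.
pose B := ball x0 r : set 'rV[R]_n; pose V := ball (f x0) d : set 'rV[R]_n.
have oB : open B by exact: ball_open.
have oV : open V by exact: ball_open.
pose psi (y : 'rV[R]_n) := xget x0 [set x | B x /\ f x = y].
have psiP y : V y -> B (psi y) /\ f (psi y) = y.
  move=> Vy; have [x Bx fx] := dS y Vy.
  by apply: (@xgetPex _ x0 [set x | B x /\ f x = y]); exists x.
have BU x : B x -> U x by move=> Bx; exact: (rU x Bx).1.
have finj x x' : B x -> B x' -> f x = f x' -> x = x'.
  move=> Bx Bx' E; have := rK x x' Bx Bx'.
  by rewrite E subrr normr0 mulr0 normr_le0 subr_eq0 => /eqP.
have psi_diff y : V y -> is_diff y psi (mulmxr (invmx ('J f (psi y)))).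
  move=> Vy; have [By fy] := psiP y Vy.
  apply: (@is_diff_inverse psi V K).
  - exact: K0.
  - exact: oV.
  - exact: Vy.
  - exact: BU.
  - exact: (rU _ By).2.
  - by move=> z /psiP [].
  - move=> z Vz; have [Bz fz] := psiP z Vz; have := rK _ _ By Bz.
    by rewrite fz fy.
have psi_partial y i j : V y ->
    partial j (fun z => psi z 0 i) y = invmx ('J f (psi y)) j i.
  move=> Vy; have D := psi_diff y Vy.
  have [dd dE] := D.
  by rewrite -jacobianE// mxE dE /= -rowE mxE.
have invs : smooth_mx_on B (fun x => invmx ('J f x)).
  apply: smooth_invmx; [exact: oB| |move=> x Bx; exact: (rU x Bx).2].
  by apply: smooth_jacobian => [|i j s x /BU]; [exact: oB|exact: fs].
have psik k i : Ck k V (fun y => psi y 0 i).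
  elim: k i => [|k IH] i.
    apply/Ck0 => y Vy; apply: differentiable_entry.
    by case: (psi_diff y Vy).
  apply/CkS; split=> [y Vy|j].
    by apply: differentiable_entry; case: (psi_diff y Vy).
  apply: (@Ck_eq _ _ _ _ (fun y => invmx ('J f (psi y)) j i)).
  - exact: oV.
  - by move=> y Vy; rewrite psi_partial.
  apply: (@Ck_comp _ _ _ _ V B (fun x => invmx ('J f x) j i) psi).
  - exact: oV.
  - exact: oB.
  - by move=> y /psiP [].
  - by have /smooth_Ck := invs j i.
  - exact: IH.
exists [set x | B x /\ V (f x)], V; split.
- by split; [exact: ballxx|exact: ballxx].
- by move=> x [/BU].
- split=> //.
  + by apply: open_preim => // x Bx; exact/fdiff/BU.
  + by move=> i j s x [/BU Ux _]; exact: fs.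
  + exists psi; split.
    * by move=> i j; rewrite [i]ord1; apply/smooth_Ck => k; exact: psik.
    * move=> x [Bx Vx]; split=> //; have [By fy] := psiP _ Vx; exact: finj.
    * by move=> y Vy; have [By fy] := psiP y Vy; split=> //; split=> //=; rewrite fy.
Qed.

End InverseFunctionTheorem.

(** * Closed one-forms have local primitives *)

Section Antiderivative.
Context {R : realType}.

Lemma antiderivative (g : R -> R) (a b : R) :
  (forall t, a <= t <= b -> {for t, continuous g}) ->
  exists G : R -> R, forall t, a < t < b -> is_derive t 1 G (g t).
Proof.
move=> gc; exists (fun x => \int[lebesgue_measure]_(t in [set` `[a, x]]) (g t)).
move=> t /andP[at_ tb].
have [||D E] := @continuous_FTC1_closed R g a t b tb _ at_.
- apply: continuous_compact_integrable; first exact: segment_compact.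
  apply: continuous_in_subspaceT => x; rewrite inE /= in_itv /=; exact: gc.
- by apply: gc; rewrite !ltW.
- by apply: DeriveDef; [exact: D|rewrite -E derive1E].
Qed.

End Antiderivative.

Section Taylor.
Context {R : realType} {n : nat}.

Lemma is_derive_mulr (c t : R) : is_derive t 1 (fun s : R => s * c) c.
Proof.
have D : is_derive t 1 (@idfun R) 1 by exact: is_derive_id.
have H := @is_deriveM R R (@idfun R) (cst c) t 1 1 0 D (is_derive_cst _ _ _).
rewrite (_ : (fun s => s * c) = @idfun R * cst c)//.
by apply: is_derive_eq H _; rewrite scaler0 add0r -[LHS]/(c * 1) mulr1.
Qed.

Lemma taylor1_ball (F : 'rV[R]_n -> R) (x0 : 'rV[R]_n) (r M : R) : 0 <= M ->
  (forall x : 'rV[R]_n, ball x0 r x -> differentiable F x) ->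
  (forall (x : 'rV[R]_n) i, ball x0 r x -> differentiable (partial i F) x) ->
  (forall (x : 'rV[R]_n) i j, ball x0 r x -> `|partial j (partial i F) x| <= M) ->
  forall x v : 'rV[R]_n, ball x0 r x -> ball x0 r (x + v) ->
  `|F (x + v) - F x - \sum_i v 0 i * partial i F x| <= n%:R ^+ 2 * M * `|v| ^+ 2.
Proof.
move=> M0 dF ddF FM x v xr xvr.
pose D := \sum_i v 0 i * partial i F x.
pose T (s : R) := F (x + s *: v) - s * D.
have seg (s : R) : 0 <= s <= 1 -> ball x0 r (x + s *: v).
  by move=> s01; have := ball_segment s01 xr xvr; rewrite [x + v - x]addrAC subrr add0r.
have -> : F (x + v) - F x - D = T 1 - T 0.
  by rewrite /T scale1r scale0r mul1r mul0r subr0 addr0 addrAC.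
rewrite -[leRHS]mulr1 -[X in _ * X](subr0 (1 : R)).
apply: (@mvt_le R T (fun s => \sum_i v 0 i * partial i F (x + s *: v) - D)) => //.
  move=> s s01; apply: is_deriveB.
    by apply: is_derive_line; exact/dF/seg.
  exact: is_derive_mulr.
move=> s s01; rewrite /D -sumrB.
apply: le_trans (ler_norm_sum _ _ _) _.
rewrite expr2 -!mulrA mulr_natl -[X in _ *+ X](card_ord n) -sumr_const.
apply: ler_sum => i _; rewrite -mulrBr normrM.
apply: (@le_trans _ _ (`|v| * (n%:R * M * `|v|))); last first.
  by rewrite expr2 le_eqVlt; apply/orP; left; apply/eqP; ring.
apply: ler_pM => //; first exact: normr_coord.
have := @mean_value_ball R n (partial i F) x0 r M _ _ x (x + s *: v) xr (seg s s01).
move=> /(_ (fun z => ddF z i) (fun z j => FM z i j)) H; apply: le_trans H _.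
rewrite [x + _ - x]addrAC subrr add0r; apply: ler_wpM2l; first by rewrite mulr_ge0.
rewrite normrZ; case/andP: s01 => s0 s1; rewrite ger0_norm//.
by rewrite ler_piMl.
Qed.

End Taylor.

Section Poincare.
Context {R : realType} {n : nat}.

Lemma is_derive_eq0_cst (f : R -> R) (a b : R) :
  (forall t, a < t < b -> is_derive t 1 f 0) ->
  forall s t, a < s < b -> a < t < b -> f s = f t.
Proof.
move=> df; suff W s t : a < s < b -> a < t < b -> s <= t -> f s = f t.
  move=> s t sab tab; have [st|ts] := leP s t; first exact: W.
  by apply/esym/W => //; exact: ltW.
move=> /andP[as_ sb] /andP[at_ tb] st; apply/eqP; rewrite eq_sym -subr_eq0 -normr_le0.
rewrite -[leRHS](mul0r (t - s)); apply: (@mvt_le R f (fun=> 0)) => //.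
  move=> z /andP[sz zt]; apply: df; apply/andP; split.
    exact: lt_le_trans as_ sz.
  exact: le_lt_trans zt tb.
by move=> z _; rewrite normr0.
Qed.

Variables (U : set 'rV[R]_n) (th : 'I_n -> 'rV[R]_n -> R).
Hypotheses (oU : open U) (ths : forall i, smooth_on U (th i)).
Hypothesis closed_th : forall i j x, U x -> partial i (th j) x = partial j (th i) x.

Lemma local_derivative_bounds (x0 : 'rV[R]_n) : U x0 ->
  exists (r M : R), [/\ 0 < r, 0 <= M, forall x : 'rV[R]_n, ball x0 r x -> U x,
    forall (x : 'rV[R]_n) i j, ball x0 r x -> `|partial j (th i) x| <= M &
    forall (x : 'rV[R]_n) i j l, ball x0 r x -> `|partial l (partial j (th i)) x| <= M].
Proof.
move=> Ux0.
have bnd (m : nat) (g : 'I_m -> 'rV[R]_n -> R) : (forall i, smooth_on U (g i)) ->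
    \forall x \near x0, forall i, `|g i x| <= \sum_i (`|g i x0| + 1).
  move=> gs; apply: (@filter_forall _ _ (fun i x => `|g i x| <= \sum_i (`|g i x0| + 1)) (nbhs x0) _) => i.
  have H := near_continuous_bound Ux0 (gs i) ltr01.
  apply: filterS H => x; move/le_trans; apply.
  by rewrite (bigD1 i)//= lerDl sumr_ge0.
have H1 := bnd #|{: 'I_n * 'I_n}| (fun k => partial (enum_val k).2 (th (enum_val k).1)).
have H2 := bnd #|{: 'I_n * 'I_n * 'I_n}| (fun k => partial (enum_val k).2
  (partial (enum_val k).1.2 (th (enum_val k).1.1))).
have {}H1 := H1 (fun k => smooth_partial (enum_val k).2 (ths _)).
have {}H2 := H2 (fun k => smooth_partial (enum_val k).2 (smooth_partial _ (ths _))).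
move: H1 H2; set M1 := \sum_i _; set M2 := \sum_i _ => H1 H2.
have M10 : 0 <= M1 by apply: sumr_ge0 => i _; rewrite addr_ge0.
have M20 : 0 <= M2 by apply: sumr_ge0 => i _; rewrite addr_ge0.
have [r r0 rP] := ball_of_near (filterI (near_open oU Ux0) (filterI H1 H2)).
exists r, (M1 + M2); split=> //; first exact: addr_ge0.
- by move=> x /rP [].
- move=> x i j /rP [_ [/(_ (enum_rank (i, j)))]]; rewrite enum_rankK /= => H _.
  by apply: le_trans H _; rewrite lerDl.
- move=> x i j l /rP [_ [_ /(_ (enum_rank (i, j, l)))]]; rewrite enum_rankK /= => H.
  by apply: le_trans H _; rewrite lerDr.
Qed.

(** The primitive is the radial integral F x = int_0^1 th (x0 + t (x - x0)) (x - x0) dt.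
    Instead of differentiating under the integral sign, one compares integrands: by
    closedness, the integrand for x + h minus that for x is the t-derivative of
    t * th (x0 + t (x - x0)) h up to an error of second order in h, so that
    F (x + h) - F x = th x h + O (|h|^2). *)
Theorem poincare (x0 : 'rV[R]_n) : U x0 -> exists (r : R) (F : 'rV[R]_n -> R),
  [/\ 0 < r, forall x : 'rV[R]_n, ball x0 r x -> U x, smooth_on (ball x0 r : set 'rV[R]_n) F &
      forall (x : 'rV[R]_n) i, ball x0 r x -> partial i F x = th i x].
Proof.
move=> Ux0; have [r [M [r0 M0 rU M1 M2]]] := local_derivative_bounds Ux0.
pose g (x : 'rV[R]_n) (t : R) := \sum_i (x - x0) 0 i * th i (x0 + t *: (x - x0)).
(* the radial segment can be prolonged a little at both ends, so that the
     antiderivative is differentiable on the closed interval [0, 1] *)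
have mem_ball (x : 'rV[R]_n) : ball x0 r x -> exists2 e : R, 0 < e &
    forall t : R, - e <= t <= 1 + e -> ball x0 r (x0 + t *: (x - x0)).
  rewrite -ball_normE /= -normrN opprB => xr.
  pose d := `|x - x0| + r.
  have d0 : 0 < d by rewrite ltr_wpDl.
  exists ((r - `|x - x0|) / (2 * d)); first by rewrite divr_gt0 ?mulr_gt0// subr_gt0.
  move=> t /andP[t1 t2]; rewrite /= opprD addrA subrr sub0r normrN normrZ.
  set e := (_ / _) in t1 t2.
  have e0 : 0 <= e by apply: ltW; rewrite divr_gt0 ?mulr_gt0// subr_gt0.
  have te : `|t| <= 1 + e by rewrite ler_norml t2 andbT; apply: le_trans t1; rewrite lerN2 lerDr.
  apply: (@le_lt_trans _ _ ((1 + e) * `|x - x0|)); first by rewrite ler_wpM2r.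
  have -> : r = `|x - x0| + e * (2 * d).
    by rewrite /e divfK ?gt_eqF ?mulr_gt0// addrC subrK.
  rewrite mulrDl mul1r ltrD2l ltr_pM2l ?divr_gt0 ?mulr_gt0 ?subr_gt0//.
  rewrite /d; apply: (@lt_le_trans _ _ (`|x - x0| + r)); first by rewrite ltrDl.
  by rewrite ler_peMl// ?ler1n// ltW.
have gG (x : 'rV[R]_n) : exists G : R -> R, ball x0 r x ->
    forall t : R, 0 <= t <= 1 -> is_derive t 1 G (g x t).
  have [xr|xr] := pselect (ball x0 r x); last by exists (fun=> 0).
  have [e e0 eP] := mem_ball x xr.
  have gc (t : R) : - e <= t <= 1 + e -> {for t, continuous (g x)}.
    move=> te; apply: differentiable_continuous; have Bt := eP t te.
    have -> : g x = \sum_(i < n) (fun t => (x - x0) 0 i * th i (x0 + t *: (x - x0))).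
      by apply/funext => s; rewrite fct_sumE.
    apply: differentiable_sum => i; apply: differentiableM; first exact: differentiable_cst.
    apply/derivable1_diffP.
    by have [] := is_derive_line (smooth_diff (ths i) (rU _ Bt)).
  have [G GP] := antiderivative gc; exists G => _ t /andP[t0 t1]; apply: GP.
  by apply/andP; split; [rewrite (lt_le_trans _ t0)// oppr_lt0|rewrite (le_lt_trans t1)// ltrDl].
pose G x := projT1 (cid (gG x)).
have GP (x : 'rV[R]_n) : ball x0 r x ->
    forall t : R, 0 <= t <= 1 -> is_derive t 1 (G x) (g x t) := projT2 (cid (gG x)).
pose F (x : 'rV[R]_n) := G x 1 - G x 0.
(* the constant of the second-order estimate, from the Taylor and mean value
     inequalities for the components of th *)
pose C := n%:R * r * (n%:R ^+ 2 * M) + n%:R * (n%:R * M).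
have FC (x h : 'rV[R]_n) : ball x0 r x -> ball x0 r (x + h) ->
    `|F (x + h) - F x - \sum_i h 0 i * th i x| <= C * `|h| ^+ 2.
  move=> xr xhr; pose y (t : R) := x0 + t *: (x - x0).
  have seg (t : R) : 0 <= t <= 1 -> ball x0 r (y t).
    by move=> t01; exact: ball_segment (ballxx _ r0) xr.
  have yh (t : R) : x0 + t *: (x + h - x0) = y t + t *: h.
    by apply/rowP => i; rewrite !mxE; ring.
  have seg' (t : R) : 0 <= t <= 1 -> ball x0 r (y t + t *: h).
    by move=> t01; rewrite -yh; exact: ball_segment (ballxx _ r0) xhr.
  pose P (t : R) := \sum_i h 0 i * th i (y t).
  pose E (t : R) := G (x + h) t - G x t - t * P t.
  have -> : F (x + h) - F x - \sum_i h 0 i * th i x = E 1 - E 0.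
    rewrite /E /F /P /y mul1r mul0r scale1r [x0 + (x - x0)]addrC subrK.
    by move: (G _ _) (G _ _) (G _ _) (G _ _) (\sum_i _) => a b c d e; ring.
  rewrite -[leRHS]mulr1 -[X in _ * X](subr0 (1 : R)).
  pose dP (t : R) := \sum_i h 0 i * (\sum_j (x - x0) 0 j * partial j (th i) (y t)).
  apply: (@mvt_le R E (fun t => g (x + h) t - g x t - (P t + t * dP t))) => //.
    move=> t t01; apply: is_deriveB; first by apply: is_deriveB; exact: GP.
    have Pd : is_derive t 1 P (dP t).
      have -> : P = \sum_(i < n) (fun t => h 0 i * th i (y t)).
        by apply/funext => s; rewrite fct_sumE.
      apply: is_derive_sum => i.
      have L := is_derive_line (smooth_diff (ths i) (rU _ (seg t t01))).
      have := @is_deriveZ R R R (fun t => th i (y t)) (h 0 i) t 1 _ L.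
      by [].
    have := @is_deriveM R R (@idfun R) P t 1 1 (dP t) (is_derive_id _ _) Pd.
    move=> H; apply: is_derive_eq H _.
    by rewrite addrC -[P t *: _]/(P t * 1) mulr1.
  move=> t t01; have yt := seg t t01; have yt' := seg' t t01.
  have -> : g (x + h) t - g x t - (P t + t * dP t)
    = \sum_j ((x - x0) 0 j * (th j (y t + t *: h) - th j (y t)
                             - \sum_i (t *: h) 0 i * partial i (th j) (y t))
      + h 0 j * (th j (y t + t *: h) - th j (y t))).
    have -> : dP t = \sum_j (x - x0) 0 j * (\sum_i h 0 i * partial i (th j) (y t)).
      rewrite /dP.
      under eq_bigr do rewrite mulr_sumr.
      rewrite exchange_big; apply: eq_bigr => j _; rewrite mulr_sumr; apply: eq_bigr => i _.
      by rewrite mulrCA (closed_th i j) //; exact: rU.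
    rewrite /g /P yh mulr_sumr opprD addrA -!sumrB; apply: eq_bigr => j _.
    have -> : \sum_i (t *: h) 0 i * partial i (th j) (y t)
        = t * \sum_i h 0 i * partial i (th j) (y t).
      by rewrite mulr_sumr; apply: eq_bigr => i _; rewrite mxE mulrA.
    rewrite !mxE; move: (th _ _) (th _ _) (\sum_i _) => a b c; ring.
  have th1 : `|t *: h| <= `|h|.
    by rewrite normrZ; case/andP: t01 => t0 t1; rewrite ger0_norm// ler_piMl.
  apply: le_trans (ler_norm_sum _ _ _) _.
  have -> : C * `|h| ^+ 2 = \sum_(j < n)
      (r * (n%:R ^+ 2 * M * `|h| ^+ 2) + `|h| * (n%:R * M * `|h|)).
    rewrite sumr_const card_ord -mulr_natl /C; ring.
  apply: ler_sum => j _; apply: le_trans (ler_normD _ _) _; rewrite !normrM.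
  have nM : 0 <= n%:R ^+ 2 * M by rewrite mulr_ge0 ?sqr_ge0.
  apply: lerD; apply: ler_pM => //; last 2 first.
  - exact: normr_coord.
  - have H := @mean_value_ball R n (th j) x0 r M _ _ (y t) (y t + t *: h) yt yt'.
    have := H (fun z Bz => smooth_diff (ths j) (rU z Bz)) (fun z l Bz => M1 z j l Bz).
    rewrite [y t + _ - _]addrAC subrr add0r => {}H; apply: le_trans H _.
    by apply: ler_wpM2l => //; rewrite mulr_ge0.
  - apply: le_trans (normr_coord _ _) _.
    by move: xr; rewrite -ball_normE /= -normrN opprB => /ltW.
  - have H := @taylor1_ball R n (th j) x0 r M M0 _ _ _ (y t) (t *: h) yt yt'.
    have := H (fun z Bz => smooth_diff (ths j) (rU z Bz))
      (fun z l Bz => smooth_diff (smooth_partial l (ths j)) (rU z Bz))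
      (fun z l m Bz => M2 z j l m Bz).
    move=> {}H; apply: le_trans H _; apply: ler_wpM2l => //.
    by rewrite lerXn2r ?nnegrE.
have C0 : 0 <= C.
  by rewrite /C addr_ge0 ?mulr_ge0// ?sqr_ge0// ltW.
pose df x (v : 'rV[R]_n) := \sum_i v 0 i * th i x.
have dflin x : linear (df x).
  move=> a u v; rewrite /df scaler_sumr -big_split; apply: eq_bigr => i _.
  by rewrite !mxE mulrDl -mulrA.
pose dfM x := GRing.isLinear.Build _ _ _ _ _ (dflin x).
pose dfL x : {linear 'rV[R]_n -> R} := HB.pack (df x) (dfM x).
have Fdiff (x : 'rV[R]_n) : ball x0 r x -> is_diff x F (dfL x).
  move=> xr; apply: is_diff_eps.
    move=> v; apply: differentiable_continuous.
    have -> : (dfL x : 'rV[R]_n -> R) = (fun v => \sum_i v 0 i * th i x) by [].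
    apply: (@smooth_diff _ _ setT) => //; apply: smooth_sum => [|i _]; first exact: openT.
    by apply: smoothM; [exact: openT|exact: smooth_coord|exact: smooth_cst].
  move=> e e0.
  have oB : open (ball x0 r : set 'rV[R]_n) by exact: ball_open.
  have [d d0 dP] := ball_of_near (near_open oB xr).
  pose d' := Num.min d (e / (C + 1)).
  have d'0 : 0 < d' by rewrite lt_min d0 divr_gt0// ltr_wpDl.
  apply/nbhs_ballP; exists d' => // h; rewrite -ball_normE /= sub0r normrN lt_min => /andP[hd he].
  rewrite [h + x]addrC.
  have xhr : ball x0 r (x + h).
    by apply: dP; rewrite -ball_normE /= opprD addrA subrr sub0r normrN.
  apply: le_trans (FC x h xr xhr) _; rewrite expr2 mulrA ler_wpM2r//.
  move: he; rewrite ltr_pdivlMr ?ltr_wpDl// => he; apply: le_trans (ltW he).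
  by rewrite mulrC; apply: ler_wpM2l => //; rewrite lerDl.
have Fpart (x : 'rV[R]_n) i : ball x0 r x -> partial i F x = th i x.
  move=> xr; have [dF E] := Fdiff x xr.
  rewrite partialE// E /= /df (bigD1 i)//= big1 => [|j ji].
    by rewrite mxE !eqxx mul1r addr0.
  by rewrite mxE (negbTE ji) andbF mul0r.
exists r, F; split=> //; apply: smooth_intro.
  by move=> x /Fdiff [].
move=> i; apply: (@smooth_eq _ _ _ _ (th i)); first exact: ball_open.
  by move=> x xr; rewrite Fpart.
by move=> s x /rU; exact: ths.
Qed.

End Poincare.

(** * Integral curves of a smooth vector field *)

Section Picard.
Context {R : realType}.

(** The intervals of radius 2 C / 2^k about u k are nested; the supremum of their left
    ends lies in all of them. *)
Lemma geometric_limit (u : nat -> R) (C : R) : 0 <= C ->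
  (forall k, `|u k.+1 - u k| <= C / 2 ^+ k) ->
  exists l, forall k, `|l - u k| <= 2 * C / 2 ^+ k.
Proof.
move=> C0 uC; pose e k := C / 2 ^+ k.
have eS k : e k = 2 * e k.+1 by rewrite /e exprS; field; rewrite expf_neq0.
have e0 k : 0 <= e k by rewrite /e divr_ge0// exprn_ge0.
have lo k m : u k - 2 * e k <= u (k + m)%N - 2 * e (k + m)%N.
  elim: m => [|m IH]; first by rewrite addn0.
  apply: le_trans IH _; rewrite addnS; have := uC (k + m)%N.
  rewrite -/(e _) ler_norml => /andP[H _].
  have := eS (k + m)%N; move: H; move: (e _) (e _) (u _) (u _) => a b c d; lra.
have hi k m : u (k + m)%N + 2 * e (k + m)%N <= u k + 2 * e k.
  elim: m => [|m IH]; first by rewrite addn0.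
  apply: le_trans IH; rewrite addnS; have := uC (k + m)%N.
  rewrite -/(e _) ler_norml => /andP[_ H].
  have := eS (k + m)%N; move: H; move: (e _) (e _) (u _) (u _) => a b c d; lra.
have cross k m : u k - 2 * e k <= u m + 2 * e m.
  have := lo k m; have := hi m k; rewrite addnC; have := e0 (k + m)%N.
  by move: (e _) (u (k + m)%N) => a b; lra.
pose A := [set x | exists k, x = u k - 2 * e k].
have ubA m : ubound A (u m + 2 * e m) by move=> x [k ->].
exists (sup A) => k.
have H1 : u k - 2 * e k <= sup A.
  by apply: ub_le_sup; [exists (u k + 2 * e k); exact: ubA|exists k].
have H2 : sup A <= u k + 2 * e k.
  by apply: ge_sup; [exists (u k - 2 * e k), k|exact: ubA].
have -> : 2 * C / 2 ^+ k = 2 * e k by rewrite /e mulrA.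
by rewrite ler_norml; apply/andP; split; lra.
Qed.

Lemma is_derive_rV n (c : R -> 'rV[R]_n) (d : 'rV[R]_n) (t : R) :
  (forall i, is_derive t 1 (fun s => c s 0 i) (d 0 i)) -> is_derive t 1 c d.
Proof.
move=> H; have dc : derivable c t 1.
  by apply/derivable_mxP => i j; rewrite ord1; case: (H j).
apply: DeriveDef => //; rewrite derive_mx//; apply/rowP => j; rewrite mxE.
by have [_ ->] := H j.
Qed.

Lemma is_derive_rV_coord n (c : R -> 'rV[R]_n) (d : 'rV[R]_n) (t : R) i :
  is_derive t 1 c d -> is_derive t 1 (fun s => c s 0 i) (d 0 i).
Proof.
move=> [dc E]; have di : derivable (fun s => c s 0 i) t 1.
  by move: dc => /derivable_mxP.
by apply: DeriveDef => //; rewrite -E derive_mx// mxE.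
Qed.

Lemma mvt_le_rV n (c dc : R -> 'rV[R]_n) (b K : R) : 0 <= K ->
  (forall t : R, `|t| <= b -> is_derive t 1 c (dc t)) ->
  (forall t : R, `|t| <= b -> `|dc t| <= K) ->
  forall s t : R, `|s| <= b -> `|t| <= b -> `|c t - c s| <= K * `|t - s|.
Proof.
move=> K0 cd dK; suff W (s t : R) : `|s| <= b -> `|t| <= b -> s <= t ->
    `|c t - c s| <= K * (t - s).
  move=> s t sb tb; have [st|ts] := leP s t.
    by rewrite [X in _ * X]ger0_norm ?subr_ge0//; exact: W.
  rewrite distrC [X in _ * X]distrC [X in _ * X]ger0_norm ?subr_ge0 ?(ltW ts)//.
  by apply: W => //; exact: ltW.
rewrite !ler_norml => /andP[s1 s2] /andP[t1 t2] st.
apply: normr_le_coord => [|i]; first by rewrite mulr_ge0// subr_ge0.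
rewrite !mxE; apply: (@mvt_le R (fun s => c s 0 i) (fun s => dc s 0 i)) => // z /andP[sz zt].
  by apply: is_derive_rV_coord; apply: cd; rewrite ler_norml; apply/andP; split; lra.
apply: le_trans (normr_coord _ _) _; apply: dK.
by rewrite ler_norml; apply/andP; split; lra.
Qed.

Lemma antiderivative_rV n (g : R -> 'rV[R]_n) (b : R) :
  (forall t : R, {for t, continuous g}) ->
  exists G : R -> 'rV[R]_n, forall t : R, `|t| <= b -> is_derive t 1 G (g t).
Proof.
move=> gc; have H i : exists G : R -> R, forall t : R, - (b + 1) < t < b + 1 ->
    is_derive t 1 G (g t 0 i).
  apply: antiderivative => t _.
  by apply: (@continuous_comp _ _ _ g (fun M : 'rV[R]_n => M 0 i)); [exact: gc|exact: coord_continuous].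
exists (fun t => \row_i projT1 (cid (H i)) t) => t; rewrite ler_norml => /andP[t1 t2].
apply: is_derive_rV => i; have := projT2 (cid (H i)).
set G := projT1 _ => GP.
have -> : (fun s => (\row_i0 projT1 (cid (H i0)) s) 0 i) = G by apply/funext => s; rewrite mxE.
by apply: GP; apply/andP; split; lra.
Qed.

Lemma continuous_cauchy_rV n (g : R -> 'rV[R]_n) (K : R) : 0 <= K ->
  (forall s t : R, `|g t - g s| <= K * `|t - s|) -> forall t : R, {for t, continuous g}.
Proof.
move=> K0 gK t; apply/cvgrPdist_le => e e0.
apply/nbhs_ballP; exists (e / (K + 1)) => /=; first by rewrite divr_gt0// ltr_wpDl.
move=> s; rewrite /ball /= => ts; apply: le_trans (gK _ _) _.
move: ts; rewrite ltr_pdivlMr ?ltr_wpDl// => ts; apply: le_trans (ltW ts).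
by rewrite mulrC ler_wpM2l// lerDl.
Qed.

(** Precomposition with the retraction of the line onto [-a, a] lets the Picard
    operator act on curves that are defined for all times. *)
Definition clamp (a t : R) := if t <= - a then - a else if a <= t then a else t.

Lemma clamp_le (a t : R) : 0 <= a -> `|clamp a t| <= a.
Proof.
move=> a0; rewrite /clamp ler_norml.
by case: ifPn; [|rewrite -ltNge => ?; case: ifPn; [|rewrite -ltNge]] => ?; lra.
Qed.

Lemma clamp_id (a t : R) : `|t| <= a -> clamp a t = t.
Proof.
rewrite ler_norml /clamp => /andP[t1 t2].
by case: ifPn => [?|_]; [lra|case: ifPn => // ?; lra].
Qed.

Lemma clamp_lip (a s t : R) : 0 <= a -> `|clamp a t - clamp a s| <= `|t - s|.
Proof.
move=> a0; have : - `|t - s| <= t - s <= `|t - s| by rewrite -ler_norml.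
rewrite ler_norml /clamp; move: `|t - s| => d /andP[d1 d2].
by do 2 (case: ifPn; [|rewrite -ltNge => ?; case: ifPn; [|rewrite -ltNge]] => ?);
  apply/andP; split; lra.
Qed.

(** Picard iteration on Lipschitz curves that stay within r / 2 of x0. The bound [aM]
    on the time a keeps the iterates there and the bound [aL] makes the Picard
    operator halve distances. *)
Theorem picard n (U : set 'rV[R]_n) (k : 'rV[R]_n -> 'rV[R]_n) (x0 : 'rV[R]_n) :
  open U -> smooth_mx_on U k -> U x0 ->
  exists (a : R) (c : R -> 'rV[R]_n),
    [/\ 0 < a, c 0 = x0 & integral_curve k U (- a) a c].
Proof.
move=> oU ks Ux0; pose th i x := k x 0 i.
have ths i : smooth_on U (th i) by exact: ks.
have B0 : \forall x \near x0, forall i, `|th i x| <= \sum_i (`|th i x0| + 1).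
  apply: (@filter_forall _ _ (fun i x => `|th i x| <= \sum_i (`|th i x0| + 1)) (nbhs x0) _) => i.
  have H := near_continuous_bound Ux0 (ths i) ltr01.
  apply: filterS H => x; move/le_trans; apply.
  by rewrite (bigD1 i)//= lerDl sumr_ge0.
have B1 : \forall x \near x0, forall i j, `|partial j (th i) x| <=
    \sum_i \sum_j (`|partial j (th i) x0| + 1).
  apply: (@filter_forall _ _ (fun i x => forall j, `|partial j (th i) x| <=
    \sum_i \sum_j (`|partial j (th i) x0| + 1)) (nbhs x0) _) => i.
  apply: (@filter_forall _ _ (fun j x => `|partial j (th i) x| <=
    \sum_i \sum_j (`|partial j (th i) x0| + 1)) (nbhs x0) _) => j.
  have H := near_continuous_bound Ux0 (smooth_partial j (ths i)) ltr01.
  apply: filterS H => x; move/le_trans; apply.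
  rewrite (bigD1 i)//= (bigD1 j)//= -addrA lerDl addr_ge0//.
    by apply: sumr_ge0 => l _; rewrite addr_ge0.
  by apply: sumr_ge0 => l _; apply: sumr_ge0 => m _; rewrite addr_ge0.
move: B0 B1; set L0 := \sum_i \sum_j _; set M0 := \sum_i _ => B0 B1.
have M00 : 0 <= M0 by apply: sumr_ge0 => i _; rewrite addr_ge0.
have L00 : 0 <= L0.
  by apply: sumr_ge0 => i _; apply: sumr_ge0 => j _; rewrite addr_ge0.
have [r r0 rP] := ball_of_near (filterI (near_open oU Ux0) (filterI B0 B1)).
have rU (x : 'rV[R]_n) : ball x0 r x -> U x by move=> /rP [].
pose M := M0 + 1; pose L := n%:R * L0 + 1.
have Mp : 0 < M by rewrite ltr_wpDl.
have Lp : 0 < L by rewrite ltr_wpDl// mulr_ge0.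
have kM (x : 'rV[R]_n) : ball x0 r x -> `|k x| <= M.
  move=> /rP [_ [H _]]; apply: normr_le_coord => [|i]; first exact: ltW.
  by apply: le_trans (H i) _; rewrite lerDl.
have kL (x y : 'rV[R]_n) : ball x0 r x -> ball x0 r y -> `|k y - k x| <= L * `|y - x|.
  move=> xr yr; apply: normr_le_coord => [|i]; first by rewrite mulr_ge0// ltW.
  rewrite !mxE; apply: (@le_trans _ _ (n%:R * L0 * `|y - x|)).
    apply: (@mean_value_ball R n (th i) x0 r L0) => //.
      by move=> z /rU; exact: smooth_diff.
    by move=> z j /rP [_ [_]]; exact.
  by apply: ler_wpM2r => //; rewrite lerDl.
pose a := Num.min (r / (2 * M)) ((2 * L)^-1).
have a0 : 0 < a by rewrite lt_min divr_gt0 ?mulr_gt0// invr_gt0 mulr_gt0.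
have aM : M * a <= r / 2.
  have : a <= r / (2 * M) by rewrite ge_min lexx.
  rewrite -(ler_pM2l Mp); move/le_trans; apply.
  by rewrite le_eqVlt; apply/orP; left; apply/eqP; field; rewrite gt_eqF.
have aL : L * a <= 2^-1.
  have : a <= (2 * L)^-1 by rewrite ge_min lexx orbT.
  rewrite -(ler_pM2l Lp); move/le_trans; apply.
  by rewrite le_eqVlt; apply/orP; left; apply/eqP; field; rewrite gt_eqF.
pose good (c : R -> 'rV[R]_n) :=
  (forall t : R, `|c t - x0| <= r / 2) /\ (forall s t : R, `|c t - c s| <= M * `|t - s|).
have inB (c : R -> 'rV[R]_n) : good c -> forall t, ball x0 r (c t).
  move=> [cr _] t; rewrite -ball_normE /= -normrN opprB; apply: le_lt_trans (cr t) _.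
  by rewrite ltr_pdivrMr// ltr_pMr// ltr1n.
have kc (c : R -> 'rV[R]_n) : good c -> forall t : R, {for t, continuous (k \o c)}.
  move=> gc; apply: (@continuous_cauchy_rV _ _ (L * M)).
    by rewrite mulr_ge0// ltW.
  move=> s t; apply: le_trans (kL _ _ (inB c gc s) (inB c gc t)) _.
  by rewrite -mulrA; apply: ler_wpM2l; [exact: ltW|exact: gc.2].
have step (c : R -> 'rV[R]_n) : exists c' : R -> 'rV[R]_n, good c ->
    good c' /\ exists G : R -> 'rV[R]_n,
      (forall t : R, `|t| <= a -> is_derive t 1 G (k (c t))) /\
      forall t, c' t = x0 + (G (clamp a t) - G 0).
  have [gc|ngc] := pselect (good c); last by exists c.
  have [G GP] := antiderivative_rV a (kc c gc).
  exists (fun t => x0 + (G (clamp a t) - G 0)) => _; split; last by exists G.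
  have a00 : `|0 : R| <= a by rewrite normr0 ltW.
  have GM (s t : R) : `|s| <= a -> `|t| <= a -> `|G t - G s| <= M * `|t - s|.
    apply: (@mvt_le_rV _ G (k \o c)) => //; first exact: ltW.
    by move=> z _; apply: kM; exact: inB.
  have ca z := clamp_le z (ltW a0).
  split=> [t|s t].
    rewrite [x0 + _]addrC addrK; apply: le_trans (GM _ _ a00 (ca t)) _.
    apply: le_trans aM; rewrite subr0 ler_wpM2l ?(ltW Mp)//.
  have -> : x0 + (G (clamp a t) - G 0) - (x0 + (G (clamp a s) - G 0))
    = G (clamp a t) - G (clamp a s) by apply/rowP => i; rewrite !mxE; ring.
  apply: le_trans (GM _ _ (ca s) (ca t)) _.
  by rewrite ler_wpM2l ?(ltW Mp)// clamp_lip// ltW.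
pose T c := projT1 (cid (step c)).
have TP c : good c -> good (T c) /\ exists G : R -> 'rV[R]_n,
      (forall t : R, `|t| <= a -> is_derive t 1 G (k (c t))) /\
      forall t, T c t = x0 + (G (clamp a t) - G 0) := projT2 (cid (step c)).
have good0 : good (fun=> x0).
  split=> [t|s t]; rewrite subrr normr0; first by rewrite divr_ge0// ltW.
  by rewrite mulr_ge0// ltW.
have Tlip c1 c2 e : good c1 -> good c2 -> (forall t : R, `|c1 t - c2 t| <= e) ->
    forall t, `|T c1 t - T c2 t| <= e / 2.
  move=> g1 g2 ce t.
  have [_ [G1 [G1P ->]]] := TP c1 g1; have [_ [G2 [G2P ->]]] := TP c2 g2.
  have e0 : 0 <= e by apply: le_trans (ce 0).
  set s := clamp a t.
  have -> : x0 + (G1 s - G1 0) - (x0 + (G2 s - G2 0))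
    = (G1 s - G2 s) - (G1 0 - G2 0) by apply/rowP => i; rewrite !mxE; ring.
  have sa : `|s| <= a by exact: clamp_le (ltW a0).
  have a00 : `|0 : R| <= a by rewrite normr0 ltW.
  have := @mvt_le_rV _ (fun t => G1 t - G2 t) (fun t => k (c1 t) - k (c2 t)) a (L * e).
  move=> /(_ _ _ _ 0 s a00 sa) H.
  apply: (le_trans (H _ _ _)).
  - by rewrite mulr_ge0// ltW.
  - by move=> z za; apply: is_deriveB; [exact: G1P|exact: G2P].
  - move=> z _; apply: le_trans (kL _ _ (inB _ g2 z) (inB _ g1 z)) _.
    by apply: ler_wpM2l; [exact: ltW|exact: ce].
  - rewrite subr0; apply: (@le_trans _ _ (L * e * a)).
      by rewrite ler_wpM2l// mulr_ge0// ltW.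
    by rewrite mulrAC mulrC ler_wpM2l.
pose c_ := fix c_ m := if m is m'.+1 then T (c_ m') else (fun=> x0).
have c_good m : good (c_ m) by elim: m => [//|m IH]; exact: (TP _ IH).1.
have c_step m t : `|c_ m.+1 t - c_ m t| <= r / 2 ^+ m.
  elim: m t => [|m IH] t.
    rewrite expr0 divr1; apply: le_trans ((c_good 1%N).1 t) _.
    by rewrite ler_pdivrMr// ler_peMr ?ltW// ltr1n.
  have := Tlip _ _ _ (c_good m.+1) (c_good m) IH t.
  by rewrite exprSr invfM mulrA.
have lim_ t i : exists l, forall m, `|l - c_ m t 0 i| <= 2 * r / 2 ^+ m.
  apply: geometric_limit; first exact: ltW.
  move=> m; apply: le_trans (c_step m t).
  by have := normr_coord (c_ m.+1 t - c_ m t) i; rewrite !mxE.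
pose c t := \row_i projT1 (cid (lim_ t i)).
have c_lim t m : `|c t - c_ m t| <= 2 * r / 2 ^+ m.
  apply: normr_le_coord => [|i].
    by rewrite divr_ge0 ?exprn_ge0// mulr_ge0// ltW.
  by rewrite !mxE; exact: projT2 (cid (lim_ t i)) m.
have small (x K : R) : (forall m, x <= K / 2 ^+ m) -> x <= 0.
  move=> xK; rewrite leNgt; apply/negP => xp.
  have K0 : 0 <= K by apply: le_trans (ltW xp) _; have := xK 0%N; rewrite expr0 divr1.
  have := archi_boundP (divr_ge0 K0 (ltW xp)); set m := Num.bound _.
  rewrite ltr_pdivrMr// => Km; have := xK m; rewrite leNgt => /negP; apply.
  rewrite ltr_pdivrMr ?exprn_gt0//; apply: lt_le_trans Km _.
  by rewrite mulrC ler_pM2l// -natrX ler_nat ltnW// ltn_expl.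
have cle m (x y z : R) (d : R) : x <= y + d -> d <= z / 2 ^+ m -> x - y <= z / 2 ^+ m.
  by move: (z / _) => w; lra.
have cg : good c.
  split=> [t|s t]; rewrite -subr_le0.
    apply: (@small _ (2 * r)) => m; apply: cle (c_lim t m).
    have -> : c t - x0 = (c_ m t - x0) + (c t - c_ m t).
      by apply/rowP => i; rewrite !mxE; ring.
    by apply: le_trans (ler_normD _ _) _; rewrite lerD2r; exact: (c_good m).1.
  apply: (@small _ (4 * r)) => m.
  apply: (@cle _ _ _ _ (`|c t - c_ m t| + `|c s - c_ m s|)).
    have -> : c t - c s = (c_ m t - c_ m s) + ((c t - c_ m t) - (c s - c_ m s)).
      by apply/rowP => i; rewrite !mxE; ring.
    apply: le_trans (ler_normD _ _) _; apply: lerD; last exact: ler_normB.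
    exact: (c_good m).2.
  apply: le_trans (lerD (c_lim t m) (c_lim s m)) _.
  by rewrite -mulrDl (_ : 2 * r + 2 * r = 4 * r)//; ring.
have Tc t : T c t = c t.
  apply/eqP; rewrite -subr_eq0 -normr_le0; apply: (@small _ (2 * r)) => m.
  have -> : T c t - c t = (T c t - c_ m.+1 t) - (c t - c_ m.+1 t).
    by apply/rowP => i; rewrite !mxE; ring.
  apply: le_trans (ler_normB _ _) _.
  have H1 := Tlip _ _ _ cg (c_good m) (fun t => c_lim t m) t.
  apply: le_trans (lerD H1 (c_lim t m.+1)) _.
  rewrite exprSr invfM le_eqVlt; apply/orP; left; apply/eqP.
  by field; rewrite expf_neq0.
have [_ [G [GP TG]]] := TP c cg.
exists a, c; split=> //.
  rewrite -Tc TG clamp_id ?normr0 ?ltW// subrr addr0 //.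
move=> t; rewrite -ltr_norml => ta; split; first by apply: rU; exact: inB.
have Gd : is_derive t 1 (fun t => x0 + (G t - G 0)) (k (c t)).
  have -> : (fun t => x0 + (G t - G 0)) = G + cst (x0 - G 0).
    by apply/funext => s; apply/rowP => i; rewrite !mxE; ring.
  have H : is_derive t 1 G (k (c t)) by apply: GP; exact: ltW.
  by have := is_deriveD H (is_derive_cst (x0 - G 0) t 1); rewrite addr0.
apply: near_eq_is_derive Gd.
apply/nbhs_ballP; exists (a - `|t|) => /=; first by rewrite subr_gt0.
move=> s; rewrite /ball /= => ts; rewrite -Tc TG clamp_id//.
rewrite -[s](subrK t); apply: le_trans (ler_normD _ _) _.
by rewrite -lerBrDr -normrN opprB ltW.
Qed.

End Picard.

(** * Symmetry of second partial derivatives *)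

Section Schwarz.
Context {R : realType} {n : nat}.

Lemma is_derive_shift_line (F : 'rV[R]_n -> R) (a : 'rV[R]_n) j (t : R) :
  differentiable F (a + t *: delta_mx 0 j) ->
  is_derive t 1 (fun s => F (a + s *: delta_mx 0 j)) (partial j F (a + t *: delta_mx 0 j)).
Proof.
move=> dF; have := is_derive_line dF; set d := \sum_i _.
suff -> : d = partial j F (a + t *: delta_mx 0 j) by [].
rewrite /d (bigD1 j)//= big1 => [|i ij]; first by rewrite mxE !eqxx mul1r addr0.
by rewrite mxE (negbTE ij) andbF mul0r.
Qed.

(** The mean value inequality in direction i reduces the second difference to a
    difference of first derivatives, which it bounds in direction j. *)
Lemma second_difference (U : set 'rV[R]_n) (f : 'rV[R]_n -> R) (x : 'rV[R]_n) i j
    (r e c t : R) : smooth_on U f ->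
  (forall y : 'rV[R]_n, ball x r y -> U y /\ `|partial j (partial i f) y - c| <= e) ->
  0 < t -> 2 * t < r ->
  `|f (x + t *: delta_mx 0 i + t *: delta_mx 0 j) - f (x + t *: delta_mx 0 i)
    - (f (x + t *: delta_mx 0 j) - f x) - t * t * c| <= e * t * t.
Proof.
move=> fs rP t0 tr.
have dn (l : 'I_n) : `|delta_mx 0 l : 'rV[R]_n| <= 1.
  apply: normr_le_coord => // m; rewrite mxE eqxx /=.
  by case: (_ == _); rewrite ?normr1 ?normr0.
have inr (u v : R) : 0 <= u <= t -> 0 <= v <= t ->
    ball x r (x + u *: delta_mx 0 i + v *: delta_mx 0 j).
  move=> /andP[u0 ut] /andP[v0 vt]; rewrite -ball_normE /= -addrA opprD addrA subrr sub0r normrN.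
  apply: le_lt_trans (ler_normD _ _) _; rewrite !normrZ !ger0_norm//.
  apply: (@le_lt_trans _ _ (u + v)); last by lra.
  by apply: lerD; rewrite ler_piMr.
have inU u v : 0 <= u <= t -> 0 <= v <= t -> U (x + u *: delta_mx 0 i + v *: delta_mx 0 j).
  by move=> ut vt; exact: (rP _ (inr u v ut vt)).1.
have t01 : 0 <= t <= t by rewrite (ltW t0) lexx.
have t00 : 0 <= (0 : R) <= t by rewrite (ltW t0) lexx.
pose phi s := f (x + t *: delta_mx 0 j + s *: delta_mx 0 i) - f (x + s *: delta_mx 0 i) - s * (t * c).
have -> : f (x + t *: delta_mx 0 i + t *: delta_mx 0 j) - f (x + t *: delta_mx 0 i)
    - (f (x + t *: delta_mx 0 j) - f x) - t * t * c = phi t - phi 0.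
  rewrite /phi !scale0r !addr0 mul0r subr0 [x + _ *: delta_mx 0 i + _]addrAC.
  by move: (f _) (f _) (f _) (f _) => a b d g; ring.
rewrite -[X in _ * X](subr0 t).
apply: (@mvt_le R phi (fun s => partial i f (x + t *: delta_mx 0 j + s *: delta_mx 0 i)
  - partial i f (x + s *: delta_mx 0 i) - t * c)); first exact: ltW.
  move=> s st; apply: is_deriveB; last exact: is_derive_mulr.
  apply: is_deriveB; apply: is_derive_shift_line; apply: smooth_diff fs _.
    by rewrite addrAC; exact: inU.
  by have := inU s 0 st t00; rewrite scale0r addr0.
move=> s st; pose H v := partial i f (x + s *: delta_mx 0 i + v *: delta_mx 0 j) - v * c.
have -> : partial i f (x + t *: delta_mx 0 j + s *: delta_mx 0 i)
    - partial i f (x + s *: delta_mx 0 i) - t * c = H t - H 0.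
  rewrite /H scale0r addr0 mul0r subr0 [x + _ *: delta_mx 0 j + _]addrAC.
  by move: (partial _ _ _) (partial _ _ _) => a b; ring.
rewrite -[X in _ * X](subr0 t).
apply: (@mvt_le R H (fun v => partial j (partial i f) (x + s *: delta_mx 0 i + v *: delta_mx 0 j) - c)).
- exact: ltW.
- move=> v vt; apply: is_deriveB; last exact: is_derive_mulr.
  apply: is_derive_shift_line; apply: smooth_diff (smooth_partial i fs) _; exact: inU.
- by move=> v vt; exact: (rP _ (inr s v st vt)).2.
Qed.

(** The second difference of f is symmetric in the two directions, and its quotient by
    t^2 is close to either of the two mixed derivatives. *)
Theorem schwarz (U : set 'rV[R]_n) (f : 'rV[R]_n -> R) (x : 'rV[R]_n) i j :
  open U -> smooth_on U f -> U x ->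
  partial i (partial j f) x = partial j (partial i f) x.
Proof.
move=> oU fs Ux; apply/eqP; rewrite -subr_eq0 -normr_le0; apply/ler_addgt0Pr => e e0.
have near_c a b : \forall y \near x, `|partial a (partial b f) y - partial a (partial b f) x| <= e / 2.
  have c := differentiable_continuous (smooth_diff (smooth_partial a (smooth_partial b fs)) Ux).
  have e2 : 0 < e / 2 by rewrite divr_gt0.
  move: c => /cvgrPdist_le /(_ _ e2); apply: filterS => y.
  have S (u v : R) : `|u - v| <= e / 2 -> `|v - u| <= e / 2 by rewrite distrC.
  exact: S.
have [r r0 rP] := ball_of_near (filterI (near_open oU Ux) (filterI (near_c i j) (near_c j i))).
pose t := r / 4; have t0 : 0 < t by rewrite divr_gt0.
have tr : 2 * t < r by rewrite /t; lra.
have H1 := @second_difference U f x i j r (e / 2) (partial j (partial i f) x) t fs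
  (fun y yr => conj (rP y yr).1 (rP y yr).2.2) t0 tr.
have H2 := @second_difference U f x j i r (e / 2) (partial i (partial j f) x) t fs
  (fun y yr => conj (rP y yr).1 (rP y yr).2.1) t0 tr.
move: H1 H2; rewrite [x + _ *: delta_mx 0 j + _]addrAC.
move: (f _) (f _) (f _) (f _) (partial _ _ _) (partial _ _ _) => a b c d u v H1 H2.
have tt0 : 0 < t * t by rewrite mulr_gt0.
rewrite add0r -(ler_pM2r tt0) -[t * t in leLHS]ger0_norm ?(ltW tt0)// -normrM.
move: H1 H2; rewrite !ler_norml => /andP[H1 H1'] /andP[H2 H2'].
by apply/andP; split; lra.
Qed.

End Schwarz.

(** * Derivation rules, and vector fields in the plane *)

Section PartialRules.
Context {R : realType} {n : nat}.
Implicit Types (f g : 'rV[R]_n -> R) (i : 'I_n).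

(** Differentiability travels with the value, so that the rules below compute the
    derivative of a compound expression without separate proofs of differentiability. *)
Definition is_partial i f x v := differentiable f x /\ partial i f x = v.

Lemma is_partialE i f x v : is_partial i f x v -> partial i f x = v.
Proof. by case. Qed.

Lemma is_partial_cst i c x : is_partial i (fun=> c) x 0.
Proof. by split; [exact: differentiable_cst|exact: partial_cst]. Qed.

Lemma is_partial_coord i j x : is_partial i (fun y => y 0 j) x (j == i)%:R.
Proof. by split; [exact: differentiable_coord|exact: partial_coord]. Qed.

Lemma is_partialD i f g x u v : is_partial i f x u -> is_partial i g x v ->
  is_partial i (fun y => f y + g y) x (u + v).
Proof. by move=> [df <-] [dg <-]; split; [exact: differentiableD|exact: partialD]. Qed.

Lemma is_partialN i f x u : is_partial i f x u -> is_partial i (fun y => - f y) x (- u).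
Proof. by move=> [df <-]; split; [exact: differentiableN|exact: partialN]. Qed.

Lemma is_partialM i f g x u v : is_partial i f x u -> is_partial i g x v ->
  is_partial i (fun y => f y * g y) x (u * g x + f x * v).
Proof. by move=> [df <-] [dg <-]; split; [exact: differentiableM|exact: partialM]. Qed.

Lemma is_partialV i f x u : f x != 0 -> is_partial i f x u ->
  is_partial i (fun y => (f y)^-1) x (- (f x)^-1 ^+ 2 * u).
Proof. by move=> f0 [df <-]; split; [exact: differentiableV|exact: partialV]. Qed.

Lemma is_partialX2 i f x u : is_partial i f x u ->
  is_partial i (fun y => f y ^+ 2) x (2 * f x * u).
Proof.
move=> H; have [d E] := is_partialM H H.
have -> : (fun y => f y ^+ 2) = (fun y => f y * f y).
  by apply/funext => y; rewrite expr2.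
by split=> //; rewrite E; ring.
Qed.

Lemma is_partial_smooth (U : set 'rV[R]_n) i f x : smooth_on U f -> U x ->
  is_partial i f x (partial i f x).
Proof. by move=> fs Ux; split=> //; exact: smooth_diff fs Ux. Qed.

End PartialRules.

Ltac smooth_tac := match goal with
  | |- smooth_on _ (fun _ => _ + _) => apply: smoothD; [done|smooth_tac|smooth_tac]
  | |- smooth_on _ (fun _ => - _) => apply: smoothN; [done|smooth_tac]
  | |- smooth_on _ (fun _ => _ * _) => apply: smoothM; [done|smooth_tac|smooth_tac]
  | |- smooth_on _ (fun _ => _ ^+ _) => apply: smoothX; [done|smooth_tac]
  | |- smooth_on _ (fun _ => _ ^-1) => apply: smoothV; [done|try done|smooth_tac]
  | |- smooth_on _ (partial _ _) => apply: smooth_partial; smooth_tac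
  | |- smooth_on _ (fun _ => partial _ _ _) => apply: smooth_partial; smooth_tac
  | |- smooth_on _ (fun _ => ?c) => apply: smooth_cst
  | |- _ => solve [assumption | auto]
  end.

Ltac is_partial_tac := cbv beta; lazymatch goal with
  | |- is_partial _ (fun _ => _ + _) _ _ => apply: is_partialD; is_partial_tac
  | |- is_partial _ (fun _ => - _) _ _ => apply: is_partialN; is_partial_tac
  | |- is_partial _ (fun _ => _ * _) _ _ => apply: is_partialM; is_partial_tac
  | |- is_partial _ (fun _ => _ ^+ 2) _ _ => apply: is_partialX2; is_partial_tac
  | |- is_partial _ (fun _ => _ ^-1) _ _ => apply: is_partialV; [try done|is_partial_tac]
  | |- is_partial _ (fun _ => ?c) _ _ => apply: is_partial_cst
  | |- is_partial _ _ ?x _ => match goal with Ux : ?U x |- _ =>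
      refine (@is_partial_smooth _ _ U _ _ _ _ Ux); smooth_tac end
  end.

(** Turns partial derivatives into variables, so that [ring] and [field] see
    polynomials. *)
Ltac move_partials := repeat match goal with
  | |- context [@partial ?R ?n ?i ?f ?x] =>
      let p := fresh "p" in move: (@partial R n i f x) => p
  end.

Notation i0 := (@ord0 1).
Notation i1 := (@lift 2 ord0 ord0).

Notation field_ R := ('I_2 -> 'rV[R]_2 -> R).

Section Plane.
Context {R : realType}.

(** Reduces an identity modulo some equations to a polynomial identity: the
    equations enter through the combination c of them. *)
Lemma eq_lincomb (a b c : R) : a - b = c -> c = 0 -> a = b.
Proof. by move=> <- /eqP; rewrite subr_eq0 => /eqP. Qed.

Lemma sum2 (V : nmodType) (F : 'I_2 -> V) : \sum_i F i = F i0 + F i1.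
Proof. by rewrite !big_ord_recl big_ord0 addr0. Qed.

Lemma ord2P (P : 'I_2 -> Prop) : P i0 -> P i1 -> forall i, P i.
Proof.
move=> P0 P1 [[|[|//]] h]; first by rewrite (_ : Ordinal h = i0)//; exact: val_inj.
by rewrite (_ : Ordinal h = i1)//; exact: val_inj.
Qed.

Definition along (X : field_ R) (f : 'rV[R]_2 -> R) (x : 'rV[R]_2) : R :=
  X i0 x * partial i0 f x + X i1 x * partial i1 f x.

Definition bracket (X Y : field_ R) : field_ R :=
  fun c x => along X (Y c) x - along Y (X c) x.

(** The covariant derivative of Y along X when G is torsion-free: the two mixed symbols
    G c i0 i1 and G c i1 i0 are merged. *)
Definition cov (G : @connection R 2) (X Y : field_ R) : field_ R :=
  fun c x => along X (Y c) x
    + (G c i0 i0 x * X i0 x * Y i0 x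
       + G c i0 i1 x * (X i0 x * Y i1 x + X i1 x * Y i0 x)
       + G c i1 i1 x * X i1 x * Y i1 x).

Definition pairing (w : 'rV[R]_2 -> 'rV[R]_2) (X : field_ R) (x : 'rV[R]_2) : R :=
  w x 0 i0 * X i0 x + w x 0 i1 * X i1 x.

Lemma projective_fieldE (U : set 'rV[R]_2) G (k Ups : 'rV[R]_2 -> 'rV[R]_2) c a b x :
  torsion_free U G -> projective_field U G k Ups -> U x ->
  let k' i y := k y 0 i in
  partial a (partial b (k' c)) x =
    (c == a)%:R * Ups x 0 b + (c == b)%:R * Ups x 0 a
    - (along k' (G c a b) x
       - G i0 a b x * partial i0 (k' c) x - G i1 a b x * partial i1 (k' c) x
       + G c i0 b x * partial a (k' i0) x + G c i1 b x * partial a (k' i1) x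
       + G c a i0 x * partial b (k' i0) x + G c a i1 x * partial b (k' i1) x).
Proof.
move=> tf H Ux k'; rewrite -(H c a b x Ux) /lie_connection sum2 /along /k'.
move_partials; ring.
Qed.

Lemma alongE X f x : along X f x = X i0 x * partial i0 f x + X i1 x * partial i1 f x.
Proof. by []. Qed.

Lemma bracketE X Y c x : bracket X Y c x = along X (Y c) x - along Y (X c) x.
Proof. by []. Qed.

Lemma covE G X Y c x : cov G X Y c x = along X (Y c) x
    + (G c i0 i0 x * X i0 x * Y i0 x
       + G c i0 i1 x * (X i0 x * Y i1 x + X i1 x * Y i0 x)
       + G c i1 i1 x * X i1 x * Y i1 x).
Proof. by []. Qed.

(** The Leibniz rule for the Lie derivative along k. The last term is the Lie
    derivative of the connection, which Ups determines because k is projective. *)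
Lemma lie_covariant (U : set 'rV[R]_2) G (k Ups : 'rV[R]_2 -> 'rV[R]_2) (X Y : field_ R) x :
  open U -> smooth_connection U G -> torsion_free U G -> smooth_mx_on U k ->
  projective_field U G k Ups -> (forall i, smooth_on U (X i)) ->
  (forall i, smooth_on U (Y i)) -> U x ->
  let k' i y := k y 0 i in
  forall c, bracket k' (cov G X Y) c x =
    cov G (bracket k' X) Y c x + cov G X (bracket k' Y) c x
    + (X c x * pairing Ups Y x + Y c x * pairing Ups X x).
Proof.
move=> oU Gs tf ks pf Xs Ys Ux k'.
have ks' i : smooth_on U (k' i) by exact: ks.
have Gs' a b c : smooth_on U (G a b c) by exact: Gs.
have k2 c a b := projective_fieldE c a b tf pf Ux.
have sk c : partial i1 (partial i0 (k' c)) x = partial i0 (partial i1 (k' c)) x.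
  exact: schwarz oU (ks' c) Ux.
have sY c : partial i1 (partial i0 (Y c)) x = partial i0 (partial i1 (Y c)) x.
  exact: schwarz oU (Ys c) Ux.
move=> c.
eassert (F0 : is_partial i0 (cov G X Y c) x _) by (rewrite /cov /along; is_partial_tac).
eassert (F1 : is_partial i1 (cov G X Y c) x _) by (rewrite /cov /along; is_partial_tac).
eassert (B0 : is_partial i0 (bracket k' Y c) x _) by (rewrite /bracket /along; is_partial_tac).
eassert (B1 : is_partial i1 (bracket k' Y c) x _) by (rewrite /bracket /along; is_partial_tac).
rewrite bracketE !covE !alongE (is_partialE F0) (is_partialE F1) (is_partialE B0) (is_partialE B1).
rewrite !bracketE !alongE sk sY (k2 c i0 i0) (k2 c i0 i1) (k2 c i1 i1).
rewrite !covE !alongE.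
clear F0 F1 B0 B1 sk sY k2; have t c' := tf c' i1 i0 x Ux.
move: c; apply: ord2P => /=; rewrite /pairing !t /k' /=.
all: move_partials; ring.
Qed.

End Plane.

(** * Frames adapted to a projective symmetry *)

Section AlongRules.
Context {R : realType}.
Implicit Types (X : field_ R) (f g : 'rV[R]_2 -> R).

Definition is_along X f x v := differentiable f x /\ along X f x = v.

Lemma is_alongE X f x v : is_along X f x v -> along X f x = v.
Proof. by case. Qed.

Lemma is_along_cst X c x : is_along X (fun=> c) x 0.
Proof.
split; first exact: differentiable_cst.
by rewrite alongE !partial_cst !mulr0 addr0.
Qed.

Lemma is_alongD X f g x u v : is_along X f x u -> is_along X g x v ->
  is_along X (fun y => f y + g y) x (u + v).
Proof.
move=> [df <-] [dg <-]; split; first exact: differentiableD.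
by rewrite !alongE !partialD//; move_partials; ring.
Qed.

Lemma is_alongN X f x u : is_along X f x u -> is_along X (fun y => - f y) x (- u).
Proof.
move=> [df <-]; split; first exact: differentiableN.
by rewrite !alongE !partialN//; move_partials; ring.
Qed.

Lemma is_alongM X f g x u v : is_along X f x u -> is_along X g x v ->
  is_along X (fun y => f y * g y) x (u * g x + f x * v).
Proof.
move=> [df <-] [dg <-]; split; first exact: differentiableM.
by rewrite !alongE !partialM//; move_partials; ring.
Qed.

Lemma is_alongX2 X f x u : is_along X f x u ->
  is_along X (fun y => f y ^+ 2) x (2 * f x * u).
Proof.
move=> H; have [d E] := is_alongM H H.
have -> : (fun y => f y ^+ 2) = (fun y => f y * f y).
  by apply/funext => y; rewrite expr2.
by split=> //; rewrite E; ring.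
Qed.

Lemma is_alongV X f x u : f x != 0 -> is_along X f x u ->
  is_along X (fun y => (f y)^-1) x (- (f x)^-1 ^+ 2 * u).
Proof.
move=> f0 [df <-]; split; first exact: differentiableV.
by rewrite !alongE !partialV//; move_partials; ring.
Qed.

Lemma is_along_smooth (U : set 'rV[R]_2) X f x : smooth_on U f -> U x ->
  is_along X f x (along X f x).
Proof. by move=> fs Ux; split=> //; exact: smooth_diff fs Ux. Qed.

Lemma along_eq (U : set 'rV[R]_2) X f g x : open U -> (forall y, U y -> f y = g y) -> U x ->
  along X f x = along X g x.
Proof. by move=> oU fg Ux; rewrite !alongE !(partial_eq oU fg _ Ux). Qed.

Lemma smooth_cov (U : set 'rV[R]_2) G X Y c : open U -> smooth_connection U G ->
  (forall i, smooth_on U (X i)) -> (forall i, smooth_on U (Y i)) ->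
  smooth_on U (cov G X Y c).
Proof.
move=> oU Gs Xs Ys; have Gs' a b d : smooth_on U (G a b d) by exact: Gs.
by rewrite /cov /along; smooth_tac.
Qed.

Lemma cov_eq0r (U : set 'rV[R]_2) G X Y c x : open U -> U x ->
  (forall i y, U y -> Y i y = 0) -> cov G X Y c x = 0.
Proof.
move=> oU Ux Y0; rewrite covE !Y0// (@along_eq U _ _ (fun=> 0))//; last by move=> y; exact: Y0.
by rewrite alongE !partial_cst; ring.
Qed.

Lemma bracketXX X : bracket X X = fun _ _ => 0.
Proof. by apply/funext => c; apply/funext => x; rewrite bracketE subrr. Qed.

End AlongRules.

Ltac is_along_tac := cbv beta; lazymatch goal with
  | |- is_along _ (fun _ => _ + _) _ _ => apply: is_alongD; is_along_tac
  | |- is_along _ (fun _ => - _) _ _ => apply: is_alongN; is_along_tac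
  | |- is_along _ (fun _ => _ * _) _ _ => apply: is_alongM; is_along_tac
  | |- is_along _ (fun _ => _ ^+ 2) _ _ => apply: is_alongX2; is_along_tac
  | |- is_along _ (fun _ => _ ^-1) _ _ => apply: is_alongV; [try done|is_along_tac]
  | |- is_along _ (fun _ => ?c) _ _ => apply: is_along_cst
  | |- is_along _ _ ?x _ => match goal with Ux : ?U x |- _ =>
      refine (@is_along_smooth _ U _ _ _ _ Ux); smooth_tac end
  end.

Section AdaptedFrame.
Context {R : realType}.

Definition coord_field (k : 'rV[R]_2 -> 'rV[R]_2) : field_ R := fun i x => k x 0 i.

Definition vol2 (X Y : field_ R) (x : 'rV[R]_2) : R := X i0 x * Y i1 x - X i1 x * Y i0 x.

(** A frame (k, e) and a one-form be for which the projectively equivalent connection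
    Gh = G + delta be + be delta takes the form
      Gh_k k = - e,   Gh_k e = Gh_e k = 0,   Gh_e e = A k - B e.
    The last four fields say that e, Gh, A and B are invariant under k; for Gh this
    means that the Lie derivative of be along k is - Ups. *)
Record adapted_frame (U : set 'rV[R]_2) (G : connection 2) (k Ups : 'rV[R]_2 -> 'rV[R]_2)
    (e be : field_ R) (A B : 'rV[R]_2 -> R) : Prop := {
  af_frame_smooth : forall i, smooth_on U (e i);
  af_form_smooth : forall i, smooth_on U (be i);
  af_A_smooth : smooth_on U A;
  af_B_smooth : smooth_on U B;
  af_vol : forall x, U x -> vol2 (coord_field k) e x != 0;
  af_kk : forall c x, U x -> cov G (coord_field k) (coord_field k) c x
    + 2 * (be i0 x * k x 0 i0 + be i1 x * k x 0 i1) * k x 0 c = - e c x;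
  af_ek : forall c x, U x -> cov G e (coord_field k) c x
    + (be i0 x * e i0 x + be i1 x * e i1 x) * k x 0 c
    + (be i0 x * k x 0 i0 + be i1 x * k x 0 i1) * e c x = 0;
  af_ee : forall c x, U x -> cov G e e c x
    + 2 * (be i0 x * e i0 x + be i1 x * e i1 x) * e c x
    = A x * k x 0 c - B x * e c x;
  af_bracket : forall c x, U x -> bracket (coord_field k) e c x = 0;
  af_form : forall a x, U x -> along (coord_field k) (be a) x
    + be i0 x * partial a (fun y => k y 0 i0) x
    + be i1 x * partial a (fun y => k y 0 i1) x = - Ups x 0 a;
  af_A : forall x, U x -> along (coord_field k) A x = 0;
  af_B : forall x, U x -> along (coord_field k) B x = 0
}.

Variables (U : set 'rV[R]_2) (G : @connection R 2) (k Ups : 'rV[R]_2 -> 'rV[R]_2).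
Hypotheses (oU : open U) (Gs : smooth_connection U G) (tf : torsion_free U G).
Hypotheses (ks : smooth_mx_on U k) (pf : projective_field U G k Ups).

Notation k' := (coord_field k).
Let w := cov G k' k'.
Let u := cov G w k'.
Let D := vol2 k' w.

Let k's i : smooth_on U (k' i). Proof. exact: ks. Qed.
Let ws i : smooth_on U (w i). Proof. exact: smooth_cov. Qed.
Let us i : smooth_on U (u i). Proof. exact: smooth_cov. Qed.

(** Since [k, k] = 0, only the Lie derivative of the connection contributes. *)
Lemma lie_acceleration c x : U x -> along k' (w c) x = along w (k' c) x + 2 * pairing Ups k' x * k' c x.
Proof.
move=> Ux; have := lie_covariant oU Gs tf ks pf k's k's Ux c.
rewrite -/(coord_field k) bracketXX.
have -> : cov G k' (fun _ _ => 0) c x = 0 by exact: (cov_eq0r _ _ _ oU Ux).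
have -> : cov G (fun _ _ => 0) k' c x = 0 by rewrite covE alongE; move_partials; ring.
rewrite bracketE -/w => /eqP; rewrite subr_eq => /eqP ->.
by move: (along _ _ _) (pairing _ _ _) => a b; ring.
Qed.

(** The correction in [lie_acceleration] is parallel to k and does not change the area
    spanned with k, which is a density and so acquires the divergence of k. *)
Lemma lie_vol_acceleration x : U x ->
  along k' D x = (partial i0 (k' i0) x + partial i1 (k' i1) x) * D x.
Proof.
move=> Ux.
eassert (F : is_along k' D x _) by (rewrite /D /vol2; is_along_tac).
rewrite (is_alongE F) !lie_acceleration// !alongE /D /vol2; move_partials; ring.
Qed.

End AdaptedFrame.

(** * Transversality of the acceleration *)

Section Transversality.
Context {R : realType}.

(** The product of d with the integrating factor exp (- int m) is constant. *)
Lemma linear_ode_zero (d m : R -> R) (a : R) :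
  (forall t : R, - a < t < a -> is_derive t 1 d (m t * d t)) ->
  (forall t : R, - a < t < a -> {for t, continuous m}) -> d 0 = 0 ->
  forall t : R, - a < t < a -> d t = 0.
Proof.
move=> dd mc d0 t ta.
have [b tb ba] : exists2 b, - b < t < b & b < a.
  move: ta; rewrite -ltr_norml => ta; exists ((`|t| + a) / 2); last by lra.
  by rewrite -ltr_norml; lra.
have [|M MP] := @antiderivative R m (- b) b.
  by move=> s /andP[s1 s2]; apply: mc; apply/andP; split; lra.
have b0 : 0 < b by move: tb => /andP[]; lra.
have zb : - b < 0 < b by apply/andP; split; lra.
have gd (s : R) : - b < s < b -> is_derive s 1 (fun s => d s * expR (- M s)) 0.
  move=> sb; have Ms := MP s sb.
  have ds : is_derive s 1 d (m s * d s).
    by apply: dd; case/andP: sb => s1 s2; apply/andP; split; lra.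
  have E : is_derive s 1 (fun s => expR (- M s)) (- m s * expR (- M s)).
    have H := is_deriveN Ms.
    have := @is_derive1_comp R expR (- M) s _ _ (is_derive_expR _) H.
    by move=> {}H; apply: is_derive_eq H _; rewrite mulrC.
  have := @is_deriveM R R d (fun s => expR (- M s)) s 1 _ _ ds E.
  move=> H; apply: is_derive_eq H _.
  rewrite -[X in X + _]/(d s * _) -[X in _ + X]/(expR (- M s) * _); ring.
have := is_derive_eq0_cst gd tb zb; rewrite d0 mul0r => /eqP.
by rewrite mulf_eq0 [expR _ == 0]gt_eqF ?expR_gt0// orbF => /eqP.
Qed.

Lemma is_derive_curve n (F : 'rV[R]_n -> R) (c : R -> 'rV[R]_n) (v : 'rV[R]_n) (t : R) :
  differentiable F (c t) -> is_derive t 1 c v ->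
  is_derive t 1 (fun s => F (c s)) (\sum_j v 0 j * partial j F (c t)).
Proof.
move=> dF cv; have dc : differentiable c t by apply/derivable1_diffP; case: cv.
apply: DeriveDef; first by apply/derivable1_diffP; exact: (differentiable_comp dc dF).
rewrite derive_chain//; apply: eq_bigr => j _; congr (_ * _).
by have [_] := is_derive_rV_coord j cv.
Qed.

(** If nabla_k k is parallel to k at one point, it is so along the integral curve
    through this point, by the linear equation of [lie_vol_acceleration]. This curve
    then is an unparametrised geodesic. *)
Lemma acceleration_transverse (U : set 'rV[R]_2) G (k Ups : 'rV[R]_2 -> 'rV[R]_2) :
  generic_projective_symmetry U G k Ups -> forall x, U x ->
  vol2 (coord_field k) (cov G (coord_field k) (coord_field k)) x != 0.
Proof.
move=> [oU Gs tf ks Us pf k0 ng] x0 Ux0; apply/negP => /eqP D0.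
have [a [c [a0 c0 ck]]] := picard oU ks Ux0.
have aa : - a < a by lra.
apply: (ng (- a) a c aa ck).
set k' := coord_field k; set w := cov G k' k'; pose D := vol2 k' w.
have k's i : smooth_on U (k' i) by exact: ks.
have ws i : smooth_on U (w i) by exact: smooth_cov.
have Ds : smooth_on U D by rewrite /D /vol2; smooth_tac.
pose m x := partial i0 (k' i0) x + partial i1 (k' i1) x.
have ms : smooth_on U m by rewrite /m; smooth_tac.
have along_curve f (t : R) : smooth_on U f -> - a < t < a ->
    is_derive t 1 (fun s => f (c s)) (along k' f (c t)).
  move=> fs ta; have [Uc cd] := ck t ta.
  by have := is_derive_curve (smooth_diff fs Uc) cd; rewrite sum2.
have Dc (t : R) : - a < t < a -> D (c t) = 0.
  move: t; apply: (@linear_ode_zero (fun t => D (c t)) (fun t => m (c t)) a); last by rewrite c0.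
    move=> s sa; have [Uc cd] := ck s sa.
    by rewrite -(lie_vol_acceleration oU Gs tf ks pf Uc); exact: along_curve.
  move=> s sa; apply: differentiable_continuous; apply/derivable1_diffP.
  by have [] := along_curve m s ms sa.
pose q (y : 'rV[R]_2) := k' i0 y ^+ 2 + k' i1 y ^+ 2.
(* the component along k of nabla_k k, which is parallel to k along the curve *)
exists (fun t => (w i0 (c t) * k' i0 (c t) + w i1 (c t) * k' i1 (c t)) / q (c t)).
move=> t ta; have [Uc cd] := ck t ta.
have q0 : q (c t) != 0.
  apply/negP; rewrite /q paddr_eq0 ?sqr_ge0// !sqrf_eq0 => /andP[/eqP H0 /eqP H1].
  have /negP := k0 _ Uc; apply; apply/eqP/rowP.
  by apply: ord2P; rewrite mxE; [exact: H0|exact: H1].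
have near_ta : \forall s \near t, - a < s < a.
  have := @near_in_itvoo R (- a) a t; rewrite in_itv /= => /(_ ta).
  by apply: filterS => s; rewrite in_itv.
have c'E : \forall s \near t, k (c s) = derive1 c s.
  apply: filterS near_ta => s sa; have [_ [_ E]] := ck s sa.
  by rewrite derive1E E.
have kcd : is_derive t 1 (fun s => k (c s)) (\row_i along k' (k' i) (c t)).
  by apply: is_derive_rV => i; rewrite mxE; exact: along_curve.
have c''d : is_derive t 1 (derive1 c) (\row_i along k' (k' i) (c t)).
  exact: near_eq_is_derive c'E kcd.
have c't : derive1 c t = k (c t) by rewrite (nbhs_singleton c'E).
split.
- by case: cd.
- by case: c''d.
- by rewrite c't; exact: k0.
move=> i; have -> : derive1n 2 c t = \row_i along k' (k' i) (c t).
  by rewrite derive1nS derive1n1 derive1E; case: c''d.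
rewrite mxE c't !sum2 (tf i i1 i0)//.
have -> : along k' (k' i) (c t) + (G i i0 i0 (c t) * k (c t) 0 i0 * k (c t) 0 i0 +
  G i i0 i1 (c t) * k (c t) 0 i0 * k (c t) 0 i1 +
  (G i i0 i1 (c t) * k (c t) 0 i1 * k (c t) 0 i0 +
  G i i1 i1 (c t) * k (c t) 0 i1 * k (c t) 0 i1)) = w i (c t).
  by rewrite /w covE /k' /coord_field; move: (along _ _ _) => z; ring.
have := Dc t ta; rewrite /D /vol2 => H; rewrite -/(k' i (c t)).
apply: (mulIf q0); rewrite mulrAC divfK//; apply/eqP; rewrite -subr_eq0; apply/eqP.
move: i; apply: ord2P.
  apply: (@etrans _ _ (- k' i1 (c t) * (k' i0 (c t) * w i1 (c t) - k' i1 (c t) * w i0 (c t)))).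
    by rewrite /q; move: (w i0 (c t)) (w i1 (c t)) => w0 w1; rewrite /k' /coord_field; ring.
  by rewrite H mulr0.
apply: (@etrans _ _ (k' i0 (c t) * (k' i0 (c t) * w i1 (c t) - k' i1 (c t) * w i0 (c t)))).
  by rewrite /q; move: (w i0 (c t)) (w i1 (c t)) => w0 w1; rewrite /k' /coord_field; ring.
by rewrite H mulr0.
Qed.

End Transversality.

(** * Construction of the adapted frame *)

Section AdaptedFrameExists.
Context {R : realType}.

Lemma lin2_zero (a b c d x y : R) : a * d - b * c != 0 ->
  a * x + b * y = 0 -> c * x + d * y = 0 -> x = 0 /\ y = 0.
Proof.
move=> D E F; split; apply: (mulfI D); rewrite mulr0.
  have -> : (a * d - b * c) * x = d * (a * x + b * y) - b * (c * x + d * y) by ring.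
  by rewrite E F !mulr0 subr0.
have -> : (a * d - b * c) * y = a * (c * x + d * y) - c * (a * x + b * y) by ring.
by rewrite E F !mulr0 subr0.
Qed.

Variables (U : set 'rV[R]_2) (G : @connection R 2) (k Ups : 'rV[R]_2 -> 'rV[R]_2).
Hypotheses (oU : open U) (Gs : smooth_connection U G) (tf : torsion_free U G).
Hypotheses (ks : smooth_mx_on U k) (pf : projective_field U G k Ups).

Notation k' := (coord_field k).
Notation w := (cov G k' k').
Notation u := (cov G w k').
Notation D := (vol2 k' w).

Hypothesis D0 : forall x, U x -> D x != 0.

Let k's i : smooth_on U (k' i). Proof. exact: ks. Qed.
Let ws i : smooth_on U (w i). Proof. exact: smooth_cov. Qed.
Let us i : smooth_on U (u i). Proof. exact: smooth_cov. Qed.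
Let Ds : smooth_on U D. Proof. by rewrite /vol2; smooth_tac. Qed.

(** The Leibniz rule for u = nabla_w k with w = nabla_k k, whose Lie derivative along k
    is 2 Ups(k) k. *)
Lemma lie_jerk c x : U x -> along k' (u c) x = along u (k' c) x
  + 3 * pairing Ups k' x * w c x + pairing Ups w x * k' c x.
Proof.
move=> Ux; have := lie_covariant oU Gs tf ks pf ws k's Ux c.
rewrite -/(coord_field k) bracketXX.
have -> : cov G w (fun _ _ => 0) c x = 0 by exact: (cov_eq0r _ _ _ oU Ux).
have -> : cov G (bracket k' w) k' c x = 2 * pairing Ups k' x * w c x.
  have bw d : bracket k' w d x = 2 * pairing Ups k' x * k' d x.
    rewrite bracketE (lie_acceleration oU Gs tf ks pf)//.
    by move: (along _ _ _) => a; ring.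
  rewrite covE alongE !bw [w c x]covE alongE; move_partials; ring.
rewrite bracketE => /eqP; rewrite subr_eq => /eqP ->.
by move: (along _ _ _) (pairing _ _ _) (pairing _ _ _) (w c x) => a b d f; ring.
Qed.

(** The components of the jerk u = nabla_w k in the frame (k, w). *)
Definition jerk_w x := (k' i0 x * u i1 x - k' i1 x * u i0 x) * (D x)^-1.
Definition jerk_k x := (u i0 x * w i1 x - u i1 x * w i0 x) * (D x)^-1.

Let jws : smooth_on U jerk_w. Proof. by rewrite /jerk_w; smooth_tac. Qed.
Let jks : smooth_on U jerk_k. Proof. by rewrite /jerk_k; smooth_tac. Qed.

Lemma jerkE c x : U x -> u c x = jerk_k x * k' c x + jerk_w x * w c x.
Proof.
move=> Ux; have := D0 Ux; rewrite /jerk_k /jerk_w {1}/vol2.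
move: c; apply: ord2P; rewrite /vol2; move: (w i0 x) (w i1 x) (u i0 x) (u i1 x) (k' i0 x) (k' i1 x);
  by move=> w0 w1 u0 u1 k0 k1 d; field.
Qed.

Lemma along_jerk_w x : U x -> along k' jerk_w x = 3 * pairing Ups k' x.
Proof.
move=> Ux; have d := D0 Ux.
eassert (F : is_along k' jerk_w x _).
  by rewrite /jerk_w; is_along_tac.
rewrite (is_alongE F) (lie_vol_acceleration oU Gs tf ks pf Ux) !lie_jerk// !alongE.
move: d; rewrite /vol2.
move: (w i0 x) (w i1 x) (u i0 x) (u i1 x) => w0 w1 u0 u1.
by move_partials => d; field.
Qed.

Lemma along_jerk_k x : U x ->
  along k' jerk_k x = pairing Ups w x - 2 * jerk_w x * pairing Ups k' x.
Proof.
move=> Ux; have d := D0 Ux.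
eassert (F : is_along k' jerk_k x _).
  by rewrite /jerk_k; is_along_tac.
rewrite (is_alongE F) (lie_vol_acceleration oU Gs tf ks pf Ux) !lie_jerk//.
rewrite !(lie_acceleration oU Gs tf ks pf _ Ux) !alongE /jerk_w.
move: d; rewrite /vol2.
move: (w i0 x) (w i1 x) (u i0 x) (u i1 x) (pairing _ w _) => w0 w1 u0 u1 pw.
by move_partials => d; field.
Qed.

(** The multiple of k compensates the Lie derivative 2 Ups(k) k of w, because the
    derivative of jerk_w along k is 3 Ups(k). *)
Definition frame_e c x := 2 / 3 * jerk_w x * k' c x - w c x.

Let es c : smooth_on U (frame_e c). Proof. by rewrite /frame_e; smooth_tac. Qed.

Lemma frame_vol x : vol2 k' frame_e x = - D x.
Proof. by rewrite /vol2 /frame_e; ring. Qed.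

Lemma frame_bracket c x : U x -> bracket k' frame_e c x = 0.
Proof.
move=> Ux; rewrite bracketE.
eassert (F : is_along k' (frame_e c) x _) by (rewrite /frame_e; is_along_tac).
rewrite (is_alongE F) along_jerk_w// (lie_acceleration oU Gs tf ks pf _ Ux) !alongE /frame_e.
by move_partials; field.
Qed.

(** The values of be on k and e, which are forced by Gh_k k = - e and Gh_e k = 0. *)
Definition form_k x := - (3^-1) * jerk_w x.
Definition form_e x := jerk_k x + 2 / 9 * jerk_w x ^+ 2.

(** The components of the one-form with these values on k and e. *)
Definition form_be a x : R :=
  (form_k x * (if a == i0 then frame_e i1 x else - frame_e i0 x)
   + form_e x * (if a == i0 then - k' i1 x else k' i0 x)) * (vol2 k' frame_e x)^-1.

Let vs : smooth_on U (vol2 k' frame_e). Proof. by rewrite /vol2; smooth_tac. Qed.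
Let v0 x : U x -> vol2 k' frame_e x != 0. Proof. by move=> Ux; rewrite frame_vol oppr_eq0 D0. Qed.
Let fks : smooth_on U form_k. Proof. by rewrite /form_k; smooth_tac. Qed.
Let fes : smooth_on U form_e. Proof. by rewrite /form_e; smooth_tac. Qed.

Let bes a : smooth_on U (form_be a).
Proof. by move: a; apply: ord2P; rewrite /form_be /=; smooth_tac. Qed.

Lemma form_be_k x : U x -> form_be i0 x * k' i0 x + form_be i1 x * k' i1 x = form_k x.
Proof.
move=> /v0; rewrite /form_be /= {1}/vol2 /vol2; move: (frame_e _ _) (frame_e _ _) (form_e _) (form_k _) => e0 e1 a b.
by move=> d; field.
Qed.

Lemma form_be_e x : U x -> form_be i0 x * frame_e i0 x + form_be i1 x * frame_e i1 x = form_e x.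
Proof.
move=> /v0; rewrite /form_be /= {1}/vol2 /vol2; move: (frame_e _ _) (frame_e _ _) (form_e _) (form_k _) => e0 e1 a b.
by move=> d; field.
Qed.

Lemma along_form_k x : U x -> along k' form_k x = - pairing Ups k' x.
Proof.
move=> Ux; eassert (F : is_along k' form_k x _) by (rewrite /form_k; is_along_tac).
by rewrite (is_alongE F) along_jerk_w//; field.
Qed.

Lemma along_form_e x : U x -> along k' form_e x = - pairing Ups frame_e x.
Proof.
move=> Ux; eassert (F : is_along k' form_e x _) by (rewrite /form_e; is_along_tac).
by rewrite (is_alongE F) along_jerk_w// along_jerk_k// /pairing /frame_e; field.
Qed.

(** The frame is invariant under k, so it is enough to compare derivatives of the
    values of be on k and e. *)
Lemma lie_form_be a x : U x -> along k' (form_be a) x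
    + form_be i0 x * partial a (k' i0) x + form_be i1 x * partial a (k' i1) x = - Ups x 0 a.
Proof.
move=> Ux.
eassert (F : is_along k' (fun x => form_be i0 x * k' i0 x + form_be i1 x * k' i1 x) x _) by is_along_tac.
eassert (E : is_along k' (fun x => form_be i0 x * frame_e i0 x + form_be i1 x * frame_e i1 x) x _) by is_along_tac.
have {}F := is_alongE F; have {}E := is_alongE E.
rewrite (along_eq _ oU form_be_k Ux) along_form_k// in F.
rewrite (along_eq _ oU form_be_e Ux) along_form_e// in E.
have bk c : along k' (frame_e c) x = along frame_e (k' c) x.
  by have := frame_bracket c Ux; rewrite bracketE => /eqP; rewrite subr_eq0 => /eqP.
move: E F; rewrite !bk ![along k' (k' _) x]alongE ![along frame_e (k' _) x]alongE /pairing.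
pose L a := along k' (form_be a) x
    + form_be i0 x * partial a (k' i0) x + form_be i1 x * partial a (k' i1) x + Ups x 0 a.
move=> E F.
have [L0 L1] : L i0 = 0 /\ L i1 = 0.
  apply: (@lin2_zero (k' i0 x) (k' i1 x) (frame_e i0 x) (frame_e i1 x)); first exact: v0.
    by move: F => /eqP; rewrite eq_sym -subr_eq0 => /eqP <-; rewrite /L; move_partials; ring.
  by move: E => /eqP; rewrite eq_sym -subr_eq0 => /eqP <-; rewrite /L; move_partials; ring.
apply/eqP; rewrite -addr_eq0; apply/eqP; move: a.
by apply: ord2P; [exact: L0|exact: L1].
Qed.

(** The field Gh_e e. *)
Definition frame_ee c x := cov G frame_e frame_e c x + 2 * form_e x * frame_e c x.
Definition coef_A x := vol2 frame_ee frame_e x * (vol2 k' frame_e x)^-1.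
Definition coef_B x := - vol2 k' frame_ee x * (vol2 k' frame_e x)^-1.

Let ees c : smooth_on U (frame_ee c).
Proof.
have H : smooth_on U (cov G frame_e frame_e c) by exact: smooth_cov.
by rewrite /frame_ee; smooth_tac.
Qed.

Lemma frame_eeE c x : U x -> frame_ee c x = coef_A x * k' c x - coef_B x * frame_e c x.
Proof.
move=> /v0; rewrite /coef_A /coef_B /vol2; move: c.
apply: ord2P; move: (frame_e _ _) (frame_e _ _) (frame_ee _ _) (frame_ee _ _) => e0 e1 a b d; by field.
Qed.

Lemma along_frame_e c x : U x -> along k' (frame_e c) x = along frame_e (k' c) x.
Proof.
by move=> Ux; have := frame_bracket c Ux; rewrite bracketE => /eqP; rewrite subr_eq0 => /eqP.
Qed.

Lemma along_frame_ee c x : U x -> along k' (frame_ee c) x = along frame_ee (k' c) x.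
Proof.
move=> Ux.
have H : smooth_on U (cov G frame_e frame_e c) by exact: smooth_cov.
eassert (F : is_along k' (frame_ee c) x _) by (rewrite /frame_ee; is_along_tac).
rewrite (is_alongE F) along_form_e// along_frame_e//.
have := lie_covariant oU Gs tf ks pf es es Ux c.
rewrite -/(coord_field k).
have -> : cov G frame_e (bracket k' frame_e) c x = 0.
  by apply: (cov_eq0r _ _ _ oU Ux) => i y; exact: frame_bracket.
have -> : cov G (bracket k' frame_e) frame_e c x = 0.
  by rewrite covE alongE !frame_bracket//; move_partials; ring.
rewrite bracketE => /eqP; rewrite subr_eq => /eqP ->.
rewrite ![along _ (k' c) x]alongE /frame_ee.
by move: (cov _ _ _ i0 x) (cov _ _ _ i1 x) => a b; move_partials; ring.
Qed.

Let coefAs : smooth_on U coef_A. Proof. by rewrite /coef_A /vol2; smooth_tac. Qed.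
Let coefBs : smooth_on U coef_B. Proof. by rewrite /coef_B /vol2; smooth_tac. Qed.

(** Both Gh_e e and the frame are invariant under k, hence so are the components of
    Gh_e e in the frame. *)
Lemma along_coef x : U x -> along k' coef_A x = 0 /\ along k' coef_B x = 0.
Proof.
move=> Ux.
have E c : along k' coef_A x * k' c x - along k' coef_B x * frame_e c x = 0.
  eassert (F : is_along k' (fun x => coef_A x * k' c x - coef_B x * frame_e c x) x _) by is_along_tac.
  have {}F := is_alongE F.
  rewrite -(along_eq _ oU (frame_eeE c) Ux) along_frame_ee// along_frame_e// in F.
  move: F; rewrite ![along _ (k' c) x]alongE !frame_eeE// => /eqP; rewrite eq_sym -subr_eq0 => /eqP <-.
  move_partials; ring.
have := v0 Ux; rewrite /vol2 => d.
apply: (@lin2_zero (k' i0 x) (- frame_e i0 x) (k' i1 x) (- frame_e i1 x)).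
- have -> : k' i0 x * - frame_e i1 x - - frame_e i0 x * k' i1 x
    = - (k' i0 x * frame_e i1 x - k' i1 x * frame_e i0 x) by ring.
  by rewrite oppr_eq0.
- by rewrite -[RHS](E i0); ring.
- by rewrite -[RHS](E i1); ring.
Qed.

Theorem adapted_frame_exists :
  adapted_frame U G k Ups frame_e form_be coef_A coef_B.
Proof.
have bk x : U x -> form_be i0 x * k x 0 i0 + form_be i1 x * k x 0 i1 = form_k x.
  exact: form_be_k.
split.
- exact: es.
- exact: bes.
- exact: coefAs.
- exact: coefBs.
- exact: v0.
- move=> c x Ux; rewrite bk// /form_k /frame_e -/(k' c x).
  by move: (cov _ _ _ _ _) => a; field.
- move=> c x Ux; rewrite bk// form_be_e// -/(k' c x).
  have -> : cov G frame_e k' c x = 2 / 3 * jerk_w x * w c x - u c x.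
    rewrite !covE !alongE /frame_e !covE !alongE; move_partials; ring.
  by rewrite jerkE// /form_k /form_e /frame_e; field.
- by move=> c x Ux; rewrite form_be_e// -/(k' c x) -frame_eeE.
- exact: frame_bracket.
- exact: lie_form_be.
- by move=> x /along_coef [].
- by move=> x /along_coef [].
Qed.

End AdaptedFrameExists.

(** * The dual coframe and the Schouten tensor in an adapted frame *)

Section AdaptedFrameGeometry.
Context {R : realType}.

Variables (U : set 'rV[R]_2) (G : @connection R 2) (k Ups : 'rV[R]_2 -> 'rV[R]_2).
Variables (e be : field_ R) (A B : 'rV[R]_2 -> R).
Hypotheses (oU : open U) (Gs : smooth_connection U G) (tf : torsion_free U G).
Hypotheses (ks : smooth_mx_on U k) (af : adapted_frame U G k Ups e be A B).

Notation k' := (coord_field k).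
Notation vol := (vol2 k' e).

Let k's i : smooth_on U (k' i). Proof. exact: ks. Qed.
Let es i : smooth_on U (e i). Proof. exact: af_frame_smooth af i. Qed.
Let bes i : smooth_on U (be i). Proof. exact: af_form_smooth af i. Qed.
Let As : smooth_on U A. Proof. exact: af_A_smooth af. Qed.
Let Bs : smooth_on U B. Proof. exact: af_B_smooth af. Qed.
Let v0 x : U x -> vol x != 0. Proof. exact: af_vol af x. Qed.
Let vs : smooth_on U vol. Proof. by rewrite /vol2; smooth_tac. Qed.
Let Gs' a b c : smooth_on U (G a b c). Proof. exact: Gs. Qed.

(** The coframe dual to (k, e). *)
Definition sg a x : R := (if a == i0 then e i1 x else - e i0 x) * (vol x)^-1.
Definition th a x : R := (if a == i0 then - k' i1 x else k' i0 x) * (vol x)^-1.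

Lemma smooth_sg a : smooth_on U (sg a).
Proof. by move: a; apply: ord2P; rewrite /sg /=; smooth_tac. Qed.

Lemma smooth_th a : smooth_on U (th a).
Proof. by move: a; apply: ord2P; rewrite /th /=; smooth_tac. Qed.

Lemma along_e c x : U x -> along k' (e c) x = along e (k' c) x.
Proof.
by move=> Ux; have := af_bracket af c Ux; rewrite bracketE => /eqP; rewrite subr_eq0 => /eqP.
Qed.

(** The coframe dual to a commuting frame is closed. *)
Lemma closed_th i j x : U x -> partial i (th j) x = partial j (th i) x.
Proof.
move=> Ux; suff H : partial i0 (th i1) x = partial i1 (th i0) x.
  by move: i j; apply: ord2P; apply: ord2P.
have v := v0 Ux.
eassert (F1 : is_partial i0 (th i1) x _) by (rewrite /th /= /vol2; is_partial_tac).
eassert (F0 : is_partial i1 (th i0) x _) by (rewrite /th /= /vol2; is_partial_tac).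
rewrite (is_partialE F1) (is_partialE F0); clear F1 F0.
have := along_e i0 Ux; have := along_e i1 Ux; rewrite !alongE => E1 E0.
move: v; rewrite /vol2 => v.
move: v E0 E1; move: (partial i0 (k' i0) x) (partial i1 (k' i0) x) (partial i0 (k' i1) x) (partial i1 (k' i1) x)
  (partial i0 (e i0) x) (partial i1 (e i0) x) (partial i0 (e i1) x) (partial i1 (e i1) x) => k00 k01 k10 k11 e00 e01 e10 e11.
move: (k' i0 x) (k' i1 x) (e i0 x) (e i1 x) => k0 k1 e0 e1 v E0 E1.
apply: (@eq_lincomb R _ _ ((k0 * e1 - k1 * e0)^-1 ^+ 2
   * (k1 * (k0 * e00 + k1 * e01 - (e0 * k00 + e1 * k01))
      - k0 * (k0 * e10 + k1 * e11 - (e0 * k10 + e1 * k11))))); first by field.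
by rewrite E0 E1 !subrr !mulr0 subrr mulr0.
Qed.

Lemma closed_sg i j x : U x -> partial i (sg j) x = partial j (sg i) x.
Proof.
move=> Ux; suff H : partial i0 (sg i1) x = partial i1 (sg i0) x.
  by move: i j; apply: ord2P; apply: ord2P.
have v := v0 Ux.
eassert (F1 : is_partial i0 (sg i1) x _) by (rewrite /sg /= /vol2; is_partial_tac).
eassert (F0 : is_partial i1 (sg i0) x _) by (rewrite /sg /= /vol2; is_partial_tac).
rewrite (is_partialE F1) (is_partialE F0); clear F1 F0.
have := along_e i0 Ux; have := along_e i1 Ux; rewrite !alongE => E1 E0.
move: v; rewrite /vol2 => v.
move: v E0 E1; move: (partial i0 (k' i0) x) (partial i1 (k' i0) x) (partial i0 (k' i1) x) (partial i1 (k' i1) x)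
  (partial i0 (e i0) x) (partial i1 (e i0) x) (partial i0 (e i1) x) (partial i1 (e i1) x) => k00 k01 k10 k11 e00 e01 e10 e11.
move: (k' i0 x) (k' i1 x) (e i0 x) (e i1 x) => k0 k1 e0 e1 v E0 E1.
apply: (@eq_lincomb R _ _ ((k0 * e1 - k1 * e0)^-1 ^+ 2
   * (e0 * (k0 * e10 + k1 * e11 - (e0 * k10 + e1 * k11))
      - e1 * (k0 * e00 + k1 * e01 - (e0 * k00 + e1 * k01))))); last first.
  by rewrite E0 E1 !subrr !mulr0 subrr mulr0.
by field.
Qed.

Lemma coframeE a c x : U x -> sg a x * k' c x + th a x * e c x = (c == a)%:R.
Proof.
move=> /v0; rewrite /sg /th /vol2; move: a c; apply: ord2P => /=; apply: ord2P => /=;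
  move: (k' i0 x) (k' i1 x) (e i0 x) (e i1 x) => k0 k1 e0 e1 v; by field.
Qed.

Lemma sg_k x : U x -> k' i0 x * sg i0 x + k' i1 x * sg i1 x = 1.
Proof.
by move=> /v0; rewrite /sg /= /vol2; move: (k' i0 x) (k' i1 x) (e i0 x) (e i1 x) => k0 k1 e0 e1 v; field.
Qed.

Lemma th_k x : U x -> k' i0 x * th i0 x + k' i1 x * th i1 x = 0.
Proof. by move=> _; rewrite /th /=; ring. Qed.

Lemma sg_e x : U x -> e i0 x * sg i0 x + e i1 x * sg i1 x = 0.
Proof. by move=> _; rewrite /sg /=; ring. Qed.

Lemma th_e x : U x -> e i0 x * th i0 x + e i1 x * th i1 x = 1.
Proof.
by move=> /v0; rewrite /th /= /vol2; move: (k' i0 x) (k' i1 x) (e i0 x) (e i1 x) => k0 k1 e0 e1 v; field.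
Qed.

(** The connection in the projective class of G for which k is affine. *)
Definition Gh c a b x : R := G c a b x + ((c == a)%:R * be b x + (c == b)%:R * be a x).

Let Ghs c a b : smooth_on U (Gh c a b).
Proof. by rewrite /Gh; smooth_tac. Qed.

Lemma frame_vanish (T : 'I_2 -> R) x : U x ->
  k' i0 x * T i0 + k' i1 x * T i1 = 0 -> e i0 x * T i0 + e i1 x * T i1 = 0 ->
  forall a, T a = 0.
Proof.
move=> Ux H1 H2; have := @lin2_zero R _ _ _ _ (T i0) (T i1) (v0 Ux) H1 H2.
by move=> [T0 T1]; apply: ord2P.
Qed.

(** The partial derivatives of k are found from its covariant derivatives along k and e. *)
Lemma partial_k a c x : U x -> partial a (k' c) x =
  - (Gh c a i0 x * k' i0 x + Gh c a i1 x * k' i1 x) - sg a x * e c x.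
Proof.
move=> Ux; apply/eqP; rewrite -subr_eq0; apply/eqP; move: a.
apply: (@frame_vanish (fun a => partial a (k' c) x - (- (Gh c a i0 x * k' i0 x + Gh c a i1 x * k' i1 x) - sg a x * e c x)) x Ux).
  have := af_kk af c Ux; rewrite covE alongE -/(k' c x) -[k x 0 i0]/(k' i0 x) -[k x 0 i1]/(k' i1 x) => E.
  have := sg_k Ux => S.
  apply: (@eq_lincomb R _ _ (cov G k' k' c x + 2 * (be i0 x * k' i0 x + be i1 x * k' i1 x) * k' c x + e c x
     + (k' i0 x * sg i0 x + k' i1 x * sg i1 x - 1) * e c x)); last first.
    by rewrite S covE alongE E; ring.
  by rewrite covE alongE; move: c {E}; apply: ord2P; rewrite /Gh /= ?(tf _ i1 i0 Ux);
    move: (sg _ _) (sg _ _) => s0 s1; move_partials; ring.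
have := af_ek af c Ux; rewrite covE alongE -/(k' c x) -[k x 0 i0]/(k' i0 x) -[k x 0 i1]/(k' i1 x) => E.
apply: (@eq_lincomb R _ _ (cov G e k' c x
   + (be i0 x * e i0 x + be i1 x * e i1 x) * k' c x
   + (be i0 x * k' i0 x + be i1 x * k' i1 x) * e c x
   + (e i0 x * sg i0 x + e i1 x * sg i1 x) * e c x)); last first.
  by rewrite sg_e// covE alongE E; ring.
by rewrite covE alongE; move: c {E}; apply: ord2P; rewrite /Gh /= ?(tf _ i1 i0 Ux);
  move: (sg _ _) (sg _ _) => s0 s1; move_partials; ring.
Qed.

Lemma partial_e a c x : U x -> partial a (e c) x =
  - (Gh c a i0 x * e i0 x + Gh c a i1 x * e i1 x)
  + th a x * (A x * k' c x - B x * e c x).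
Proof.
move=> Ux; apply/eqP; rewrite -subr_eq0; apply/eqP; move: a.
apply: (@frame_vanish (fun a => partial a (e c) x - (- (Gh c a i0 x * e i0 x + Gh c a i1 x * e i1 x)
  + th a x * (A x * k' c x - B x * e c x))) x Ux).
  have := af_ek af c Ux; rewrite covE alongE -/(k' c x) -[k x 0 i0]/(k' i0 x) -[k x 0 i1]/(k' i1 x) => E.
  have := along_e c Ux; rewrite !alongE => L.
  apply: (@eq_lincomb R _ _ (cov G e k' c x
     + (be i0 x * e i0 x + be i1 x * e i1 x) * k' c x
     + (be i0 x * k' i0 x + be i1 x * k' i1 x) * e c x
     + (k' i0 x * partial i0 (e c) x + k' i1 x * partial i1 (e c) x
       - (e i0 x * partial i0 (k' c) x + e i1 x * partial i1 (k' c) x))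
     - (k' i0 x * th i0 x + k' i1 x * th i1 x) * (A x * k' c x - B x * e c x))); last first.
    by rewrite th_k// covE alongE E L; ring.
  by rewrite covE alongE; move: c {E L}; apply: ord2P; rewrite /Gh /= ?(tf _ i1 i0 Ux);
    move: (th _ _) (th _ _) => s0 s1; move_partials; ring.
have := af_ee af c Ux; rewrite covE alongE -/(k' c x) => E.
apply: (@eq_lincomb R _ _ (cov G e e c x
   + 2 * (be i0 x * e i0 x + be i1 x * e i1 x) * e c x - (A x * k' c x - B x * e c x)
   - (e i0 x * th i0 x + e i1 x * th i1 x - 1) * (A x * k' c x - B x * e c x))); last first.
  by rewrite th_e// covE alongE E; ring.
by rewrite covE alongE; move: c {E}; apply: ord2P; rewrite /Gh /= ?(tf _ i1 i0 Ux);
  move: (th _ _) (th _ _) => s0 s1; move_partials; ring.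
Qed.

(** The component R_{01}^c_b of the curvature of Gh. *)
Definition curv c b x : R := partial i0 (Gh c i1 b) x - partial i1 (Gh c i0 b) x
  + (Gh c i0 i0 x * Gh i0 i1 b x + Gh c i0 i1 x * Gh i1 i1 b x)
  - (Gh c i1 i0 x * Gh i0 i0 b x + Gh c i1 i1 x * Gh i1 i0 b x).

(** The Ricci identity for k: equality of the mixed second derivatives of k, whose
    first derivatives are known from [partial_k] and [partial_e]. *)
Lemma curv_k c x : U x -> curv c i0 x * k' i0 x + curv c i1 x * k' i1 x
  = (sg i0 x * th i1 x - sg i1 x * th i0 x) * (A x * k' c x - B x * e c x).
Proof.
move=> Ux.
have ss a := smooth_sg a; have ts a := smooth_th a.
pose F a y := - (Gh c a i0 y * k' i0 y + Gh c a i1 y * k' i1 y) - sg a y * e c y.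
have E0 y : U y -> partial i0 (k' c) y = F i0 y by exact: partial_k.
have E1 y : U y -> partial i1 (k' c) y = F i1 y by exact: partial_k.
have S := schwarz i0 i1 oU (k's c) Ux.
rewrite (partial_eq oU E1 _ Ux) (partial_eq oU E0 _ Ux) in S.
eassert (H0 : is_partial i1 (F i0) x _) by (rewrite /F; is_partial_tac).
eassert (H1 : is_partial i0 (F i1) x _) by (rewrite /F; is_partial_tac).
move: S; rewrite (is_partialE H0) (is_partialE H1); clear H0 H1 => S.
rewrite (closed_sg i1 i0 Ux) !partial_k// !partial_e// in S.
move/eqP: S; rewrite eq_sym -subr_eq0 => /eqP S.
apply: eq_lincomb S; rewrite /curv; move: c {E0 E1 F}; apply: ord2P;
  move: (sg i0 x) (sg i1 x) (th i0 x) (th i1 x) => s0 s1 t0 t1; move_partials; ring.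
Qed.

Lemma along_k_th f x : U x -> along k' f x = 0 ->
  partial i0 f x * th i1 x - partial i1 f x * th i0 x = 0.
Proof.
move=> Ux; rewrite alongE /th /= => H.
apply: (@eq_trans _ _ ((k' i0 x * partial i0 f x + k' i1 x * partial i1 f x) * (vol x)^-1)).
  by move_partials; ring.
by rewrite H mul0r.
Qed.

(** The Ricci identity for e, where A and B do not contribute derivatives: their
    differentials are multiples of th. *)
Lemma curv_e c x : U x -> curv c i0 x * e i0 x + curv c i1 x * e i1 x
  = - (sg i0 x * th i1 x - sg i1 x * th i0 x) * A x * e c x.
Proof.
move=> Ux.
have ss a := smooth_sg a; have ts a := smooth_th a.
pose F a y := - (Gh c a i0 y * e i0 y + Gh c a i1 y * e i1 y)
  + th a y * (A y * k' c y - B y * e c y).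
have E0 y : U y -> partial i0 (e c) y = F i0 y by exact: partial_e.
have E1 y : U y -> partial i1 (e c) y = F i1 y by exact: partial_e.
have S := schwarz i0 i1 oU (es c) Ux.
rewrite (partial_eq oU E1 _ Ux) (partial_eq oU E0 _ Ux) in S.
eassert (H0 : is_partial i1 (F i0) x _) by (rewrite /F; is_partial_tac).
eassert (H1 : is_partial i0 (F i1) x _) by (rewrite /F; is_partial_tac).
move: S; rewrite (is_partialE H0) (is_partialE H1); clear H0 H1 => S.
rewrite (closed_th i1 i0 Ux) !partial_k// !partial_e// in S.
have HA := along_k_th Ux (af_A af Ux); have HB := along_k_th Ux (af_B af Ux).
move/eqP: S; rewrite eq_sym -subr_eq0 => /eqP S.
move: S HA HB; set l := (X in X = 0 -> _) => S.
set la := (X in X = 0 -> _) => HA; set lb := (X in X = 0 -> _) => HB.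
apply: (@eq_lincomb R _ _ (l + la * k' c x - lb * e c x)); last by rewrite S HA HB; ring.
rewrite /l /la /lb /curv; move: c {E0 E1 F S l HA HB la lb}; apply: ord2P;
  move: (sg i0 x) (sg i1 x) (th i0 x) (th i1 x) => s0 s1 t0 t1; move_partials; ring.
Qed.

Lemma vol_coframe x : U x -> sg i0 x * th i1 x - sg i1 x * th i0 x = (vol x)^-1.
Proof.
by move=> /v0; rewrite /sg /th /= /vol2; move: (k' i0 x) (k' i1 x) (e i0 x) (e i1 x) => k0 k1 e0 e1 v; field.
Qed.

Lemma curvE c b x : U x -> curv c b x
  = (vol x)^-1 * ((A x * k' c x - B x * e c x) * sg b x - A x * e c x * th b x).
Proof.
move=> Ux; apply/eqP; rewrite -subr_eq0; apply/eqP; move: b.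
apply: (@frame_vanish (fun b => curv c b x
  - (vol x)^-1 * ((A x * k' c x - B x * e c x) * sg b x - A x * e c x * th b x)) x Ux).
  have := curv_k c Ux; rewrite vol_coframe//.
  have := sg_k Ux; have := th_k Ux.
  move: (curv c i0 x) (curv c i1 x) (sg i0 x) (sg i1 x) (th i0 x) (th i1 x) ((vol x)^-1) => c0 c1 s0 s1 t0 t1 v T S E.
  apply: (@eq_lincomb R _ _ (c0 * k' i0 x + c1 * k' i1 x - v * (A x * k' c x - B x * e c x)
     - v * (A x * k' c x - B x * e c x) * (k' i0 x * s0 + k' i1 x * s1 - 1)
     + v * A x * e c x * (k' i0 x * t0 + k' i1 x * t1))); last by rewrite T S E; ring.
  by ring.
have := curv_e c Ux; rewrite vol_coframe//.
have := sg_e Ux; have := th_e Ux.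
move: (curv c i0 x) (curv c i1 x) (sg i0 x) (sg i1 x) (th i0 x) (th i1 x) ((vol x)^-1) => c0 c1 s0 s1 t0 t1 v T S E.
apply: (@eq_lincomb R _ _ (c0 * e i0 x + c1 * e i1 x + v * A x * e c x
     - v * (A x * k' c x - B x * e c x) * (e i0 x * s0 + e i1 x * s1)
     + v * A x * e c x * (e i0 x * t0 + e i1 x * t1 - 1))); last by rewrite T S E; ring.
by ring.
Qed.

(** The Ricci tensor of Gh is a contraction of the curvature [curvE], and the Schouten
    tensors of projectively equivalent connections differ by derivatives of be and by
    be (x) be. *)
Lemma schouten_symE a b x : U x ->
  2^-1 * (schouten G a b x + schouten G b a x)
  = B x * sg a x * sg b x + A x * (sg a x * th b x + th a x * sg b x)
    + 2^-1 * (partial a (be b) x + partial b (be a) x)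
    - (G i0 a b x * be i0 x + G i1 a b x * be i1 x) - be a x * be b x.
Proof.
move=> Ux.
have pG a' c : partial a' (G c i1 i0) x = partial a' (G c i0 i1) x.
  by apply: (partial_eq oU) => // y; exact: tf.
have pGh a' c b' d : partial a' (Gh c b' d) x = partial a' (G c b' d) x
    + ((c == b')%:R * partial a' (be d) x + (c == d)%:R * partial a' (be b') x).
  eassert (F : is_partial a' (Gh c b' d) x _) by (rewrite /Gh; is_partial_tac).
  by rewrite (is_partialE F); move_partials; ring.
have C c d := curvE c d Ux.
have tf' c := tf c i1 i0 Ux.
have -> : schouten G a b x + schouten G b a x = ricci G a b x + ricci G b a x.
  by rewrite /schouten; field.
(* the difference of the two sides is the combination Y of the curvature identities
   X = 0 *)
pose X c d := curv c d x
  - (vol x)^-1 * ((A x * k' c x - B x * e c x) * sg d x - A x * e c x * th d x).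
have X0 c d : X c d = 0 by rewrite /X C subrr.
pose Y := if a == i0 then (if b == i0 then - X i1 i0 else 2^-1 * (X i0 i0 - X i1 i1))
          else if b == i0 then 2^-1 * (X i0 i0 - X i1 i1) else X i0 i1.
apply: (@eq_lincomb R _ _ Y); last by rewrite /Y !X0 subrr mulr0 oppr0; do 2 case: ifP.
rewrite /Y /X /curv /ricci !sum2 !pGh /Gh /sg /th /=; clear Y X X0 C pGh.
move: a b; apply: ord2P => /=; apply: ord2P => /=; rewrite ?pG ?tf';
  move: ((vol x)^-1) => v; move_partials; by field.
Qed.

End AdaptedFrameGeometry.

(** * The metric on the cotangent bundle in block form *)

Section BlockForm.
Context {R : realType}.
Notation I4 := 'I_(2 + 2).

Lemma symprodE n (u v : 'rV[R]_n) i j :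
  symprod u v i j = 2^-1 * (u 0 i * v 0 j + v 0 i * u 0 j).
Proof. by rewrite /symprod !mxE !big_ord1 !mxE. Qed.

Lemma dxl (a b : 'I_2) : dx a 0 (lshift 2 b) = (b == a)%:R :> R.
Proof. by rewrite mxE eqxx /= (inj_eq (@lshift_inj _ _)). Qed.

Lemma dxr (a b : 'I_2) : dx a 0 (rshift 2 b) = 0 :> R.
Proof. by rewrite mxE eqxx /= eq_rlshift. Qed.

Lemma dzl (a b : 'I_2) : dz a 0 (lshift 2 b) = 0 :> R.
Proof. by rewrite mxE eqxx /= eq_lrshift. Qed.

Lemma dzr (a b : 'I_2) : dz a 0 (rshift 2 b) = (b == a)%:R :> R.
Proof. by rewrite mxE eqxx /= (inj_eq (@rshift_inj _ _)). Qed.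

Definition metric_coef (G : @connection R 2) (m : 'rV[R]_(2 + 2)) (a b : 'I_2) : R :=
  G i0 a b (lsubmx m) * rsubmx m 0 i0 + G i1 a b (lsubmx m) * rsubmx m 0 i1
  - rsubmx m 0 a * rsubmx m 0 b - schouten G a b (lsubmx m).

Definition metric_xx G m : 'M[R]_2 :=
  \matrix_(a, b) (- (2^-1 * (metric_coef G m a b + metric_coef G m b a))).

Lemma metricE G m :
  metric G m = block_mx (metric_xx G m) (2^-1)%:M (2^-1)%:M 0.
Proof.
apply/matrixP => i j; rewrite /metric !sum2 -!/(metric_coef G m _ _).
have addE (P Q : 'M[R]_(2 + 2)) : (P + Q) i j = P i j + Q i j by rewrite mxE.
have oppE (P : 'M[R]_(2 + 2)) : (- P) i j = - P i j by rewrite mxE.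
have scaleE c (P : 'M[R]_(2 + 2)) : (c *: P) i j = c * P i j by rewrite mxE.
rewrite !(addE, oppE, symprodE, scaleE).
case: (split_ordP i) => a ->; case: (split_ordP j) => b ->;
  rewrite ?block_mxEul ?block_mxEur ?block_mxEdl ?block_mxEdr !mxE ?dxl ?dxr ?dzl ?dzr.
all: move: a b; apply: ord2P => /=; apply: ord2P => /=; rewrite ?mulr0n ?mulr1n.
all: move: (metric_coef G m i0 i0) (metric_coef G m i0 i1) (metric_coef G m i1 i0) (metric_coef G m i1 i1) => c00 c01 c10 c11; by field.
Qed.

End BlockForm.

(** * The Hodge dual of a three-form *)

Section Hodge.
Context {R : realType}.
Notation I4 := 'I_(2 + 2).
Implicit Types (X J g : 'M[R]_(2 + 2)) (T : I4 -> I4 -> I4 -> R).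

Definition eps (a b c d : I4) : R :=
  \det (\matrix_(i < 4, j < 4) (tnth [tuple a; b; c; d] i == j)%:R).

Lemma sum_delta (f : I4 -> R) (j : I4) : \sum_a f a * (a == j)%:R = f j.
Proof.
rewrite (bigD1 j)//= eqxx mulr1 big1 ?addr0// => i ij.
by rewrite (negbTE ij) mulr0.
Qed.

Lemma prod_sum4 (f g h k : I4 -> R) :
  (\sum_a f a) * (\sum_b g b) * (\sum_c h c) * (\sum_d k d)
  = \sum_a \sum_b \sum_c \sum_d f a * g b * h c * k d.
Proof.
rewrite -!mulrA mulr_suml; apply: eq_bigr => a _.
rewrite mulr_suml mulr_sumr; apply: eq_bigr => b _.
rewrite mulr_suml !mulr_sumr; apply: eq_bigr => c _.
by rewrite !mulr_sumr; apply: eq_bigr => d _; rewrite !mulrA.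
Qed.

(** The Leibniz formula for the determinant of the matrix of the rows n, i, j, l of X. *)
Lemma eps_mul X (n i j l : I4) :
  \sum_e \sum_a \sum_b \sum_c X n e * X i a * X j b * X l c * eps e a b c
  = eps n i j l * \det X.
Proof.
pose o1 : I4 := lift ord0 ord0; pose o2 : I4 := lift ord0 (lift ord0 ord0).
pose o3 : I4 := lift ord0 (lift ord0 (lift ord0 ord0)).
have prod4 (F : I4 -> R) : \prod_i F i = F ord0 * F o1 * F o2 * F o3.
  by rewrite !big_ord_recl big_ord0 mulr1 !mulrA.
have epsE (e a b c : I4) : eps e a b c = \sum_(s : {perm I4}) (-1) ^+ s *
    ((e == s ord0)%:R * (a == s o1)%:R * (b == s o2)%:R * (c == s o3)%:R).
  rewrite /eps /determinant; apply: eq_bigr => s _; congr (_ * _).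
  by rewrite prod4 !mxE.
pose P := \matrix_(r < 4, q < 4) (tnth [tuple n; i; j; l] r == q)%:R : 'M[R]_(2 + 2).
have -> : eps n i j l * \det X = \det (P *m X) by rewrite det_mulmx.
have PX r q : (P *m X) r q = X (tnth [tuple n; i; j; l] r) q.
  rewrite mxE -[RHS](sum_delta (fun t => X t q)); apply: eq_bigr => t _.
  by rewrite mxE mulrC eq_sym.
have -> : \det (P *m X) = \sum_(s : {perm I4}) (-1) ^+ s *
    (X n (s ord0) * X i (s o1) * X j (s o2) * X l (s o3)).
  by rewrite /determinant; apply: eq_bigr => s _; rewrite prod4 !PX.
transitivity (\sum_(s : {perm I4}) (-1) ^+ s * (
   (\sum_e X n e * (e == s ord0)%:R) * (\sum_a X i a * (a == s o1)%:R)
   * (\sum_b X j b * (b == s o2)%:R) * (\sum_c X l c * (c == s o3)%:R))); last first.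
  by apply: eq_bigr => s _; rewrite !sum_delta.
have E (s : {perm I4}) : (-1) ^+ s * (
   (\sum_e X n e * (e == s ord0)%:R) * (\sum_a X i a * (a == s o1)%:R)
   * (\sum_b X j b * (b == s o2)%:R) * (\sum_c X l c * (c == s o3)%:R))
   = \sum_e \sum_a \sum_b \sum_c X n e * X i a * X j b * X l c * ((-1) ^+ s *
    ((e == s ord0)%:R * (a == s o1)%:R * (b == s o2)%:R * (c == s o3)%:R)).
  rewrite prod_sum4 mulr_sumr; apply: eq_bigr => e _; rewrite mulr_sumr; apply: eq_bigr => a _.
  rewrite mulr_sumr; apply: eq_bigr => b _; rewrite mulr_sumr; apply: eq_bigr => c _.
  by move: (X n e) (X i a) (X j b) (X l c) ((_ == _)%:R) ((_ == _)%:R) ((_ == _)%:R) ((_ == _)%:R) ((-1) ^+ s) => *; ring.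
under [RHS]eq_bigr do rewrite E.
rewrite [RHS]exchange_big; apply: eq_bigr => e _; rewrite [RHS]exchange_big; apply: eq_bigr => a _.
rewrite [RHS]exchange_big; apply: eq_bigr => b _; rewrite [RHS]exchange_big; apply: eq_bigr => c _.
by rewrite epsE mulr_sumr.
Qed.

(** The vector density obtained by contraction with the Levi-Civita symbol. The Hodge
    dual factors through it, and its behaviour under linear maps is simple. *)
Definition dual_vector T : 'rV[R]_(2 + 2) :=
  \row_n (6^-1 * \sum_i \sum_j \sum_l eps n i j l * T i j l).

Definition pull3 J T : I4 -> I4 -> I4 -> R := fun a b c =>
  \sum_i \sum_j \sum_l J a i * J b j * J c l * T i j l.

Lemma dual_vector_pull J T : dual_vector (pull3 J T) *m J = \det J *: dual_vector T.
Proof.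
apply/rowP => n'; rewrite !mxE.
transitivity (6^-1 * \sum_i' \sum_j' \sum_l' (eps n' i' j' l' * \det J^T) * T i' j' l'); last first.
  rewrite det_tr mulrCA; congr (_ * _); rewrite mulr_sumr; apply: eq_bigr => i _.
  rewrite mulr_sumr; apply: eq_bigr => j _; rewrite mulr_sumr; apply: eq_bigr => l _.
  by rewrite mulrAC mulrC.
under eq_bigr do rewrite mxE -mulrA mulr_suml.
rewrite -mulr_sumr; congr (_ * _).
transitivity (\sum_n \sum_i \sum_j \sum_l \sum_i' \sum_j' \sum_l'
    J^T n' n * J^T i' i * J^T j' j * J^T l' l * eps n i j l * T i' j' l').
  apply: eq_bigr => n _; apply: eq_bigr => i _; rewrite mulr_suml; apply: eq_bigr => j _.
  rewrite mulr_suml; apply: eq_bigr => l _; rewrite /pull3 mulrC mulrA mulr_sumr.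
  apply: eq_bigr => i' _; rewrite mulr_sumr; apply: eq_bigr => j' _.
  rewrite mulr_sumr; apply: eq_bigr => l' _; rewrite !mxE.
  by move: (J _ _) (J _ _) (J _ _) (J _ _) (eps _ _ _ _) (T _ _ _) => *; ring.
under eq_bigr => n _ do under eq_bigr => i _ do under eq_bigr => j _ do rewrite exchange_big /=.
under eq_bigr => n _ do under eq_bigr => i _ do rewrite exchange_big /=.
under eq_bigr => n _ do rewrite exchange_big /=.
rewrite exchange_big /=; apply: eq_bigr => i' _.
under eq_bigr => n _ do under eq_bigr => i _ do under eq_bigr => j _ do rewrite exchange_big /=.
under eq_bigr => n _ do under eq_bigr => i _ do rewrite exchange_big /=.
under eq_bigr => n _ do rewrite exchange_big /=.
rewrite exchange_big /=; apply: eq_bigr => j' _.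
under eq_bigr => n _ do under eq_bigr => i _ do under eq_bigr => j _ do rewrite exchange_big /=.
under eq_bigr => n _ do under eq_bigr => i _ do rewrite exchange_big /=.
under eq_bigr => n _ do rewrite exchange_big /=.
rewrite exchange_big /=; apply: eq_bigr => l' _.
rewrite -eps_mul mulr_suml; apply: eq_bigr => n _; rewrite mulr_suml; apply: eq_bigr => i _.
rewrite mulr_suml; apply: eq_bigr => j _; rewrite mulr_suml; apply: eq_bigr => l _.
by [].
Qed.

(** By [eps_mul] for g^-1, raising three indices of the Levi-Civita symbol amounts to
    lowering the remaining one with g and dividing by det g. *)
Lemma hodge3E g T : g \in unitmx ->
  hodge3 g T = - (Num.sqrt `|\det g| / \det g) *: (dual_vector T *m g).
Proof.
move=> gu; apply/rowP => d; rewrite [LHS]mxE [RHS]mxE [X in _ = _ * X]mxE.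
set gi := invmx g; set s := Num.sqrt _.
transitivity (6^-1 * \sum_i \sum_j \sum_l \sum_a \sum_b \sum_c
    (- s) * (gi^T i a * gi^T j b * gi^T l c * eps d a b c) * T i j l).
  congr (_ * _).
  transitivity (\sum_a \sum_b \sum_c \sum_i \sum_j \sum_l
      (- s) * (gi^T i a * gi^T j b * gi^T l c * eps d a b c) * T i j l).
    apply: eq_bigr => a _; apply: eq_bigr => b _; apply: eq_bigr => c _.
    rewrite mulr_sumr; apply: eq_bigr => i _; rewrite mulr_sumr; apply: eq_bigr => j _.
    rewrite mulr_sumr; apply: eq_bigr => l _; rewrite /volume -/(eps d a b c) -/s !mxE.
    by move: (gi _ _) (gi _ _) (gi _ _) (eps _ _ _ _) (T _ _ _) => *; ring.
  under eq_bigr => a _ do under eq_bigr => b _ do rewrite exchange_big /=.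
  under eq_bigr => a _ do rewrite exchange_big /=.
  rewrite exchange_big /=; apply: eq_bigr => i _.
  under eq_bigr => a _ do under eq_bigr => b _ do rewrite exchange_big /=.
  under eq_bigr => a _ do rewrite exchange_big /=.
  rewrite exchange_big /=; apply: eq_bigr => j _.
  under eq_bigr => a _ do under eq_bigr => b _ do rewrite exchange_big /=.
  under eq_bigr => a _ do rewrite exchange_big /=.
  by rewrite exchange_big.
have key i j l : \sum_a \sum_b \sum_c gi^T i a * gi^T j b * gi^T l c * eps d a b c
    = (\det g)^-1 * \sum_n g n d * eps n i j l.
  have dgi : \det gi^T = (\det g)^-1 by rewrite det_tr det_inv.
  transitivity (\sum_n g n d * (eps n i j l * \det gi^T)); last first.
    rewrite dgi mulr_sumr; apply: eq_bigr => n _.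
    by move: (eps _ _ _ _) (g _ _) (_^-1) => *; ring.
  transitivity (\sum_n g n d * \sum_e \sum_a \sum_b \sum_c
      gi^T n e * gi^T i a * gi^T j b * gi^T l c * eps e a b c); last first.
    by apply: eq_bigr => n _; rewrite eps_mul.
  transitivity (\sum_e (\sum_n g n d * gi^T n e) * \sum_a \sum_b \sum_c
      gi^T i a * gi^T j b * gi^T l c * eps e a b c).
    transitivity (\sum_e (\sum_a \sum_b \sum_c gi^T i a * gi^T j b * gi^T l c * eps e a b c)
        * (e == d)%:R); first by rewrite (sum_delta (fun e => _)).
    apply: eq_bigr => e _; rewrite mulrC; congr (_ * _).
    have : (gi *m g) e d = (1%:M : 'M[R]_(2 + 2)) e d by rewrite /gi (mulVmx gu).
    rewrite !mxE => <-; apply: eq_bigr => n _; rewrite mxE mulrC; congr (_ * _).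
  transitivity (\sum_e \sum_n g n d * \sum_a \sum_b \sum_c
      gi^T n e * gi^T i a * gi^T j b * gi^T l c * eps e a b c).
    apply: eq_bigr => e _; rewrite mulr_suml; apply: eq_bigr => n _.
    rewrite -mulrA; congr (_ * _); rewrite mulr_sumr; apply: eq_bigr => a _.
    rewrite mulr_sumr; apply: eq_bigr => b _; rewrite mulr_sumr; apply: eq_bigr => c _.
    by move: (gi^T n e) (gi^T i a) (gi^T j b) (gi^T l c) (eps _ _ _ _) => *; ring.
  by rewrite exchange_big; apply: eq_bigr => n _; rewrite mulr_sumr.
transitivity (6^-1 * \sum_i \sum_j \sum_l
   (- s) * ((\det g)^-1 * \sum_n g n d * eps n i j l) * T i j l).
  congr (_ * _); apply: eq_bigr => i _; apply: eq_bigr => j _; apply: eq_bigr => l _.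
  rewrite -key mulr_sumr mulr_suml; apply: eq_bigr => a _.
  rewrite mulr_sumr mulr_suml; apply: eq_bigr => b _.
  by rewrite mulr_sumr mulr_suml.
under [in RHS]eq_bigr do rewrite mxE -mulrA mulr_suml.
rewrite -[in RHS]mulr_sumr mulrCA; congr (_ * _).
under [in RHS]eq_bigr => n _ do under eq_bigr => i _ do rewrite mulr_suml.
rewrite [in RHS]exchange_big mulr_sumr; apply: eq_bigr => i _ /=.
under [in RHS]eq_bigr => n _ do under eq_bigr => j _ do rewrite mulr_suml.
rewrite [in RHS]exchange_big mulr_sumr; apply: eq_bigr => j _ /=.
rewrite [in RHS]exchange_big mulr_sumr; apply: eq_bigr => l _ /=.
rewrite !mulr_sumr mulr_suml; apply: eq_bigr => n _.
by move: (g _ _) (eps _ _ _ _) (T _ _ _) (_^-1) => *; ring.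
Qed.

End Hodge.

Notation l0 := (lshift 2 i0).
Notation l1 := (lshift 2 i1).
Notation r0 := (rshift 2 i0).
Notation r1 := (rshift 2 i1).

Section DualVector.
Context {R : realType}.
Notation I4 := 'I_(2 + 2).

Lemma sum4 (V : nmodType) (F : I4 -> V) : \sum_i F i = F l0 + F l1 + F r0 + F r1.
Proof. by rewrite big_split_ord /= !sum2 !addrA. Qed.

Lemma ord4P (P : I4 -> Prop) : P l0 -> P l1 -> P r0 -> P r1 -> forall i, P i.
Proof.
by move=> ? ? ? ? i; case: (split_ordP i) => a ->; move: a; apply: ord2P.
Qed.

(** The Laplace expansion over an arbitrary ring, so that the Levi-Civita symbol can be
    evaluated by computation with integers. *)
Definition det4_poly (S : pzRingType) (f : nat -> nat -> S) : S :=
  let d3 (a b c : nat) := f 1%N a * (f 2%N b * f 3%N c - f 2%N c * f 3%N b)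
    - f 1%N b * (f 2%N a * f 3%N c - f 2%N c * f 3%N a)
    + f 1%N c * (f 2%N a * f 3%N b - f 2%N b * f 3%N a) in
  f 0%N 0%N * d3 1%N 2%N 3%N - f 0%N 1%N * d3 0%N 2%N 3%N
  + f 0%N 2%N * d3 0%N 1%N 3%N - f 0%N 3%N * d3 0%N 1%N 2%N.

Lemma det4 (f : nat -> nat -> R) :
  \det (\matrix_(i < 4, j < 4) f i j) = det4_poly f.
Proof.
rewrite (expand_det_row _ ord0) !big_ord_recl big_ord0 /cofactor.
rewrite !(expand_det_row _ (@ord0 2)) !big_ord_recl !big_ord0 /cofactor.
rewrite !(expand_det_row _ (@ord0 1)) !big_ord_recl !big_ord0 /cofactor.
rewrite !det_mx11 !mxE /= /bump /= /det4_poly.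
rewrite ?addn0 ?add0n ?addn1 ?expr0 ?expr1 /=; ring.
Qed.

Definition epsz (a b c d : nat) : int :=
  det4_poly (fun i j => (nth 0%N [:: a; b; c; d] i == j)%:Z).

Lemma epsE (a b c d : I4) : eps a b c d = (epsz a b c d)%:~R :> R.
Proof.
pose f i j : R := (nth 0%N [:: a : nat; b : nat; c : nat; d : nat] i == j)%:R.
have -> : eps a b c d = \det (\matrix_(i < 4, j < 4) f i j).
  rewrite /eps; congr (\det _); apply/matrixP => i j; rewrite !mxE /f; congr (_%:R).
  rewrite (tnth_nth a) -val_eqE /=; congr (nat_of_bool (_ == _)).
  by case: i => [[|[|[|[|//]]]] ?].
rewrite det4 /epsz /det4_poly /f /= !(rmorphD, rmorphB, rmorphM, rmorphN) /=.
by [].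
Qed.

Ltac eval_eps := rewrite !epsE; repeat match goal with
  |- context [epsz ?a ?b ?c ?d] => let v := eval vm_compute in (epsz a b c d) in
    change (epsz a b c d) with v end.

Lemma dual_vector_wedge (u : 'rV[R]_(2 + 2)) (F : I4 -> I4 -> R) :
  (forall a b, F b a = - F a b) ->
  let S := dual_vector (wedge12 u F) in
  [/\ S 0 l0 = u 0 l1 * F r0 r1 - u 0 r0 * F l1 r1 + u 0 r1 * F l1 r0,
      S 0 l1 = - (u 0 l0 * F r0 r1 - u 0 r0 * F l0 r1 + u 0 r1 * F l0 r0),
      S 0 r0 = u 0 l0 * F l1 r1 - u 0 l1 * F l0 r1 + u 0 r1 * F l0 l1 &
      S 0 r1 = - (u 0 l0 * F l1 r0 - u 0 l1 * F l0 r0 + u 0 r0 * F l0 l1)].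
Proof.
move=> Fa S.
have F0 a : F a a = 0 by apply/eqP; have := Fa a a; move/eqP; rewrite -addr_eq0 -mulr2n mulrn_eq0.
have F10 := Fa l0 l1; have F20 := Fa l0 r0; have F30 := Fa l0 r1.
have F21 := Fa l1 r0; have F31 := Fa l1 r1; have F32 := Fa r0 r1.
split; rewrite /S mxE !sum4; eval_eps; rewrite ?mulr0z ?mulr1z ?mulrN1z ?NegzE ?mul0r ?addr0 ?add0r.
all: rewrite /wedge12 ?F10 ?F20 ?F30 ?F21 ?F31 ?F32.
all: move: (F l0 l1) (F l0 r0) (F l0 r1) (F l1 r0) (F l1 r1) (F r0 r1) => f01 f02 f03 f12 f13 f23.
all: move: (u 0 l0) (u 0 l1) (u 0 r0) (u 0 r1) => u0 u1 u2 u3; by field.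
Qed.

End DualVector.

(** * Functions of one coordinate, and the model *)

Section OneVariable.
Context {R : realType}.

Lemma partial_indep n (i : 'I_n) (f : 'rV[R]_n -> R) x :
  (forall y h, f (h *: delta_mx 0 i + y) = f y) -> partial i f x = 0.
Proof.
move=> fi; rewrite /partial /derive; set g := fun h : R => _.
have -> : g = fun=> 0 by apply/funext => h; rewrite /g /= fi subrr scaler0.
by apply: lim_cst.
Qed.

Lemma smooth1_derive (J : set R) f : smooth1_on J f -> smooth1_on J (derive1 f).
Proof. by move=> fs n t Jt; have := fs n.+1 t Jt; rewrite derive1Sn. Qed.

Lemma partial_comp1 n (i : 'I_n) (f : R -> R) (phi : 'rV[R]_n -> R) x :
  derivable f (phi x) 1 -> differentiable phi x ->
  is_partial i (fun y => f (phi y)) x (partial i phi x * derive1 f (phi x)).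
Proof.
move=> df dphi; have df' : differentiable f (phi x) by apply/derivable1_diffP.
have dc : differentiable (f \o phi) x by exact: differentiable_comp.
split=> //; rewrite (partialE i dc) diff_comp//= -partialE//.
by rewrite [in LHS](deriv1E df).
Qed.

Lemma Ck_comp1 n k (J : set R) (U : set 'rV[R]_n) f phi : open U ->
  smooth1_on J f -> (forall x, U x -> J (phi x)) -> smooth_on U phi ->
  Ck k U (fun x => f (phi x)).
Proof.
move=> oU; elim: k f => [|k IH] f fs UJ phis.
  apply/Ck0 => x Ux; apply: (@differentiable_comp _ _ _ _ phi f).
    exact: smooth_diff phis Ux.
  by apply/derivable1_diffP; exact: (fs 0%N _ (UJ x Ux)).
have P i x (Ux : U x) := partial_comp1 i (fs 0%N _ (UJ x Ux)) (smooth_diff phis Ux).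
apply/CkS; split=> [x Ux|i].
  apply: (@differentiable_comp _ _ _ _ phi f); first exact: smooth_diff phis Ux.
  by apply/derivable1_diffP; exact: (fs 0%N _ (UJ x Ux)).
apply: (@Ck_eq _ _ _ _ (fun x => partial i phi x * derive1 f (phi x))) => //.
  by move=> x Ux; have [_ ->] := P i x Ux.
apply: CkM => //; first by have /smooth_Ck := smooth_partial i phis.
by apply: IH => //; exact: smooth1_derive.
Qed.

Lemma smooth_comp1 n (J : set R) (U : set 'rV[R]_n) f phi : open U ->
  smooth1_on J f -> (forall x, U x -> J (phi x)) -> smooth_on U phi ->
  smooth_on U (fun x => f (phi x)).
Proof. by move=> oU fs UJ phis; apply/smooth_Ck => k; exact: Ck_comp1 fs UJ phis. Qed.

Lemma smooth1_line n (J : set R) (U : set 'rV[R]_n) (F : 'rV[R]_n -> R) a j :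
  open J -> smooth_on U F -> (forall t, J t -> U (a + t *: delta_mx 0 j)) ->
  smooth1_on J (fun t => F (a + t *: delta_mx 0 j)).
Proof.
move=> oJ Fs JU; pose D m := iter m (partial j) F.
have Ds m : smooth_on U (D m) by elim: m => [//|m IH]; exact: smooth_partial.
have dD m t : J t -> is_derive t 1 (fun t => D m (a + t *: delta_mx 0 j)) (D m.+1 (a + t *: delta_mx 0 j)).
  by move=> Jt; apply: is_derive_shift_line; exact: smooth_diff (Ds m) (JU t Jt).
have E m t : J t -> derive1n m (fun t => F (a + t *: delta_mx 0 j)) t = D m (a + t *: delta_mx 0 j).
  elim: m t => [//|m IH] t Jt; rewrite derive1nS derive1E.
  have [_ <-] := dD m t Jt; apply: near_eq_derive.
  by apply: filterS (open_nbhs_nbhs (conj oJ Jt)) => s; exact: IH.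
move=> m t Jt; have [H _] := dD m t Jt.
apply: near_eq_derivable H.
by apply: filterS (open_nbhs_nbhs (conj oJ Jt)) => s Js; rewrite E.
Qed.

End OneVariable.

Section Model.
Context {R : realType}.
Variables (fA fB : R -> R).
Implicit Types (x : 'rV[R]_2) (m : 'rV[R]_(2 + 2)).

(** The connection nabla_0 d_0 = - d_1, nabla_1 d_1 = A d_0 - B d_1: the case of
    [adapted_frame] in which the frame is (d_0, d_1) and be = 0. *)
Definition model_connection : @connection R 2 := fun c a b x =>
  if (a == i0) || (b == i0) then
    if [&& c == i1, a == i0 & b == i0] then -1 else 0
  else if c == i0 then fA (x 0 i1) else - fB (x 0 i1).

Definition model_field : 'rV[R]_2 -> 'rV[R]_2 := fun=> delta_mx 0 i0.
Definition model_form : 'rV[R]_2 -> 'rV[R]_2 := fun=> 0.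

Lemma model_schouten x :
  [/\ schouten model_connection i0 i0 x = fB (x 0 i1),
      schouten model_connection i0 i1 x + schouten model_connection i1 i0 x = 2 * fA (x 0 i1) &
      schouten model_connection i1 i1 x = 0].
Proof.
have P0 (f : R -> R) : partial i0 (fun y : 'rV[R]_2 => f (y 0 i1)) x = 0.
  by apply: partial_indep => y h; rewrite !mxE /= mulr0 add0r.
have PA := P0 fA; have PB := P0 (fun t => - fB t).
split; rewrite /schouten /ricci !sum2 /model_connection /= !partial_cst ?PA ?PB; move_partials; by field.
Qed.

(** The coefficients of (dx^0)^2, 2 dx^0 dx^1 and (dx^1)^2 in the metric of the model.
    The first is |K|^2, and also 1/V for V as in the normal form. *)
Definition mN m : R := fB (m 0 l1) + m 0 r0 ^+ 2 + m 0 r1.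
Definition mc m : R := m 0 r0 * m 0 r1 + fA (m 0 l1).
Definition mE m : R := m 0 r1 ^+ 2 + fB (m 0 l1) * m 0 r1 - fA (m 0 l1) * m 0 r0.

Lemma model_metric_xx m : [/\ metric_xx model_connection m i0 i0 = mN m,
  metric_xx model_connection m i0 i1 = mc m, metric_xx model_connection m i1 i0 = mc m &
  metric_xx model_connection m i1 i1 = mE m].
Proof.
have [P00 P01 P11] := model_schouten (lsubmx m).
split; rewrite mxE /metric_coef ?P00 ?P11; last first.
- by rewrite /model_connection /= !mxE /mE; field.
- move: (schouten _ i0 i1 _) (schouten _ i1 i0 _) P01 => s01 s10 P01.
  apply: (@eq_lincomb R _ _ (2^-1 * (s01 + s10 - 2 * fA (lsubmx m 0 i1)))); last by rewrite P01 subrr mulr0.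
  by rewrite /model_connection /= !mxE /mc; field.
- move: (schouten _ i0 i1 _) (schouten _ i1 i0 _) P01 => s01 s10 P01.
  apply: (@eq_lincomb R _ _ (2^-1 * (s01 + s10 - 2 * fA (lsubmx m 0 i1)))); last by rewrite P01 subrr mulr0.
  by rewrite /model_connection /= !mxE /mc; field.
- by rewrite /model_connection /= !mxE /mN; field.
Qed.

Lemma model_lift m : lift_field model_field model_form m = delta_mx 0 l0.
Proof.
apply/rowP => i; rewrite /lift_field; case: (split_ordP i) => a ->.
  by rewrite row_mxEl !mxE eqxx /= (inj_eq (@lshift_inj _ _)).
rewrite row_mxEr !mxE sum2 (_ : (fun=> model_field _ 0 i0) = fun=> 1); last first.
  by apply/funext => y; rewrite mxE.
rewrite (_ : (fun=> model_field _ 0 i1) = fun=> 0); last by apply/funext => y; rewrite mxE.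
by rewrite !partial_cst !mulr0 addr0 subr0; move: a; apply: ord2P.
Qed.

Lemma model_killing_form m : killing_form model_connection model_field model_form m
  = row l0 (metric model_connection m).
Proof. by rewrite /killing_form model_lift -rowE. Qed.

Definition mkf m : 'rV[R]_(2 + 2) := mN m *: dx i0 + mc m *: dx i1 + 2^-1 *: dz i0.

Lemma model_killing_formE m :
  killing_form model_connection model_field model_form m = mkf m.
Proof.
have [M00 M01 _ _] := model_metric_xx m.
rewrite model_killing_form metricE; apply/rowP; rewrite /mkf.
by apply: ord4P; rewrite [LHS]mxE ?block_mxEul ?block_mxEur ?M00 ?M01 !mxE /= ?mulr1n ?mulr0n; ring.
Qed.

Lemma model_killing_norm m : killing_norm model_connection model_field model_form m = mN m.
Proof.
rewrite /killing_norm /sqnorm -/(killing_form model_connection model_field model_form m).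
rewrite model_killing_formE model_lift trmx_delta -colE mxE /mkf !mxE /=.
by ring.
Qed.

(** As the lift of d_0 is d_0, the other three coordinates parametrise its orbits:
    p and q are the fibre coordinates and y is x^1. *)
Definition orbit_proj m : 'rV[R]_3 := \row_i m 0 (tnth [tuple r0; r1; l1] i).

Lemma orbit_projE m : [/\ cp (orbit_proj m) = m 0 r0, cq (orbit_proj m) = m 0 r1 &
  cy (orbit_proj m) = m 0 l1].
Proof. by rewrite /cp /cq /cy !mxE. Qed.

Lemma smooth_orbit_proj (O : set 'rV[R]_(2 + 2)) : smooth_mx_on O orbit_proj.
Proof.
move=> i j; rewrite [i]ord1 (_ : (fun y => _) = fun m => m 0 (tnth [tuple r0; r1; l1] j)).
  exact: smooth_coord.
by apply/funext => m; rewrite mxE.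
Qed.

Lemma jacobian_orbit_proj m a i :
  'J orbit_proj m a i = (tnth [tuple r0; r1; l1] i == a)%:R.
Proof.
rewrite jacobianE; last by apply: (@smooth_mx_diff _ _ setT) => //; exact: smooth_orbit_proj.
rewrite (_ : (fun y => _) = fun m => m 0 (tnth [tuple r0; r1; l1] i)) ?partial_coord//.
by apply/funext => y; rewrite mxE.
Qed.

Lemma pull_symprod n p (J : 'M[R]_(p, n)) (u v : 'rV[R]_n) :
  J *m symprod u v *m J^T = symprod (u *m J^T) (v *m J^T).
Proof.
rewrite /symprod -scalemxAr -scalemxAl mulmxDr mulmxDl !trmx_mul !trmxK.
by rewrite !mulmxA.
Qed.

Lemma pull_coframe m : [/\ dp *m ('J orbit_proj m)^T = dz i0,
  dq *m ('J orbit_proj m)^T = dz i1 & dy *m ('J orbit_proj m)^T = dx i1].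
Proof.
by split; apply/rowP => a; rewrite -rowE 2![LHS]mxE jacobian_orbit_proj mxE /= eq_sym.
Qed.

(** The representative of the Weyl structure that the reduction of the model yields; the
    factor rho = 1/V leads to the normal form. *)
Definition model_h (w : 'rV[R]_3) : 'M[R]_3 := normal_V fB w ^+ 2 *: normal_h fA fB w.

Definition model_omega (w : 'rV[R]_3) : 'rV[R]_3 :=
  normal_V fB w *: (2 *: dq - (2 * cp w) *: dp - (2 * derive1 fB (cy w)) *: dy).

Lemma model_V m : normal_V fB (orbit_proj m) = (mN m)^-1.
Proof. by have [P Q Y] := orbit_projE m; rewrite /normal_V P Q Y. Qed.

Lemma model_jones_tod_h m : mN m != 0 ->
  jones_tod_h model_connection model_field model_form m = pullback2 orbit_proj model_h m.
Proof.
move=> N0; rewrite /jones_tod_h model_killing_norm model_killing_formE.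
rewrite /pullback2 /model_h model_V /normal_h model_V.
have [-> -> ->] := orbit_projE m.
have [pp pq py] := pull_coframe m.
rewrite -scalemxAr -scalemxAl mulmxBr mulmxBl -scalemxAr -scalemxAl !pull_symprod.
rewrite !mulmxDl -!scalemxAl pp pq py metricE.
have [M00 M01 M10 M11] := model_metric_xx m.
apply/matrixP => i j.
have addE (P Q : 'M[R]_(2 + 2)) : (P + Q) i j = P i j + Q i j by rewrite mxE.
have oppE (P : 'M[R]_(2 + 2)) : (- P) i j = - P i j by rewrite mxE.
have scaleE c (P : 'M[R]_(2 + 2)) : (c *: P) i j = c * P i j by rewrite mxE.
rewrite !(addE, oppE, symprodE, scaleE); clear addE oppE scaleE.
move: N0 M00 M01 M10 M11; move: i j; apply: ord4P; apply: ord4P => N0 M00 M01 M10 M11;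
  rewrite ?block_mxEul ?block_mxEur ?block_mxEdl ?block_mxEdr ?M00 ?M01 ?M10 ?M11 /mkf !mxE /= ?mulr1n ?mulr0n.
all: rewrite /mc /mE; move: N0; move: (mN m) (m 0 r0) (m 0 r1) => N p q N0; by field.
Qed.

Lemma model_metric_det m : \det (metric model_connection m) = 16^-1.
Proof.
rewrite metricE; set P := metric_xx _ _.
(* a block triangular matrix times shears *)
have -> : block_mx P (2^-1)%:M (2^-1)%:M 0
    = block_mx (- (2^-1)%:M) P 0 (2^-1)%:M
      *m (block_mx 1%:M (- 1%:M) 0 1%:M *m block_mx 1%:M 0 1%:M 1%:M
          *m block_mx 1%:M (- 1%:M) 0 1%:M).
  rewrite !mulmx_block !(mulmx1, mul1mx, mulmx0, mul0mx, mulmxN, mulNmx, addr0, add0r, oppr0, subrr, opprK).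
  by rewrite ?(addNr, subrr, mulmx1, mul1mx, mulmx0, mul0mx, mulmxN, mulNmx, addr0, add0r, oppr0, opprK).
rewrite !det_mulmx !det_ublock det_lblock !det1 -scaleN1r detZ !det_scalar.
by rewrite !(mul1r, mulr1); field.
Qed.

Lemma model_metric_unit m : metric model_connection m \in unitmx.
Proof.
have d : \det (metric model_connection m) != 0 by rewrite model_metric_det invr_eq0 pnatr_eq0.
by apply: etrans (_ : _ = (\det (metric model_connection m) != 0)) d; rewrite -unitfE; exact: unitmxE.
Qed.

Lemma model_hodge_factor m : - (Num.sqrt `|\det (metric model_connection m)|
  / \det (metric model_connection m)) = - 4 :> R.
Proof.
rewrite model_metric_det ger0_norm ?invr_ge0//.
have -> : (16^-1 : R) = (4^-1) ^+ 2 by field.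
by rewrite sqrtr_sqr ger0_norm ?invr_ge0//; field.
Qed.

Variable J : set R.
Hypotheses (fAs : smooth1_on J fA) (fBs : smooth1_on J fB).

Lemma model_ext_d m : J (m 0 l1) ->
  let F := ext_d (killing_form model_connection model_field model_form) m in
  [/\ F l0 l1 = - derive1 fB (m 0 l1), F l0 r0 = - (2 * m 0 r0), F l0 r1 = - 1 &
   [/\ F l1 r0 = - m 0 r1, F l1 r1 = - m 0 r0 & F r0 r1 = 0]].
Proof.
move=> Jm F.
have kfE b : (fun y => killing_form model_connection model_field model_form y 0 b) = (fun y => mkf y 0 b).
  by apply/funext => y; rewrite model_killing_formE.
have k0 : (fun y => mkf y 0 l0) = mN.
  by apply/funext => y; rewrite /mkf !mxE /=; ring.
have k1 : (fun y => mkf y 0 l1) = mc.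
  by apply/funext => y; rewrite /mkf !mxE /=; ring.
have k2 : (fun y => mkf y 0 r0) = fun=> 2^-1.
  by apply/funext => y; rewrite /mkf !mxE /=; ring.
have k3 : (fun y => mkf y 0 r1) = fun=> 0.
  by apply/funext => y; rewrite /mkf !mxE /=; ring.
have dA := @fAs 0%N _ Jm; have dB := @fBs 0%N _ Jm.
have co i j : is_partial i (fun y : 'rV[R]_(2 + 2) => y 0 j) m (j == i)%:R by exact: is_partial_coord.
have cf (f : R -> R) (df : derivable f (m 0 l1) 1) i :
    is_partial i (fun y : 'rV[R]_(2 + 2) => f (y 0 l1)) m ((l1 == i)%:R * derive1 f (m 0 l1)).
  by have := partial_comp1 i df (co i l1).1; rewrite (co i l1).2.
have pN i : is_partial i mN m _ := is_partialD (is_partialD (cf fB dB i) (is_partialX2 (co i r0))) (co i r1).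
have pc i : is_partial i mc m _ := is_partialD (is_partialM (co i r0) (co i r1)) (cf fA dA i).
rewrite /F /ext_d !kfE k0 k1 k2 k3 !partial_cst.
have {}pN i := (pN i).2; have {}pc i := (pc i).2.
by do !split; rewrite ?pN ?pc /=; ring.
Qed.

Lemma model_jones_tod_omega m : mN m != 0 -> J (m 0 l1) ->
  jones_tod_omega model_connection model_field model_form m
  = pullback1 orbit_proj model_omega m.
Proof.
move=> N0 Jm; rewrite /jones_tod_omega model_killing_norm.
have [F01 F02 F03 [F12 F13 F23]] := model_ext_d Jm.
rewrite hodge3E; last exact: model_metric_unit.
rewrite model_hodge_factor model_killing_formE.
have Fa a b : ext_d (killing_form model_connection model_field model_form) m b a =
  - ext_d (killing_form model_connection model_field model_form) m a b.
  by rewrite /ext_d opprB.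
have [S0 S1 S2 S3] := dual_vector_wedge (mkf m) Fa.
rewrite F01 F02 F03 F12 F13 F23 in S0 S1 S2 S3.
rewrite /pullback1 /model_omega model_V; have [-> _ ->] := orbit_projE m.
have [pp pq py] := pull_coframe m.
rewrite -scalemxAl !mulmxBl -!scalemxAl pp pq py.
have [M00 M01 M10 M11] := model_metric_xx m.
set S := dual_vector _ in S0 S1 S2 S3 *.
have SM j : (S *m metric model_connection m) 0 j = S 0 l0 * metric model_connection m l0 j
  + S 0 l1 * metric model_connection m l1 j + S 0 r0 * metric model_connection m r0 j
  + S 0 r1 * metric model_connection m r1 j by rewrite mxE sum4.
have scaleE c (v : 'rV[R]_(2 + 2)) j : (c *: v) 0 j = c * v 0 j by rewrite mxE.
apply/rowP; apply: ord4P; rewrite !(scaleE, SM) metricE; clear scaleE SM;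
  rewrite ?block_mxEul ?block_mxEur ?block_mxEdl ?block_mxEdr ?M00 ?M01 ?M10 ?M11 S0 S1 S2 S3 /mkf !mxE /= ?mulr1n ?mulr0n.
all: move: N0; rewrite /mc /mE /mN; move: (fA _) (fB _) (derive1 fB _) (m 0 r0) (m 0 r1) => a b b' p q N0; by field.
Qed.

End Model.

(** * Naturality of the Jones-Tod tensors *)

Section Naturality.
Context {R : realType}.
Variables (G G' : @connection R 2) (k Ups k' Ups' : 'rV[R]_2 -> 'rV[R]_2).
Variables (O : set 'rV[R]_(2 + 2)) (Phi : 'rV[R]_(2 + 2) -> 'rV[R]_(2 + 2)).
Hypotheses (oO : open O) (Phis : smooth_mx_on O Phi).
Hypothesis metric_pull : forall m, O m ->
  metric G m = 'J Phi m *m metric G' (Phi m) *m ('J Phi m)^T.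
Hypothesis lift_push : forall m, O m ->
  lift_field k Ups m *m 'J Phi m = lift_field k' Ups' (Phi m).
Hypothesis det_jac : forall m, O m -> \det ('J Phi m) = 1.

Lemma form_pull p (v : 'rV[R]_p) (J g : 'M[R]_p) :
  v *m (J *m g *m J^T) *m v^T = (v *m J) *m g *m (v *m J)^T.
Proof. by rewrite trmx_mul !mulmxA. Qed.

Lemma natural_killing_form m : O m ->
  killing_form G k Ups m = killing_form G' k' Ups' (Phi m) *m ('J Phi m)^T.
Proof.
move=> Om; rewrite /killing_form -(lift_push Om) (metric_pull Om).
by move: (lift_field _ _ _) ('J Phi m) (metric _ _) => v j g; rewrite !mulmxA.
Qed.

Lemma natural_killing_norm m : O m ->
  killing_norm G k Ups m = killing_norm G' k' Ups' (Phi m).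
Proof.
move=> Om; rewrite /killing_norm -(lift_push Om) (metric_pull Om) /sqnorm.
by move: (lift_field _ _ _) ('J Phi m) (metric _ _) => v j g; rewrite form_pull.
Qed.

Lemma natural_jones_tod_h m : O m ->
  jones_tod_h G k Ups m = pullback2 Phi (jones_tod_h G' k' Ups') m.
Proof.
move=> Om; rewrite /jones_tod_h /pullback2 natural_killing_norm// natural_killing_form//.
rewrite (metric_pull Om); move: ('J Phi m) (metric _ _) (killing_form _ _ _ _) (killing_norm _ _ _ _) => j g u n.
by rewrite -pull_symprod mulmxBr mulmxBl -!scalemxAr -!scalemxAl.
Qed.

Notation kf' := (killing_form G' k' Ups').

(** The second derivatives of Phi cancel by symmetry. *)
Lemma ext_d_pull (u u' : 'rV[R]_(2 + 2) -> 'rV[R]_(2 + 2)) m a b :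
  (forall y, O y -> u y = pullback1 Phi u' y) -> O m ->
  (forall j, differentiable (fun y => u' y 0 j) (Phi m)) ->
  ext_d u m a b = \sum_i \sum_j 'J Phi m a i * 'J Phi m b j * ext_d u' (Phi m) i j.
Proof.
move=> uE Om dkf.
have dPhi := smooth_mx_diff Phis Om.
have kfE c y : O y -> u y 0 c
    = \sum_j u' (Phi y) 0 j * partial c (fun y => Phi y 0 j) y.
  move=> Oy; rewrite uE// /pullback1 mxE; apply: eq_bigr => j _.
  by rewrite [(_)^T j c]mxE jacobianE//; exact: smooth_mx_diff Phis Oy.
have expand c d : partial c (fun y => u y 0 d) m =
    \sum_j (\sum_i 'J Phi m c i * partial i (fun y => u' y 0 j) (Phi m)) * 'J Phi m d j
    + \sum_j u' (Phi m) 0 j * partial c (partial d (fun y => Phi y 0 j)) m.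
  rewrite (partial_eq oO (kfE d) c Om).
  have dc j : differentiable (fun y => u' (Phi y) 0 j) m.
    exact: (@differentiable_comp _ _ _ _ Phi (fun y => u' y 0 j)).
  have dd j : differentiable (partial d (fun y => Phi y 0 j)) m.
    exact: smooth_diff (smooth_partial d (Phis 0 j)) Om.
  rewrite partial_sum => [|j]; last exact: differentiableM.
  rewrite -big_split; apply: eq_bigr => j _ /=.
  rewrite partialM// (jacobianE d j dPhi); congr (_ * _ + _).
  rewrite (@partial_chain _ _ _ c (fun y => u' y 0 j) Phi)//.
  by apply: eq_bigr => i _; rewrite jacobianE.
have S : \sum_j u' (Phi m) 0 j * partial a (partial b (fun y => Phi y 0 j)) m
    = \sum_j u' (Phi m) 0 j * partial b (partial a (fun y => Phi y 0 j)) m.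
  by apply: eq_bigr => j _; rewrite (schwarz a b oO (Phis 0 j) Om).
have aux (l1 l2 p q r r' : R) : l1 = p + r -> l2 = q + r' -> r = r' -> l1 - l2 = p - q.
  by move=> -> -> ->; ring.
rewrite /ext_d (aux _ _ _ _ _ _ (expand a b) (expand b a) S).
transitivity (\sum_i \sum_j 'J Phi m a i * 'J Phi m b j * partial i (fun y => u' y 0 j) (Phi m)
  - \sum_i \sum_j 'J Phi m a i * 'J Phi m b j * partial j (fun y => u' y 0 i) (Phi m)).
  congr (_ - _).
    rewrite exchange_big; apply: eq_bigr => j _; rewrite mulr_suml; apply: eq_bigr => i _.
    by rewrite mulrAC.
  apply: eq_bigr => i _; rewrite mulr_suml; apply: eq_bigr => j _.
  by rewrite mulrAC [_ * 'J Phi m a i]mulrC.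
rewrite -sumrB; apply: eq_bigr => i _; rewrite -sumrB; apply: eq_bigr => j _.
by rewrite -mulrBr.
Qed.

Lemma wedge_pull (J : 'M[R]_(2 + 2)) (u : 'rV[R]_(2 + 2)) (F F' : 'I_(2 + 2) -> 'I_(2 + 2) -> R) :
  (forall a b, F a b = \sum_i \sum_j J a i * J b j * F' i j) ->
  wedge12 (u *m J^T) F = pull3 J (wedge12 u F').
Proof.
move=> FE; apply/funext => a; apply/funext => b; apply/funext => c.
have term x y z : (u *m J^T) 0 x * F y z
    = \sum_i \sum_j \sum_l J x i * J y j * J z l * (u 0 i * F' j l).
  rewrite mxE FE mulr_suml; apply: eq_bigr => i _; rewrite mulr_sumr; apply: eq_bigr => j _.
  rewrite mulr_sumr; apply: eq_bigr => l _; rewrite mxE.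
  by move: (J _ _) (J _ _) (J _ _) (u _ _) (F' _ _) => *; ring.
rewrite /wedge12 /pull3 !term.
have -> : \sum_i \sum_j \sum_l J b i * J c j * J a l * (u 0 i * F' j l)
    = \sum_i \sum_j \sum_l J a i * J b j * J c l * (u 0 j * F' l i).
  rewrite exchange_big /=; under eq_bigr do rewrite exchange_big /=.
  rewrite exchange_big /=; apply: eq_bigr => i _.
  rewrite exchange_big /=; apply: eq_bigr => j _; apply: eq_bigr => l _.
  by move: (J _ _) (J _ _) (J _ _) (u _ _) (F' _ _) => *; ring.
have -> : \sum_i \sum_j \sum_l J c i * J a j * J b l * (u 0 i * F' j l)
    = \sum_i \sum_j \sum_l J a i * J b j * J c l * (u 0 l * F' i j).
  rewrite exchange_big /=; apply: eq_bigr => i _.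
  rewrite exchange_big /=; apply: eq_bigr => j _; apply: eq_bigr => l _.
  by move: (J _ _) (J _ _) (J _ _) (u _ _) (F' _ _) => *; ring.
rewrite -!big_split /=; apply: eq_bigr => i _.
rewrite -!big_split /=; apply: eq_bigr => j _.
rewrite -!big_split /=; apply: eq_bigr => l _.
by rewrite -!mulrDr.
Qed.

(** As the Jacobian determinant of Phi is 1, the Hodge dual, which depends on volume and
    orientation, is natural too. *)
Lemma natural_jones_tod_omega m : O m ->
  (forall j, differentiable (fun y => kf' y 0 j) (Phi m)) ->
  metric G' (Phi m) \in unitmx ->
  jones_tod_omega G k Ups m = pullback1 Phi (jones_tod_omega G' k' Ups') m.
Proof.
move=> Om dkf gu; rewrite /jones_tod_omega /pullback1 natural_killing_norm// -scalemxAl.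
congr (_ *: _).
have dg : \det (metric G m) = \det (metric G' (Phi m)).
  by rewrite metric_pull// !det_mulmx det_tr det_jac// mul1r mulr1.
have gu' : metric G m \in unitmx.
  by apply: etrans gu; rewrite /= !unitmxE dg.
rewrite (hodge3E _ gu') (hodge3E _ gu) dg -scalemxAl; congr (_ *: _).
rewrite natural_killing_form// (@wedge_pull ('J Phi m) _ _ (ext_d kf' (Phi m))); last first.
  move=> a b; apply: ext_d_pull => // y Oy; exact: natural_killing_form.
rewrite (metric_pull Om).
have E := dual_vector_pull ('J Phi m) (wedge12 (kf' (Phi m)) (ext_d kf' (Phi m))).
rewrite (det_jac Om) scale1r in E; rewrite -E.
by rewrite !mulmxA.
Qed.

End Naturality.

(** * Adapted coordinates on the cotangent bundle *)

Section BaseFunctions.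
Context {R : realType}.

Lemma smooth_lsubmx (O : set 'rV[R]_(2 + 2)) : smooth_mx_on O lsubmx.
Proof.
move=> i j; rewrite [i]ord1 (_ : (fun y => _) = fun m : 'rV[R]_(2 + 2) => m 0 (lshift 2 j)).
  exact: smooth_coord.
by apply/funext => m; rewrite mxE.
Qed.

Lemma open_cotangent (U : set 'rV[R]_2) : open U -> open (cotangent U).
Proof.
move=> oU; have -> : cotangent U = [set m | setT m /\ U (lsubmx m)].
  by apply/seteqP; split=> m //= [].
apply: open_preim => //; first exact: openT.
by move=> m _; apply: (@smooth_mx_diff _ _ setT) => //; exact: smooth_lsubmx.
Qed.

Lemma smooth_base (U : set 'rV[R]_2) f : open U -> smooth_on U f ->
  smooth_on (cotangent U) (fun m => f (lsubmx m)).
Proof.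
move=> oU fs; apply: (@smooth_comp _ _ _ (open_cotangent oU) _ U) => //.
exact: smooth_lsubmx.
Qed.

Lemma is_partial_base (U : set 'rV[R]_2) f m i : open U -> smooth_on U f -> cotangent U m ->
  is_partial i (fun m => f (lsubmx m)) m
    ((l0 == i)%:R * partial i0 f (lsubmx m) + (l1 == i)%:R * partial i1 f (lsubmx m)).
Proof.
move=> oU fs Um; split; first exact: smooth_diff (smooth_base oU fs) Um.
rewrite partial_chain; first last.
- by apply: (@smooth_mx_diff _ _ setT) => //; exact: smooth_lsubmx.
- exact: smooth_diff fs Um.
have E j : (fun y : 'rV[R]_(2 + 2) => lsubmx y 0 j) = fun y : 'rV[R]_(2 + 2) => y 0 (lshift 2 j).
  by apply/funext => y; rewrite mxE.
by rewrite sum2 !E !partial_coord.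
Qed.

End BaseFunctions.

Section AdaptedCoordinates.
Context {R : realType}.
Variables (U : set 'rV[R]_2) (G : @connection R 2) (k Ups : 'rV[R]_2 -> 'rV[R]_2).
Variables (e be : field_ R) (A B : 'rV[R]_2 -> R).
Hypotheses (oU : open U) (Gs : smooth_connection U G) (tf : torsion_free U G).
Hypotheses (ks : smooth_mx_on U k) (af : adapted_frame U G k Ups e be A B).
Variables (U' : set 'rV[R]_2) (s y : 'rV[R]_2 -> R) (fA fB : R -> R).
Hypotheses (oU' : open U') (UU : U' `<=` U) (ss : smooth_on U' s) (ys : smooth_on U' y).
Hypothesis ds : forall a x, U' x -> partial a s x = sg k e a x.
Hypothesis dy_ : forall a x, U' x -> partial a y x = th k e a x.
Hypothesis AE : forall x, U' x -> A x = fA (y x).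
Hypothesis BE : forall x, U' x -> B x = fB (y x).

Notation k' := (coord_field k).
Notation sg := (sg k e).
Notation th := (th k e).

Let sub f : smooth_on U f -> smooth_on U' f.
Proof. by move=> fs t x Ux; exact: fs (UU Ux). Qed.
Let k's i : smooth_on U' (k' i). Proof. by apply: sub; exact: ks. Qed.
Let es i : smooth_on U' (e i). Proof. by apply: sub; exact: af_frame_smooth af i. Qed.
Let bes i : smooth_on U' (be i). Proof. by apply: sub; exact: af_form_smooth af i. Qed.

Definition base_coord x : 'rV[R]_2 := \row_i (if i == i0 then s x else y x).

(** The value of the translated covector z + be on X. The translation compensates both
    the change of connection from G to Gh and the term Ups of the lift. *)
Definition fibre_coord (X : field_ R) (m : 'rV[R]_(2 + 2)) : R :=
  (m 0 r0 + be i0 (lsubmx m)) * X i0 (lsubmx m)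
  + (m 0 r1 + be i1 (lsubmx m)) * X i1 (lsubmx m).

Definition adapted_coord (m : 'rV[R]_(2 + 2)) : 'rV[R]_(2 + 2) :=
  row_mx (base_coord (lsubmx m))
    (\row_i (if i == i0 then fibre_coord k' m else fibre_coord e m)).

Lemma adapted_coordE m : [/\ adapted_coord m 0 l0 = s (lsubmx m),
  adapted_coord m 0 l1 = y (lsubmx m), adapted_coord m 0 r0 = fibre_coord k' m &
  adapted_coord m 0 r1 = fibre_coord e m].
Proof. by split; rewrite /adapted_coord ?row_mxEl ?row_mxEr !mxE. Qed.

Let oO : open (cotangent U'). Proof. exact: open_cotangent. Qed.

Lemma smooth_fibre_coord X : (forall i, smooth_on U' (X i)) ->
  smooth_on (cotangent U') (fibre_coord X).
Proof.
move=> Xs; have X's i : smooth_on (cotangent U') (fun m => X i (lsubmx m)) by exact: smooth_base.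
have b's i : smooth_on (cotangent U') (fun m => be i (lsubmx m)) by exact: smooth_base.
have c j : smooth_on (cotangent U') (fun m : 'rV[R]_(2 + 2) => m 0 j) by exact: smooth_coord.
by rewrite /fibre_coord; smooth_tac.
Qed.

Lemma smooth_adapted_coord : smooth_mx_on (cotangent U') adapted_coord.
Proof.
move=> i j; rewrite [i]ord1; move: j.
have E m := adapted_coordE m.
apply: ord4P.
- by apply: (@smooth_eq _ _ _ oO (fun m => s (lsubmx m))) => [m _|]; [have [->] := E m|exact: smooth_base].
- by apply: (@smooth_eq _ _ _ oO (fun m => y (lsubmx m))) => [m _|]; [have [_ ->] := E m|exact: smooth_base].
- by apply: (@smooth_eq _ _ _ oO (fibre_coord k')) => [m _|]; [have [_ _ ->] := E m|exact: smooth_fibre_coord].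
- by apply: (@smooth_eq _ _ _ oO (fibre_coord e)) => [m _|]; [have [_ _ _ ->] := E m|exact: smooth_fibre_coord].
Qed.

Lemma partial_fibre_coord X m i : (forall i, smooth_on U' (X i)) -> cotangent U' m ->
  let x := lsubmx m in
  partial i (fibre_coord X) m =
    ((r0 == i)%:R + ((l0 == i)%:R * partial i0 (be i0) x + (l1 == i)%:R * partial i1 (be i0) x)) * X i0 x
    + (m 0 r0 + be i0 x) * ((l0 == i)%:R * partial i0 (X i0) x + (l1 == i)%:R * partial i1 (X i0) x)
    + (((r1 == i)%:R + ((l0 == i)%:R * partial i0 (be i1) x + (l1 == i)%:R * partial i1 (be i1) x)) * X i1 x
    + (m 0 r1 + be i1 x) * ((l0 == i)%:R * partial i0 (X i1) x + (l1 == i)%:R * partial i1 (X i1) x)).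
Proof.
move=> Xs Um x.
have c j : is_partial i (fun m : 'rV[R]_(2 + 2) => m 0 j) m (j == i)%:R by exact: is_partial_coord.
have b f : smooth_on U' f -> is_partial i (fun m => f (lsubmx m)) m _ :=
  fun fs => is_partial_base i oU' fs Um.
have [_ ->] := is_partialD
  (is_partialM (is_partialD (c r0) (b _ (bes i0))) (b _ (Xs i0)))
  (is_partialM (is_partialD (c r1) (b _ (bes i1))) (b _ (Xs i1))).
by [].
Qed.

Definition jac_base x : 'M[R]_2 := \matrix_(a, j) (if j == i0 then sg a x else th a x).
Definition jac_fibre x : 'M[R]_2 := \matrix_(c, j) (if j == i0 then k' c x else e c x).
Definition jac_mixed (m : 'rV[R]_(2 + 2)) : 'M[R]_2 := \matrix_(a, j)
  let x := lsubmx m in let X := if j == i0 then k' else e in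
  partial a (be i0) x * X i0 x + (m 0 r0 + be i0 x) * partial a (X i0) x
  + (partial a (be i1) x * X i1 x + (m 0 r1 + be i1 x) * partial a (X i1) x).

Lemma jacobian_adapted_coord m : cotangent U' m ->
  'J adapted_coord m = block_mx (jac_base (lsubmx m)) (jac_mixed m) 0 (jac_fibre (lsubmx m)).
Proof.
move=> Um; have dP := smooth_mx_diff smooth_adapted_coord Um.
have E m := adapted_coordE m.
have Es : (fun m => adapted_coord m 0 l0) = fun m => s (lsubmx m).
  by apply/funext => m'; have [->] := E m'.
have Ey : (fun m => adapted_coord m 0 l1) = fun m => y (lsubmx m).
  by apply/funext => m'; have [_ ->] := E m'.
have Ep : (fun m => adapted_coord m 0 r0) = fibre_coord k'.
  by apply/funext => m'; have [_ _ ->] := E m'.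
have Eq : (fun m => adapted_coord m 0 r1) = fibre_coord e.
  by apply/funext => m'; have [_ _ _ ->] := E m'.
have Ps i := (is_partial_base i oU' ss Um).2.
have Py i := (is_partial_base i oU' ys Um).2.
have ds0 a := ds a Um; have dy0 a := dy_ a Um.
apply/matrixP => i j; rewrite jacobianE//; move: i j; apply: ord4P; apply: ord4P;
  rewrite ?Es ?Ey ?Ep ?Eq ?Ps ?Py ?ds0 ?dy0 ?(partial_fibre_coord _ k's Um) ?(partial_fibre_coord _ es Um);
  rewrite ?block_mxEul ?block_mxEur ?block_mxEdl ?block_mxEdr !mxE /=; move_partials; ring.
Qed.

Lemma jac_base_fibre x : U' x -> jac_base x *m (jac_fibre x)^T = 1%:M.
Proof.
move=> Ux; apply/matrixP => a c; rewrite !mxE sum2 !mxE /= eq_sym -(coframeE af a c (UU Ux)).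
by [].
Qed.

Lemma jac_fibre_base x : U' x -> jac_fibre x *m (jac_base x)^T = 1%:M.
Proof. by move=> Ux; apply: trmx_inj; rewrite trmx_mul trmxK jac_base_fibre// trmx1. Qed.

Lemma det_adapted_coord m : cotangent U' m -> \det ('J adapted_coord m) = 1.
Proof.
move=> Um; rewrite jacobian_adapted_coord// det_ublock -[X in _ * X]det_tr -det_mulmx.
by rewrite jac_base_fibre// det1.
Qed.

(** For the fibre coordinates this amounts to [k, e] = 0 and to the equation
    L_k be = - Ups. *)
Lemma lift_adapted_coord m : cotangent U' m ->
  lift_field k Ups m *m 'J adapted_coord m
  = lift_field model_field model_form (adapted_coord m).
Proof.
move=> Um; rewrite model_lift jacobian_adapted_coord// /lift_field mul_row_block.
set x := lsubmx m; have Ux : U x by exact: UU.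
have S := sg_k af Ux; have T := th_k k e Ux.
have F a := af_form af a Ux.
have L c : along k' (e c) x = along e (k' c) x by exact: along_e af c x Ux.
apply/rowP; apply: ord4P; rewrite ?row_mxEl ?row_mxEr ?mulmx0 ?addr0 !mxE ?sum2 !mxE ?sum2 ?mxE /=.
- by rewrite -[RHS]S.
- by rewrite -[RHS]T.
- apply: (@eq_lincomb R _ _ (k x 0 i0 * (along k' (be i0) x
    + be i0 x * partial i0 (fun y => k y 0 i0) x + be i1 x * partial i0 (fun y => k y 0 i1) x + Ups x 0 i0)
    + k x 0 i1 * (along k' (be i1) x
    + be i0 x * partial i1 (fun y => k y 0 i0) x + be i1 x * partial i1 (fun y => k y 0 i1) x + Ups x 0 i1))).
    rewrite !alongE /coord_field -/x; move_partials; ring.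
  by rewrite !F !addNr !mulr0 addr0.
- apply: (@eq_lincomb R _ _ (e i0 x * (along k' (be i0) x
    + be i0 x * partial i0 (fun y => k y 0 i0) x + be i1 x * partial i0 (fun y => k y 0 i1) x + Ups x 0 i0)
    + e i1 x * (along k' (be i1) x
    + be i0 x * partial i1 (fun y => k y 0 i0) x + be i1 x * partial i1 (fun y => k y 0 i1) x + Ups x 0 i1)
    + (m 0 r0 + be i0 x) * (along k' (e i0) x - along e (k' i0) x)
    + (m 0 r1 + be i1 x) * (along k' (e i1) x - along e (k' i1) x))).
    rewrite !alongE /coord_field -/x; move_partials; ring.
  by rewrite !F !addNr !L !subrr !mulr0 !addr0.
Qed.

Lemma block_pull (S T F P : 'M[R]_2) h : S *m F^T = 1%:M -> F *m S^T = 1%:M ->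
  block_mx S T 0 F *m block_mx P h%:M h%:M 0 *m (block_mx S T 0 F)^T
  = block_mx (S *m P *m S^T + h *: (T *m S^T + S *m T^T)) h%:M h%:M 0.
Proof.
move=> SF FS; rewrite tr_block_mx !mulmx_block trmx0.
rewrite !(mulmx0, mul0mx, addr0, add0r) !mul_mx_scalar.
rewrite mulmxDl -!scalemxAl SF FS -addrA -scalerDr !scalemx1.
by [].
Qed.

(** The Jacobian is block triangular with the coframe and the frame on the diagonal; its
    off-diagonal block contains the derivatives of k, e and be. Once those of k and e are
    expressed by the connection, the derivatives of be cancel against the ones in the
    Schouten tensor. *)
Lemma metric_adapted_coord m : cotangent U' m ->
  metric G m = 'J adapted_coord m *m metric (model_connection fA fB) (adapted_coord m)
                 *m ('J adapted_coord m)^T.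
Proof.
move=> Um; set x := lsubmx m; have Ux : U x by exact: UU.
rewrite jacobian_adapted_coord// (metricE G) (metricE (model_connection _ _)).
have [M00 M01 M10 M11] := model_metric_xx fA fB (adapted_coord m).
set P := metric_xx (model_connection _ _) _ in M00 M01 M10 M11 *.
rewrite (block_pull _ _ _ (jac_base_fibre Um) (jac_fibre_base Um)).
congr block_mx.
have Sch a b := schouten_symE oU Gs tf ks af a b Ux.
have [Es Ey Ep Eq] := adapted_coordE m.
rewrite /mN /mc /mE Ey Ep Eq -(AE Um) -(BE Um) /fibre_coord -/x in M00 M01 M10 M11.
clearbody P.
have pk a c := partial_k tf af a c Ux.
have pe a c := partial_e tf af a c Ux.
apply/matrixP => a b.
have -> : metric_xx G m a b = - (G i0 a b x * m 0 r0 + G i1 a b x * m 0 r1)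
    + m 0 (rshift 2 a) * m 0 (rshift 2 b) + 2^-1 * (schouten G a b x + schouten G b a x).
  rewrite mxE /metric_coef !mxE -/x !(tf _ b a Ux).
  by move: (schouten _ _ _ _) (schouten _ _ _ _) => u v; field.
rewrite Sch !(mxE, sum2) /= M00 M01 M10 M11 -/x !pk !pe.
have v := af_vol af Ux; have t c := tf c i1 i0 Ux.
clear Sch Es Ey Ep Eq M00 M01 M10 M11 pk pe.
rewrite /Gh; move: a b; apply: ord2P => /=; apply: ord2P => /=; rewrite ?t /sg /th /=;
  move: v; rewrite /vol2; move: (k' i0 x) (k' i1 x) (e i0 x) (e i1 x) (A x) (B x) => k0 k1 e0 e1 a b v;
  move: (m 0 r0) (m 0 r1) (be i0 x) (be i1 x) => z0 z1 b0 b1;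
  move: (G i0 i0 i0 x) (G i0 i0 i1 x) (G i0 i1 i1 x) (G i1 i0 i0 x) (G i1 i0 i1 x) (G i1 i1 i1 x) => g1 g2 g3 g4 g5 g6;
  move_partials; by field.
Qed.

End AdaptedCoordinates.

(** * Diffeomorphisms, orbits and pullbacks *)

Section Diffeomorphisms.
Context {R : realType}.

Lemma jacobian_comp n m p (f : 'rV[R]_n -> 'rV[R]_m) (g : 'rV[R]_m -> 'rV[R]_p) x :
  differentiable f x -> differentiable g (f x) ->
  'J (fun y => g (f y)) x = 'J f x *m 'J g (f x).
Proof.
move=> df dg; have dgf : differentiable (fun y => g (f y)) x.
  exact: (@differentiable_comp _ _ _ _ f g).
apply/matrixP => i j; rewrite jacobianE// mxE.
rewrite (@partial_chain _ _ _ i (fun z => g z 0 j) f)//; last exact: differentiable_entry.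
by apply: eq_bigr => l _; rewrite !jacobianE.
Qed.

Lemma jacobian_eq n m (U : set 'rV[R]_n) (f g : 'rV[R]_n -> 'rV[R]_m) x : open U ->
  (forall y, U y -> f y = g y) -> differentiable f x -> differentiable g x -> U x ->
  'J f x = 'J g x.
Proof.
move=> oU fg df dg Ux; apply/matrixP => i j.
refine (etrans (jacobianE i j df) (etrans _ (esym (jacobianE i j dg)))).
by apply: (partial_eq oU) Ux => y Uy; rewrite fg.
Qed.

Lemma jacobian_id n (x : 'rV[R]_n) : 'J id x = 1%:M.
Proof.
have di : differentiable (id : 'rV[R]_n -> 'rV[R]_n) x.
  by apply: differentiable_mx => a b; rewrite [a]ord1; exact: differentiable_coord.
apply/matrixP => i j; rewrite (jacobianE i j di).
by rewrite partial_coord mxE eq_sym.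
Qed.

Lemma jacobian_inverse n (U : set 'rV[R]_n) (f g : 'rV[R]_n -> 'rV[R]_n) x : open U ->
  U x -> (forall y, U y -> g (f y) = y) -> differentiable f x -> differentiable g (f x) ->
  'J f x *m 'J g (f x) = 1%:M.
Proof.
move=> oU Ux gf df dg; rewrite -(jacobian_comp df dg) -(jacobian_id x).
apply: (jacobian_eq oU gf) Ux; last by apply: differentiable_mx => a b; rewrite [a]ord1; exact: differentiable_coord.
exact: (@differentiable_comp _ _ _ _ f g).
Qed.

Lemma diffeomorphism_jacobian n (U V : set 'rV[R]_n) (f : 'rV[R]_n -> 'rV[R]_n) x :
  diffeomorphism U V f -> U x -> 'J f x \in unitmx.
Proof.
move=> [oU oV fs [g [gs fg gf]]] Ux.
have E := jacobian_inverse oU Ux (fun y Uy => (fg y Uy).2)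
  (smooth_mx_diff fs Ux) (smooth_mx_diff gs (fg x Ux).1).
by have [H _] := mulmx1_unit E; exact: H.
Qed.

Lemma smooth_sub n m p (U U' : set 'rV[R]_n) (f : 'rV[R]_n -> 'M[R]_(m, p)) :
  U' `<=` U -> smooth_mx_on U f -> smooth_mx_on U' f.
Proof. by move=> UU fs i j s x Ux; exact: fs (UU x Ux). Qed.

Lemma smooth_mx_comp n m p q (U : set 'rV[R]_n) (W : set 'rV[R]_m)
    (F : 'rV[R]_m -> 'M[R]_(p, q)) (phi : 'rV[R]_n -> 'rV[R]_m) : open U -> open W ->
  (forall x, U x -> W (phi x)) -> smooth_mx_on W F -> smooth_mx_on U phi ->
  smooth_mx_on U (fun x => F (phi x)).
Proof.
move=> oU oW UW Fs phis i j.
exact: (@smooth_comp _ _ _ oU _ W (fun y => F y i j) phi oW UW (Fs i j) phis).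
Qed.

Lemma diffeomorphism_restrict n (U V V1 : set 'rV[R]_n) (f : 'rV[R]_n -> 'rV[R]_n) :
  diffeomorphism U V f -> open V1 -> V1 `<=` V ->
  diffeomorphism [set x | U x /\ V1 (f x)] V1 f.
Proof.
move=> [oU oV fs [g [gs fg gf]]] oV1 VV; split=> //.
- by apply: open_preim => // x Ux; exact: smooth_mx_diff fs Ux.
- by apply: smooth_sub fs => x [].
exists g; split.
- exact: smooth_sub gs.
- by move=> x [Ux V1x]; have [_ ->] := fg x Ux.
- by move=> y V1y; have [Uy fy] := gf y (VV y V1y); rewrite /= fy.
Qed.

Lemma is_derive_push n m (F : 'rV[R]_n -> 'rV[R]_m) (c : R -> 'rV[R]_n) v (t : R) :
  differentiable F (c t) -> is_derive t 1 c v ->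
  is_derive t 1 (fun s => F (c s)) (v *m 'J F (c t)).
Proof.
move=> dF dc; apply: is_derive_rV => j.
have dj : differentiable (fun y => F y 0 j) (c t) by exact: differentiable_entry.
have := is_derive_curve dj dc; congr (is_derive _ _ _ _).
by rewrite mxE; apply: eq_bigr => i _; rewrite jacobianE.
Qed.

Lemma same_orbit_push n (U V : set 'rV[R]_n) (F X Y : 'rV[R]_n -> 'rV[R]_n) x y :
  (forall x, U x -> [/\ V (F x), differentiable F x & X x *m 'J F x = Y (F x)]) ->
  same_orbit X U x y -> same_orbit Y V (F x) (F y).
Proof.
move=> H [a [b [s [t [c [ic sab tab cs ct]]]]]].
exists a, b, s, t, (fun r => F (c r)); split=> //; rewrite ?cs ?ct// => r rab.
have [Uc dc] := ic r rab; have [Vc dF <-] := H _ Uc.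
by split=> //; exact: is_derive_push.
Qed.

Lemma same_orbit_diffeomorphism n (U V : set 'rV[R]_n) (F X Y : 'rV[R]_n -> 'rV[R]_n) x y :
  diffeomorphism U V F -> (forall x, U x -> X x *m 'J F x = Y (F x)) -> U x -> U y ->
  same_orbit X U x y <-> same_orbit Y V (F x) (F y).
Proof.
move=> [oU oV Fs [g [gs Fg gF]]] XY Ux Uy; split.
  apply: same_orbit_push => z Uz; split; [exact: (Fg z Uz).1|exact: smooth_mx_diff Fs Uz|exact: XY].
rewrite -{2}(Fg x Ux).2 -{2}(Fg y Uy).2; apply: same_orbit_push => z Vz.
have [Ugz Fgz] := gF z Vz; split=> //; first exact: smooth_mx_diff gs Vz.
have := jacobian_inverse oU Ugz (fun w Uw => (Fg w Uw).2) (smooth_mx_diff Fs Ugz).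
rewrite Fgz => /(_ (smooth_mx_diff gs Vz)) E.
by rewrite -{1}Fgz -(XY _ Ugz) -mulmxA E mulmx1.
Qed.

Lemma pullback2_comp n m p (f : 'rV[R]_n -> 'rV[R]_m) (g : 'rV[R]_m -> 'rV[R]_p) h x :
  differentiable f x -> differentiable g (f x) ->
  pullback2 (fun y => g (f y)) h x = pullback2 f (pullback2 g h) x.
Proof. by move=> df dg; rewrite /pullback2 (jacobian_comp df dg) trmx_mul !mulmxA. Qed.

Lemma pullback1_comp n m p (f : 'rV[R]_n -> 'rV[R]_m) (g : 'rV[R]_m -> 'rV[R]_p) w x :
  differentiable f x -> differentiable g (f x) ->
  pullback1 (fun y => g (f y)) w x = pullback1 f (pullback1 g w) x.
Proof. by move=> df dg; rewrite /pullback1 (jacobian_comp df dg) trmx_mul !mulmxA. Qed.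

End Diffeomorphisms.

(** * Straightening the symmetry in the plane *)

Section Straightening.
Context {R : realType}.

Definition box (a b : R) (J : set R) : set 'rV[R]_2 :=
  [set v | a < v 0 i0 < b /\ J (v 0 i1)].

Lemma box_ball (v : 'rV[R]_2) (r : R) : 0 < r ->
  box (v 0 i0 - r) (v 0 i0 + r) `]v 0 i1 - r, v 0 i1 + r[ = ball v r.
Proof.
move=> r0; apply/seteqP; split=> w.
  move=> [/andP[a b]]; rewrite /= in_itv /= => /andP[c d].
  rewrite -ball_normE /=; apply: normr_lt_coord => //; apply: ord2P; rewrite !mxE ltr_norml; apply/andP; split; lra.
rewrite -ball_normE /= => vw; have H i := le_lt_trans (normr_coord (v - w) i) vw.
have := H i0; have := H i1; rewrite !mxE !ltr_norml => /andP[a b] /andP[c d].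
by split; rewrite /= ?in_itv /=; apply/andP; split; lra.
Qed.

Variables (U : set 'rV[R]_2) (G : @connection R 2) (k Ups : 'rV[R]_2 -> 'rV[R]_2).
Variables (e be : field_ R) (A B : 'rV[R]_2 -> R).
Hypotheses (oU : open U) (ks : smooth_mx_on U k) (af : adapted_frame U G k Ups e be A B).

Lemma smooth_base_coord (U' : set 'rV[R]_2) s y : open U' -> smooth_on U' s -> smooth_on U' y ->
  smooth_mx_on U' (base_coord s y).
Proof.
move=> oU' ss ys i j; rewrite [i]ord1; move: j; apply: ord2P.
  by apply: smooth_eq ss => // x _; rewrite mxE.
by apply: smooth_eq ys => // x _; rewrite mxE.
Qed.

Lemma jacobian_base_coord (U' : set 'rV[R]_2) s y x : open U' -> smooth_on U' s -> smooth_on U' y ->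
  (forall a x, U' x -> partial a s x = sg k e a x) ->
  (forall a x, U' x -> partial a y x = th k e a x) -> U' x ->
  'J (base_coord s y) x = jac_base k e x.
Proof.
move=> oU' ss ys ds dy Ux; have D := smooth_mx_diff (smooth_base_coord oU' ss ys) Ux.
have E0 : (fun x => base_coord s y x 0 i0) = s by apply/funext => x'; rewrite mxE.
have E1 : (fun x => base_coord s y x 0 i1) = y by apply/funext => x'; rewrite mxE.
apply/matrixP => i j; refine (etrans (jacobianE i j D) _); rewrite mxE; move: j.
by apply: ord2P; rewrite ?E0 ?E1 /= ?ds ?dy.
Qed.

(** Primitives s and y of the closed coframe are coordinates by the inverse function
    theorem. A ball for the norm of row vectors is a box. *)
Lemma straightening x0 : U x0 -> exists (s y : 'rV[R]_2 -> R) (U' : set 'rV[R]_2) (a b c d : R),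
  [/\ U' x0, U' `<=` U, smooth_on U' s & smooth_on U' y] /\
  [/\ forall i x, U' x -> partial i s x = sg k e i x,
      forall i x, U' x -> partial i y x = th k e i x &
      diffeomorphism U' (box a b `]c, d[) (base_coord s y)].
Proof.
move=> Ux0.
have [r1 [s [r1_0 r1U ss ds]]] := poincare oU (smooth_sg oU ks af) (closed_sg ks af) Ux0.
have [r2 [y [r2_0 r2U ys dy]]] := poincare oU (smooth_th oU ks af) (closed_th ks af) Ux0.
pose r := Num.min r1 r2; have r0 : 0 < r by rewrite lt_min r1_0.
pose U1 : set 'rV[R]_2 := ball x0 r.
have oU1 : open U1 by exact: ball_open.
have U1s x : U1 x -> ball x0 r1 x by apply: le_ball; rewrite ge_min lexx.
have U1y x : U1 x -> ball x0 r2 x by apply: le_ball; rewrite ge_min lexx orbT.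
have U1U x (H : U1 x) : U x := r1U x (U1s x H).
have ss1 : smooth_on U1 s by move=> t x /U1s; exact: ss.
have ys1 : smooth_on U1 y by move=> t x /U1y; exact: ys.
have ds1 i x (H : U1 x) : partial i s x = sg k e i x := ds x i (U1s x H).
have dy1 i x (H : U1 x) : partial i y x = th k e i x := dy x i (U1y x H).
have U1x0 : U1 x0 by exact: ballxx.
have Ju : 'J (base_coord s y) x0 \in unitmx.
  have E := jacobian_base_coord oU1 ss1 ys1 ds1 dy1 U1x0.
  have [H _] := mulmx1_unit (jac_base_fibre af U1U U1x0).
  by rewrite E; exact: H.
have [U2 [V2 [U2x0 U21 D]]] := inverse_function oU1 (smooth_base_coord oU1 ss1 ys1) U1x0 Ju.
pose v := base_coord s y x0.
have [oU2 oV2 _ [g [_ fg _]]] := D.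
have [eps eps0 epsV] := ball_of_near (near_open oV2 (fg x0 U2x0).1).
have oB : open (ball v eps : set 'rV[R]_2) by exact: ball_open.
have D' := diffeomorphism_restrict D oB epsV.
exists s, y, [set x | U2 x /\ ball v eps (base_coord s y x)].
exists (v 0 i0 - eps), (v 0 i0 + eps), (v 0 i1 - eps), (v 0 i1 + eps).
split; split.
- by split=> //; exact: ballxx.
- by move=> x [/U21 /U1U].
- by move=> t x [/U21 H _]; exact: ss1.
- by move=> t x [/U21 H _]; exact: ys1.
- by move=> i x [/U21 H _]; exact: ds1.
- by move=> i x [/U21 H _]; exact: dy1.
- by rewrite box_ball.
Qed.

(** In the coordinates (s, y) the field k is d/ds, and a function that k annihilates does
    not change along the segments of the box on which y is constant. *)
Lemma invariant_descends (U' : set 'rV[R]_2) s y (a b : R) (J : set R) f : U' `<=` U ->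
  smooth_on U' s -> smooth_on U' y ->
  (forall i x, U' x -> partial i s x = sg k e i x) ->
  (forall i x, U' x -> partial i y x = th k e i x) ->
  diffeomorphism U' (box a b J) (base_coord s y) -> a < b -> open J ->
  smooth_on U f -> (forall x, U x -> along (coord_field k) f x = 0) ->
  exists2 g, smooth1_on J g & forall x, U' x -> f x = g (y x).
Proof.
move=> UU ss ys ds dy [oU' oV _ [psi [psis fg gf]]] ab oJ fs fk.
pose F v := f (psi v).
have Fs : smooth_on (box a b J) F.
  by apply: (smooth_comp oV oU _ fs psis) => v Vv; apply: UU; exact: (gf v Vv).1.
pose s0 := 2^-1 * (a + b); have s0ab : a < s0 < b by apply/andP; split; rewrite /s0; lra.
have F0 v : box a b J v -> partial i0 F v = 0.
  move=> Vv; have [Upv bv] := gf v Vv; have UUpv := UU _ Upv.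
  have dpsi := smooth_mx_diff psis Vv.
  rewrite (partial_chain i0 (smooth_diff fs UUpv) dpsi).
  have Jpsi : 'J psi v = (jac_fibre k e (psi v))^T.
    have E := jacobian_inverse oU' Upv (fun w Uw => (fg w Uw).2)
      (smooth_mx_diff (smooth_base_coord oU' ss ys) Upv).
    rewrite bv (jacobian_base_coord oU' ss ys ds dy Upv) in E.
    have {E} E := E dpsi; have E2 := jac_base_fibre af UU Upv.
    have [u _] := mulmx1_unit E2.
    by rewrite -[LHS](mulKmx u) E -E2 mulKmx.
  rewrite -[RHS](fk _ UUpv) alongE sum2.
  rewrite -!(jacobianE i0 _ dpsi) Jpsi !mxE /=.
  by [].
exists (fun t => F (s0 *: delta_mx 0 i0 + t *: delta_mx 0 i1)).
  apply: (smooth1_line oJ Fs) => t Jt; split; by rewrite !mxE /= !(mulr0, mulr1, add0r, addr0).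
move=> x Ux; have [[sx yx] px] := fg x Ux.
have E : base_coord s y x = y x *: delta_mx 0 i1 + s x *: delta_mx 0 i0.
  by apply/rowP; apply: ord2P; rewrite !mxE /= !(mulr0, mulr1, add0r, addr0).
have line t : a < t < b -> box a b J (y x *: delta_mx 0 i1 + t *: delta_mx 0 i0).
  by move: sx yx; rewrite !mxE /= => _ yx tab; split; rewrite !mxE /= !(mulr0, mulr1, add0r, addr0).
rewrite -[in LHS]px [in LHS]E -/(F _) [in RHS]addrC.
apply: (@is_derive_eq0_cst _ (fun t => F (y x *: delta_mx 0 i1 + t *: delta_mx 0 i0)) a b) => //.
  move=> t tab; have := is_derive_shift_line (smooth_diff Fs (line t tab)).
  by rewrite F0//; exact: line.
by move: sx; rewrite mxE.
Qed.

End Straightening.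

(** * Charts onto the model *)

Section Charts.
Context {R : realType}.

(** The determinant is prescribed because the Hodge dual depends on volume and
    orientation. *)
Record model_chart (U : set 'rV[R]_2) (G : @connection R 2) (k Ups : 'rV[R]_2 -> 'rV[R]_2)
    (a b : R) (J : set R) (fA fB : R -> R) (Phi : 'rV[R]_(2 + 2) -> 'rV[R]_(2 + 2)) : Prop := {
  mch_lt : a < b;
  mch_open : open J;
  mch_A : smooth1_on J fA;
  mch_B : smooth1_on J fB;
  mch_diffeo : diffeomorphism (cotangent U) (cotangent (box a b J)) Phi;
  mch_metric : forall m, cotangent U m -> metric G m
    = 'J Phi m *m metric (model_connection fA fB) (Phi m) *m ('J Phi m)^T;
  mch_lift : forall m, cotangent U m ->
    lift_field k Ups m *m 'J Phi m = lift_field model_field model_form (Phi m);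
  mch_det : forall m, cotangent U m -> \det ('J Phi m) = 1
}.

Lemma smooth_row_mx n p q (O : set 'rV[R]_n) (f : 'rV[R]_n -> 'rV[R]_p) (g : 'rV[R]_n -> 'rV[R]_q) :
  open O -> smooth_mx_on O f -> smooth_mx_on O g -> smooth_mx_on O (fun m => row_mx (f m) (g m)).
Proof.
move=> oO fs gs i j; rewrite [i]ord1; case: (split_ordP j) => l ->.
  by apply: (smooth_eq oO _ (fs 0 l)) => m _; rewrite row_mxEl.
by apply: (smooth_eq oO _ (gs 0 l)) => m _; rewrite row_mxEr.
Qed.

(** On the fibres the adapted coordinates are affine, with inverse given by the dual
    coframe. *)
Lemma adapted_coord_diffeomorphism (U : set 'rV[R]_2) G k Ups e be A B
    (U' : set 'rV[R]_2) s y (V : set 'rV[R]_2) :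
  open U -> smooth_mx_on U k -> adapted_frame U G k Ups e be A B -> U' `<=` U ->
  smooth_on U' s -> smooth_on U' y ->
  diffeomorphism U' V (base_coord s y) ->
  diffeomorphism (cotangent U') (cotangent V) (adapted_coord k e be s y).
Proof.
move=> oU ks af UU ss ys [oU' oV _ [psi [psis fg gf]]].
pose bv x : 'rV[R]_2 := \row_i be i x.
have PhiE m : adapted_coord k e be s y m
    = row_mx (base_coord s y (lsubmx m)) ((rsubmx m + bv (lsubmx m)) *m jac_fibre k e (lsubmx m)).
  by congr row_mx; apply/rowP; apply: ord2P; rewrite /fibre_coord !mxE sum2 !mxE.
pose x_ (m : 'rV[R]_(2 + 2)) := psi (lsubmx m).
pose Psi (m : 'rV[R]_(2 + 2)) : 'rV[R]_(2 + 2) :=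
  row_mx (x_ m) (rsubmx m *m (jac_base k e (x_ m))^T - bv (x_ m)).
have oO := open_cotangent oV.
split; [exact: open_cotangent|exact: oO|refine (smooth_adapted_coord ks af oU' UU ss ys)|].
have xU m : cotangent V m -> U' (x_ m) by move=> Om; exact: (gf _ Om).1.
have xs : smooth_mx_on (cotangent V) x_.
  apply: (smooth_mx_comp oO oV) => //; exact: smooth_lsubmx.
have fx f : smooth_on U f -> smooth_on (cotangent V) (fun m => f (x_ m)).
  move=> fs; apply: (smooth_comp oO oU _ fs xs) => m Om; apply: UU; exact: xU.
exists Psi; split.
- apply: smooth_row_mx => //.
  move=> i j; rewrite [i]ord1.
  have c l : smooth_on (cotangent V) (fun m : 'rV[R]_(2 + 2) => m 0 l) by exact: smooth_coord.
  have bs : smooth_on (cotangent V) (fun m => be j (x_ m)) by apply: fx; exact: af_form_smooth af j.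
  have sgs := fx _ (smooth_sg oU ks af j); have ths := fx _ (smooth_th oU ks af j).
  apply: (smooth_eq oO _ (smoothD oO (smoothD oO (smoothM oO (c r0) sgs) (smoothM oO (c r1) ths)) (smoothN oO bs))).
  by move=> m _; rewrite !mxE sum2 !mxE.
- move=> m Um; have [Vx px] := fg _ Um.
  rewrite PhiE; split; first by rewrite /cotangent /= row_mxKl.
  have xE : x_ (row_mx (base_coord s y (lsubmx m)) ((rsubmx m + bv (lsubmx m)) *m jac_fibre k e (lsubmx m))) = lsubmx m.
    by rewrite /x_ row_mxKl.
  rewrite /Psi xE row_mxKr -mulmxA (jac_fibre_base af UU Um) mulmx1 addrK.
  by rewrite hsubmxK.
- move=> m Vm; have [Ux bx] := gf _ Vm.
  split; first by rewrite /cotangent /= row_mxKl.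
  rewrite PhiE /Psi row_mxKl row_mxKr subrK -mulmxA.
  have E : (jac_base k e (x_ m))^T *m jac_fibre k e (x_ m) = 1%:M.
    by apply: mulmx1C; refine (jac_fibre_base af UU Ux).
  by rewrite E mulmx1 bx hsubmxK.
Qed.

Lemma model_chart_exists (U : set 'rV[R]_2) G k Ups x0 :
  generic_projective_symmetry U G k Ups -> U x0 ->
  exists (U' : set 'rV[R]_2) (a b : R) (J : set R) (fA fB : R -> R) Phi,
    [/\ U' x0, U' `<=` U & model_chart U' G k Ups a b J fA fB Phi].
Proof.
move=> gps Ux0.
have [oU Gs tf ks _ pf _ _] := gps.
have af := adapted_frame_exists oU Gs tf ks pf (fun x Ux => acceleration_transverse gps Ux).
have [s [y [U' [a [b [c [d [[U'x0 UU ss ys] [ds dy D]]]]]]]]] := straightening oU ks af Ux0.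
have [oU' _ _ [psi [psis fg gf]]] := D.
have [/andP[sa sb] _] := (fg x0 U'x0).1.
have ab : a < b by exact: lt_trans sa sb.
have oJ : open (`]c, d[%classic : set R) by exact: interval_open.
have [fA fAs AE] := invariant_descends oU af UU ss ys ds dy D ab oJ (af_A_smooth af) (af_A af).
have [fB fBs BE] := invariant_descends oU af UU ss ys ds dy D ab oJ (af_B_smooth af) (af_B af).
exists U', a, b, `]c, d[%classic, fA, fB, (adapted_coord k (frame_e G k) (form_be G k) s y).
split=> //; split=> //.
- exact: adapted_coord_diffeomorphism oU ks af UU ss ys D.
- by move=> m Um; exact: (metric_adapted_coord oU Gs tf ks af oU' UU ss ys ds dy AE BE Um).
- by move=> m Um; exact: (lift_adapted_coord ks af oU' UU ss ys ds dy Um).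
- by move=> m Um; exact: (det_adapted_coord ks af oU' UU ss ys ds dy Um).
Qed.

End Charts.

(** * The normal form as a Weyl structure *)

Notation j0 := (@Ordinal 3 0 isT).
Notation j1 := (@Ordinal 3 1 isT).
Notation j2 := (@Ordinal 3 2 isT).

Section EinsteinWeyl.
Context {R : realType}.

Lemma open_coord n (J : set R) (i : 'I_n) : open J -> open [set v : 'rV[R]_n | J (v 0 i)].
Proof.
move=> oJ; rewrite openE => v Jv.
exact: (differentiable_continuous (differentiable_coord v 0 i) (open_nbhs_nbhs (conj oJ Jv))).
Qed.

Lemma ord3P (P : 'I_3 -> Prop) : P j0 -> P j1 -> P j2 -> forall i, P i.
Proof.
move=> P0 P1 P2 [[|[|[|//]]] h]; [move: P0|move: P1|move: P2]; congr P; exact: val_inj.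
Qed.

Lemma sum3 (V : nmodType) (F : 'I_3 -> V) : \sum_i F i = F j0 + F j1 + F j2.
Proof.
rewrite !big_ord_recl big_ord0 addr0 addrA; congr (F _ + F _ + F _); exact: val_inj.
Qed.

Definition sym3 (x00 x01 x02 x11 x12 x22 : R) (a b : 'I_3) : R :=
  match val a, val b with
  | 0, 0 => x00 | 0, 1 | 1, 0 => x01 | 0, _ | _, 0 => x02
  | 1, 1 => x11 | 1, _ | _, 1 => x12 | _, _ => x22
  end%N.

Lemma sym3C x00 x01 x02 x11 x12 x22 a b :
  sym3 x00 x01 x02 x11 x12 x22 a b = sym3 x00 x01 x02 x11 x12 x22 b a.
Proof. by move: a b; apply: ord3P; apply: ord3P. Qed.

Variables (J : set R) (fA fB : R -> R).
Hypotheses (oJ : open J) (fAs : smooth1_on J fA) (fBs : smooth1_on J fB).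
Implicit Types w : 'rV[R]_3.

(** In terms of N = 1/V and c = p q + A the metric, its Weyl connection and the curvature
    are polynomials in p, q, c, N, V and the derivatives of A and B, in which A and B
    themselves do not occur. *)
Definition nN w : R := fB (cy w) + cp w ^+ 2 + cq w.
Definition nc w : R := cp w * cq w + fA (cy w).
Definition nA' w : R := derive1 fA (cy w).
Definition nB' w : R := derive1 fB (cy w).

Notation W := (normal_domain J fB).

Lemma normal_hE w a b : normal_h fA fB w a b =
  sym3 (- 4^-1) 0 (- (2^-1 * nc w)) 0 (2^-1 * nN w)
    (nN w ^+ 2 * cq w - nN w * nc w * cp w - nc w ^+ 2) a b.
Proof.
rewrite /normal_h /normal_V -/(nN w) -/(nc w) div1r invrK.
have -> : fB (cy w) = nN w - cp w ^+ 2 - cq w by rewrite /nN; ring.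
have -> : fA (cy w) = nc w - cp w * cq w by rewrite /nc; ring.
move: a b; apply: ord3P; apply: ord3P; rewrite !mxE !big_ord1 !mxE /sym3 /= ?mulr1n ?mulr0n; by field.
Qed.

Lemma nN_neq0 w : W w -> nN w != 0.
Proof. by case. Qed.

Lemma coordinate_smooth3 (O : set 'rV[R]_3) :
  [/\ smooth_on O cp, smooth_on O cq & smooth_on O cy].
Proof. by split; exact: smooth_coord. Qed.

Let ps O : smooth_on O cp := let: And3 H _ _ := coordinate_smooth3 O in H.
Let qs O : smooth_on O cq := let: And3 _ H _ := coordinate_smooth3 O in H.
Let ys O : smooth_on O cy := let: And3 _ _ H := coordinate_smooth3 O in H.

Let slab : set 'rV[R]_3 := [set w | J (cy w)].

Lemma open_slab : open slab.
Proof. exact: open_coord. Qed.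

Let smooth_slab_nN : smooth_on slab nN.
Proof.
have oS := open_slab; have [p q] := (@ps slab, @qs slab).
have b : smooth_on slab (fun w => fB (cy w)) by apply: (smooth_comp1 oS fBs).
by rewrite /nN; smooth_tac.
Qed.

Let slab_smooth : [/\ smooth_on slab nN, smooth_on slab nc, smooth_on slab nA' & smooth_on slab nB'].
Proof.
have oS := open_slab; have [p q y] := And3 (@ps slab) (@qs slab) (@ys slab).
have S f : smooth1_on J f -> smooth_on slab (fun w => f (cy w)).
  by move=> fs; apply: (smooth_comp1 oS fs).
have [a b] := (S _ fAs, S _ fBs).
by split; [rewrite /nN; smooth_tac|rewrite /nc; smooth_tac|apply: S; exact: smooth1_derive|apply: S; exact: smooth1_derive].
Qed.

Lemma open_neq0 n (U : set 'rV[R]_n) (f : 'rV[R]_n -> R) : open U -> smooth_on U f ->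
  open [set x | U x /\ f x != 0].
Proof.
move=> oU fs; rewrite openE => x [Ux fx]; apply: filterI; first exact: near_open oU Ux.
have cf := differentiable_continuous (smooth_diff fs Ux).
exact: (cvgr_neq0 _ cf fx).
Qed.

Lemma open_normal_domain : open W.
Proof. exact: open_neq0 open_slab smooth_slab_nN. Qed.

Lemma normal_smooth : [/\ smooth_on W nN, smooth_on W nc, smooth_on W nA' & smooth_on W nB'].
Proof.
have [a b c d] := slab_smooth.
by split=> t w [Jw _]; [exact: a|exact: b|exact: c|exact: d].
Qed.

Lemma normal_partial i w : W w ->
  [/\ partial i cp w = (j0 == i)%:R, partial i cq w = (j1 == i)%:R,
    partial i nN w = (j2 == i)%:R * nB' w + 2 * cp w * (j0 == i)%:R + (j1 == i)%:R &
    partial i nc w = (j0 == i)%:R * cq w + cp w * (j1 == i)%:R + (j2 == i)%:R * nA' w].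
Proof.
move=> [Jw _].
have P := @is_partial_coord R 3 i _ w.
have F f (df : derivable f (cy w) 1) : is_partial i (fun w => f (cy w)) w ((j2 == i)%:R * derive1 f (cy w)).
  by have := partial_comp1 i df (P j2).1; rewrite (P j2).2.
have FA := F _ (@fAs 0%N _ Jw); have FB := F _ (@fBs 0%N _ Jw).
split.
- exact: (P j0).2.
- exact: (P j1).2.
- exact: (is_partialD (is_partialD FB (is_partialX2 (P j0))) (P j1)).2.
- exact: (is_partialD (is_partialM (P j0) (P j1)) FA).2.
Qed.

(** The Levi-Civita connection of h plus (h om^# - delta om - om delta) / 2, which is the
    only torsion-free solution of D h = om (x) h. *)
Definition normal_connection : connection 3 := fun k a b w =>
  let p := cp w in let q := cq w in let c := nc w in let N := nN w in
  let V := (nN w)^-1 in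
  match val k with
  | 0 => sym3 (2 * V ^+ 2 * c - p * V) (- (2 * V)) (4 * V ^+ 2 * c ^+ 2 - p * V * c)
      0 (p - 4 * V * c)
      (8 * V ^+ 2 * c ^+ 2 * c - 2 * V * c * nB' w + 2 * nA' w - 8 * c * q
       + 6 * p * V * c ^+ 2 + 2 * p * N * q - 2 * p ^+ 2 * c) a b
  | 1 => sym3 (V * q - p * V ^+ 2 * c) (- (2^-1 * p * V))
      (2 * V * c * q - c - 2 * p * V ^+ 2 * c ^+ 2 + p ^+ 2 * V * c)
      (- (3 * V)) (N - 2 * q + 2 * p * V * c - p ^+ 2)
      (4 * V * c ^+ 2 * q - 2 * c ^+ 2 - 4 * N * q ^+ 2 + 2 * N ^+ 2 * q
       - 4 * p * V ^+ 2 * c ^+ 2 * c + p * V * c * nB' w - p * nA' w + 8 * p * c * q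
       - 2 * p * N * c - 2 * p ^+ 2 * V * c ^+ 2 - 2 * p ^+ 2 * N * q + 2 * p ^+ 2 * p * c) a b
  | _ => sym3 (- V ^+ 2) 0 (2^-1 * p * V - 2 * V ^+ 2 * c) 0 0
      (V * nB' w - 4 * V ^+ 2 * c ^+ 2 + 2 * q - N - p * V * c + p ^+ 2) a b
  end%N.

(** Read off the component h_pp = - 1/4 and the same component of the Ricci tensor. *)
Definition normal_scalar w : R := let V := (nN w)^-1 in
  12 * cp w * V ^+ 2 * V * nc w + 6 * cp w ^+ 2 * V ^+ 2 - 4 * V ^+ 2 * V * nB' w - 4 * V.

Lemma smooth_normal_connection : smooth_connection W normal_connection.
Proof.
have oW := open_normal_domain; have [Ns cs As Bs] := normal_smooth.
have [p q] := (@ps W, @qs W); have N0 w (Ww : W w) := nN_neq0 Ww.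
apply: ord3P; apply: ord3P; apply: ord3P; rewrite /normal_connection /sym3 /=; smooth_tac.
Qed.

Lemma weyl_pair_normal : weyl_pair W (normal_h fA fB) (normal_omega fB).
Proof.
have oW := open_normal_domain; have [Ns cs As Bs] := normal_smooth.
have [p q] := (@ps W, @qs W); have N0 w (Ww : W w) := nN_neq0 Ww.
split=> //.
- move=> i j; apply: (smooth_eq oW (fun w _ => esym (normal_hE w i j))).
  move: i j; apply: ord3P; apply: ord3P; rewrite /sym3 /=; smooth_tac.
- move=> i j; rewrite [i]ord1.
  have E w : normal_omega fB w 0 j = (nN w)^-1 * (4 * (j == j1)%:R + 2 * cp w * (j == j0)%:R).
    by rewrite /normal_omega /normal_V -/(nN w) !mxE /=.
  apply: (smooth_eq oW (fun w _ => esym (E w))); smooth_tac.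
- by move=> w _; apply/matrixP => a b; rewrite mxE !normal_hE sym3C.
- move=> w Ww; have n0 := N0 w Ww.
  (* the inverse of h, whose determinant is N^2 / 16 *)
  pose hi : 'M[R]_3 := \matrix_(a, b) sym3 (- 4) (- (4 * nc w * (nN w)^-1)) 0
    (4 * (nN w)^-1 * (nc w * cp w - nN w * cq w)) (2 * (nN w)^-1) 0 a b.
  suff E : normal_h fA fB w *m hi = 1%:M by have [H _] := mulmx1_unit E; exact: H.
  apply/matrixP; apply: ord3P; apply: ord3P;
    rewrite [LHS]mxE sum3 !normal_hE [hi _ _]mxE [hi _ _]mxE [hi _ _]mxE [RHS]mxE /sym3 /=;
    move: n0; move: (nN w) (nc w) (cp w) (cq w) => N c p' q' n0; by field.
Qed.

End EinsteinWeyl.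

(** * The normal form is Einstein-Weyl *)

Section Curvature.
Context {R : realType}.
Variables (J : set R) (fA fB : R -> R).
Hypotheses (oJ : open J) (fAs : smooth1_on J fA) (fBs : smooth1_on J fB).
Notation W := (normal_domain J fB).
Notation N := (nN fB).
Notation c := (nc fA).
Notation A' := (nA' fA).
Notation B' := (nB' fB).
Notation D := (normal_connection fA fB).

(** Expands the derivatives of compound expressions down to those of p, q, c, N and of
    the derivatives of A and B. *)
Ltac expand_partials :=
  repeat match goal with |- context [@partial ?K ?n ?i ?f ?x] =>
    lazymatch f with
    | cp => fail | cq => fail | nN _ => fail | nc _ => fail | nA' _ => fail | nB' _ => fail
    | _ => idtac
    end;
    let F := fresh "F" in
    eassert (F : @is_partial K n i f x _) by
      (rewrite ?/normal_connection /sym3 /=; is_partial_tac);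
    rewrite (is_partialE F); clear F
  end.

Lemma normal_weyl_connection : weyl_connection W (normal_h fA fB) (normal_omega fB) D.
Proof.
have oW := open_normal_domain oJ fBs.
have [Ns cs As Bs] := normal_smooth oJ fAs fBs.
have [ps qs ys] := coordinate_smooth3 W; have N0 w (Ww : W w) := nN_neq0 Ww.
split.
- exact: smooth_normal_connection.
- move=> k a b w _; rewrite /normal_connection /=.
  by case: (val k) => [|[|k']]; rewrite sym3C.
move=> w Ww a b d.
rewrite (partial_eq oW (fun y _ => normal_hE fA fB y b d) a Ww) !sum3 !normal_hE.
have om j : normal_omega fB w 0 j = (N w)^-1 * (4 * (j == j1)%:R + 2 * cp w * (j == j0)%:R).
  by rewrite /normal_omega /normal_V -/(N w) !mxE /=.
rewrite om; have n0 := N0 w Ww.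
have [dp0 dq0 dN0 dc0] := normal_partial fAs fBs j0 Ww.
have [dp1 dq1 dN1 dc1] := normal_partial fAs fBs j1 Ww.
have [dp2 dq2 dN2 dc2] := normal_partial fAs fBs j2 Ww.
move: a b d; apply: ord3P; apply: ord3P; apply: ord3P; rewrite /sym3 /=.
all: expand_partials; rewrite ?(dp0, dq0, dN0, dc0, dp1, dq1, dN1, dc1, dp2, dq2, dN2, dc2) /=;
  move: n0; rewrite /normal_connection /sym3 /=.
all: move: (N w) (c w) (cp w) (cq w) (A' w) (B' w) => n c p q a b n0; by field.
Qed.
Lemma partial_derivatives_y (f : R -> R) i w : i != j2 ->
  partial i (fun w : 'rV[R]_3 => derive1 f (cy w)) w = 0.
Proof.
move=> i2; apply: partial_indep => v h; rewrite /cy !mxE /= eq_sym (negPf i2).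
by rewrite mulr0 add0r.
Qed.

Lemma normal_ricci w a b : W w ->
  2^-1 * (ricci D a b w + ricci D b a w) = normal_scalar fA fB w * normal_h fA fB w a b.
Proof.
move=> Ww.
have oW := open_normal_domain oJ fBs.
have [Ns cs As Bs] := normal_smooth oJ fAs fBs.
have [ps qs ys] := coordinate_smooth3 W; have n0 : N w != 0 := nN_neq0 Ww.
rewrite normal_hE /ricci !sum3.
have [dp0 dq0 dN0 dc0] := normal_partial fAs fBs j0 Ww.
have [dp1 dq1 dN1 dc1] := normal_partial fAs fBs j1 Ww.
have [dp2 dq2 dN2 dc2] := normal_partial fAs fBs j2 Ww.
(* the derivatives of A and B do not depend on p and q; their y-derivatives stay as
   they are and cancel in the end *)
have A0 : partial j0 A' w = 0 by exact: partial_derivatives_y.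
have A1 : partial j1 A' w = 0 by exact: partial_derivatives_y.
have B0 : partial j0 B' w = 0 by exact: partial_derivatives_y.
have B1 : partial j1 B' w = 0 by exact: partial_derivatives_y.
move: a b; apply: ord3P; apply: ord3P.
all: expand_partials; rewrite ?(dp0, dq0, dN0, dc0, dp1, dq1, dN1, dc1, dp2, dq2, dN2, dc2, A0, A1, B0, B1) /=;
  move: n0; rewrite /normal_connection /sym3 /normal_scalar /=.
all: move: (N w) (c w) (cp w) (cq w) (A' w) (B' w) => n c p q a b n0; move_partials; by field.
Qed.

Theorem normal_einstein_weyl :
  einstein_weyl W (normal_h fA fB) (normal_omega fB).
Proof.
split; first exact: weyl_pair_normal oJ fAs fBs.
exists D, (normal_scalar fA fB); split; first exact: normal_weyl_connection.
by move=> w Ww a b; exact: normal_ricci.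
Qed.

End Curvature.

(** * Reduction of the model and of the charts *)

Section ModelReduction.
Context {R : realType}.
Variables (a b : R) (J : set R) (fA fB : R -> R).
Hypotheses (ab : a < b) (oJ : open J) (fAs : smooth1_on J fA) (fBs : smooth1_on J fB).
Notation W := (normal_domain J fB).

Lemma open_box : open (box a b J).
Proof.
have -> : box a b J = [set v : 'rV[R]_2 | `]a, b[%classic (v 0 i0)] `&` [set v | J (v 0 i1)].
  by apply/seteqP; split=> v; rewrite /box /= in_itv.
apply: openI; apply: open_coord => //; exact: interval_open.
Qed.

Definition model_domain : set 'rV[R]_(2 + 2) :=
  [set m | cotangent (box a b J) m /\ mN fB m != 0].

Lemma model_domainE m : model_domain m <-> [/\ a < m 0 l0 < b, J (m 0 l1) & mN fB m != 0].
Proof.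
by split=> [[[]]|[? ? ?]]; rewrite /model_domain /cotangent /box /= !mxE.
Qed.

Lemma open_model_domain : open model_domain.
Proof.
have oC := open_cotangent open_box.
apply: (open_neq0 oC); rewrite /mN.
have p : smooth_on (cotangent (box a b J)) (fun m => m 0 r0) by exact: smooth_coord.
have q : smooth_on (cotangent (box a b J)) (fun m => m 0 r1) by exact: smooth_coord.
have y : smooth_on (cotangent (box a b J)) (fun m => fB (m 0 l1)).
  apply: (smooth_comp1 oC fBs); last exact: smooth_coord.
  by move=> m []; rewrite !mxE.
by smooth_tac.
Qed.

Lemma model_domain_proj m : model_domain m -> W (orbit_proj m).
Proof.
move=> /model_domainE[_ Jm N0]; have [P Q Y] := orbit_projE m.
by split; rewrite ?P ?Q Y.
Qed.

(** A coordinate projection: the transposed Jacobian is a left inverse. *)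
Lemma submersion_orbit_proj (m : 'rV[R]_(2 + 2)) : row_full ('J orbit_proj m).
Proof.
apply/row_fullP; exists ('J orbit_proj m)^T; apply/matrixP => i j.
have tE k l : ('J orbit_proj m)^T k l = 'J orbit_proj m l k by rewrite mxE.
rewrite mxE sum4 !tE !jacobian_orbit_proj [RHS]mxE; clear tE.
by move: i j; apply: ord3P; apply: ord3P; rewrite /= ?mulr1 ?mulr0 ?addr0 ?add0r.
Qed.

(** The orbits are the segments parallel to d_0, and the model domain is a box in that
    direction. *)
Lemma same_orbit_model m m' : model_domain m -> model_domain m' ->
  orbit_proj m = orbit_proj m' <->
  same_orbit (lift_field model_field model_form) model_domain m m'.
Proof.
move=> /model_domainE[ma mJ mn] /model_domainE[m'a _ _]; split.
  move=> E; have [P Q Y] := orbit_projE m; rewrite E in P Q Y.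
  have [P' Q' Y'] := orbit_projE m'; rewrite P' in P; rewrite Q' in Q; rewrite Y' in Y.
  pose c (t : R) : 'rV[R]_(2 + 2) := m + (t - m 0 l0) *: delta_mx 0 l0.
  have cE t : [/\ c t 0 l0 = t, c t 0 l1 = m 0 l1, c t 0 r0 = m 0 r0 & c t 0 r1 = m 0 r1].
    by split; rewrite !mxE /=; ring.
  exists a, b, (m 0 l0), (m' 0 l0), c; split=> //.
  - move=> t tab; have [c0 c1 c2 c3] := cE t; split.
      by apply/model_domainE; rewrite /mN c0 c1 c2 c3.
    rewrite model_lift; apply: is_derive_rV => j.
    set d := (delta_mx 0 l0 : 'rV[R]_(2 + 2)) 0 j.
    have := is_deriveD (is_derive_mulr d t) (is_derive_cst (m 0 j - m 0 l0 * d) t 1).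
    rewrite addr0; congr (is_derive _ _ _ _); apply/funext => s.
    rewrite -[LHS]/(s * d + (m 0 j - m 0 l0 * d)) /c [RHS]mxE [X in _ = _ + X]mxE -/d.
    by ring.
  - by apply/rowP => j; have := cE (m 0 l0); move: j; apply: ord4P => -[].
  - by apply/rowP => j; have := cE (m' 0 l0); move: j; apply: ord4P => -[]; rewrite ?P ?Q ?Y.
move=> [s0 [s1 [s [t [c [ic sab tab <- <-]]]]]].
have H j : j != l0 -> c s 0 j = c t 0 j.
  move=> j0; apply: (@is_derive_eq0_cst _ (fun r => c r 0 j) s0 s1 _ s t sab tab) => r rab.
  have [_ dc] := ic r rab; have := is_derive_rV_coord j dc.
  by rewrite model_lift mxE (negPf j0).
by apply/rowP; apply: ord3P; rewrite !mxE; apply: H.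
Qed.

Lemma model_orbit_space :
  orbit_space (lift_field model_field model_form) model_domain W orbit_proj.
Proof.
split.
- exact: open_model_domain.
- exact: open_normal_domain oJ fBs.
- apply/seteqP; split=> [_ [m Om <-]|w [Jw Nw]]; first exact: model_domain_proj.
  pose m : 'rV[R]_(2 + 2) := row_mx (\row_i (if i == i0 then 2^-1 * (a + b) else cy w))
    (\row_i (if i == i0 then cp w else cq w)).
  have [m0 m1 m2 m3] : [/\ m 0 l0 = 2^-1 * (a + b), m 0 l1 = cy w, m 0 r0 = cp w & m 0 r1 = cq w].
    by split; rewrite ?row_mxEl ?row_mxEr !mxE.
  have mid : a < 2^-1 * (a + b) < b by apply/andP; split; move: ab => ?; lra.
  exists m; first by apply/model_domainE; rewrite /mN m0 m1 m2 m3.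
  by apply/rowP; apply: ord3P; rewrite mxE /= ?m1 ?m2 ?m3.
- exact: smooth_orbit_proj.
- by move=> m _; exact: submersion_orbit_proj.
- exact: same_orbit_model.
Qed.

Lemma weyl_pair_model : weyl_pair W (model_h fA fB) (model_omega fB).
Proof.
have [oW hs oms hsym hu] := weyl_pair_normal oJ fAs fBs.
have [Ns cs As Bs] := normal_smooth oJ fAs fBs.
have [ps qs ys] := coordinate_smooth3 W; have N0 w (Ww : W w) := nN_neq0 Ww.
split=> //.
- move=> i j; have hs' : smooth_on W (fun w => normal_h fA fB w i j) by exact: hs.
  apply: (smooth_eq oW (f := fun w => (nN fB w)^-1 ^+ 2 * normal_h fA fB w i j)).
    by move=> w _; rewrite [RHS]mxE.
  by smooth_tac.
- move=> i j; rewrite [i]ord1.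
  apply: (smooth_eq oW (f := fun w => (nN fB w)^-1 * (2 * (j == j1)%:R - 2 * cp w * (j == j0)%:R - 2 * nB' fB w * (j == j2)%:R))).
    by move=> w _; rewrite /model_omega /normal_V -/(nN fB w) !mxE /=.
  by smooth_tac.
- by move=> w Ww; rewrite linearZ /= hsym.
- move=> w Ww; rewrite /model_h /normal_V -/(nN fB w).
  rewrite unitmxZ; first exact: hu.
  by rewrite unitfE expf_eq0 /= invr_eq0; exact: N0.
Qed.

Lemma normal_h_conformal w : W w -> normal_h fA fB w = nN fB w ^+ 2 *: model_h fA fB w.
Proof.
move=> Ww; rewrite /model_h /normal_V -/(nN fB w) scalerA -exprMn.
by rewrite mulfV ?expr1n ?scale1r//; exact: nN_neq0 Ww.
Qed.

Lemma normal_omega_conformal w : W w ->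
  normal_omega fB w = model_omega fB w + (2 / nN fB w) *: \row_i partial i (nN fB) w.
Proof.
move=> Ww; have N0 := nN_neq0 Ww.
rewrite /normal_omega /model_omega /normal_V -/(nN fB w) -/(nB' fB w).
apply/rowP => i; have [_ _ dN _] := normal_partial fAs fBs i Ww.
rewrite !mxE dN; move: i dN; apply: ord3P => _; rewrite /=; move: N0;
  move: (nN fB w) (cp w) (nB' fB w) => N p B1 N0; by field.
Qed.

End ModelReduction.

Section ChartReduction.
Context {R : realType}.
Variables (U : set 'rV[R]_2) (G : @connection R 2) (k Ups : 'rV[R]_2 -> 'rV[R]_2).
Variables (a b : R) (J : set R) (fA fB : R -> R) (Phi : 'rV[R]_(2 + 2) -> 'rV[R]_(2 + 2)).
Hypothesis mch : model_chart U G k Ups a b J fA fB Phi.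
Notation W := (normal_domain J fB).

Definition chart_domain : set 'rV[R]_(2 + 2) :=
  [set m | cotangent U m /\ model_domain a b J fB (Phi m)].
Definition chart_proj m : 'rV[R]_3 := orbit_proj (Phi m).

Let ab : a < b := mch_lt mch.
Let oJ : open J := mch_open mch.
Let fAs : smooth1_on J fA := mch_A mch.
Let fBs : smooth1_on J fB := mch_B mch.
Let D := mch_diffeo mch.

Lemma chart_domain_diffeomorphism : diffeomorphism chart_domain (model_domain a b J fB) Phi.
Proof. by apply: diffeomorphism_restrict D _ _; [exact: open_model_domain|move=> m []]. Qed.

Lemma chart_smooth : smooth_mx_on (cotangent U) Phi.
Proof. by case: D. Qed.

Lemma chart_open : open (cotangent U).
Proof. by case: D. Qed.

Lemma chart_box m : cotangent U m -> J (Phi m 0 l1).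
Proof. by case: D => _ _ _ [psi [_ fg _]] /fg[[_]]; rewrite mxE. Qed.

Lemma chart_killing_norm m : cotangent U m -> killing_norm G k Ups m = mN fB (Phi m).
Proof.
by move=> Um; rewrite (natural_killing_norm (mch_metric mch) (mch_lift mch) Um) (model_killing_norm fA).
Qed.

Lemma chart_domainE m : chart_domain m <-> cotangent U m /\ killing_norm G k Ups m != 0.
Proof.
split=> [[Um [_ N0]]|[Um N0]]; first by rewrite chart_killing_norm.
split=> //; split; last by rewrite -chart_killing_norm.
by case: D => _ _ _ [psi [_ fg _]]; case: (fg m Um).
Qed.

Lemma chart_proj_smooth : smooth_mx_on (cotangent U) chart_proj.
Proof.
apply: (smooth_mx_comp chart_open openT _ _ chart_smooth) => //.
exact: smooth_orbit_proj.
Qed.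

Lemma orbit_proj_differentiable (m : 'rV[R]_(2 + 2)) : differentiable orbit_proj m.
Proof. exact: (smooth_mx_diff (smooth_orbit_proj (O := setT))). Qed.

Lemma chart_jones_tod_h m : cotangent U m -> killing_norm G k Ups m != 0 ->
  jones_tod_h G k Ups m = pullback2 chart_proj (model_h fA fB) m.
Proof.
move=> Um N0; rewrite chart_killing_norm// in N0.
have dP := smooth_mx_diff chart_smooth Um.
rewrite (natural_jones_tod_h (mch_metric mch) (mch_lift mch) Um).
rewrite (pullback2_comp _ dP (orbit_proj_differentiable _)).
by rewrite {1}/pullback2 (model_jones_tod_h fA N0).
Qed.

Lemma model_form_differentiable (m : 'rV[R]_(2 + 2)) j : J (m 0 l1) -> differentiable
  (fun y => killing_form (model_connection fA fB) model_field model_form y 0 j) m.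
Proof.
move=> Jm; have oO : open [set v : 'rV[R]_(2 + 2) | J (v 0 l1)] by exact: open_coord.
pose O := [set v : 'rV[R]_(2 + 2) | J (v 0 l1)].
have c i : smooth_on O (fun v : 'rV[R]_(2 + 2) => v 0 i) by exact: smooth_coord.
have f (g : R -> R) : smooth1_on J g -> smooth_on O (fun v => g (v 0 l1)).
  by move=> gs; apply: (smooth_comp1 oO gs).
have [As Bs] := (f _ fAs, f _ fBs).
have oO' : open O := oO.
have Ns : smooth_on O (mN fB) by rewrite /mN; have [p q] := (c r0, c r1); smooth_tac.
have cs : smooth_on O (mc fA) by rewrite /mc; have [p q] := (c r0, c r1); smooth_tac.
suff S : smooth_on O (fun y => killing_form (model_connection fA fB) model_field model_form y 0 j).
  exact: smooth_diff S Jm.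
apply: (smooth_eq oO (f := fun y => mN fB y * dx i0 0 j + mc fA y * dx i1 0 j + 2^-1 * dz i0 0 j)).
  by move=> y _; rewrite model_killing_formE /mkf !mxE.
by smooth_tac.
Qed.

Lemma chart_jones_tod_omega m : cotangent U m -> killing_norm G k Ups m != 0 ->
  jones_tod_omega G k Ups m = pullback1 chart_proj (model_omega fB) m.
Proof.
move=> Um N0; rewrite chart_killing_norm// in N0.
have dP := smooth_mx_diff chart_smooth Um; have Jm := chart_box Um.
rewrite (natural_jones_tod_omega chart_open chart_smooth (mch_metric mch) (mch_lift mch)
  (mch_det mch) Um (fun j => model_form_differentiable j Jm) (model_metric_unit _ _ _)).
rewrite (pullback1_comp _ dP (orbit_proj_differentiable _)).
by rewrite {1}/pullback1 (model_jones_tod_omega fAs fBs N0 Jm).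
Qed.

Lemma chart_orbit_space :
  orbit_space (lift_field k Ups) chart_domain W chart_proj.
Proof.
have [_ oW onto _ _ fib] := model_orbit_space ab oJ fBs.
have D' := chart_domain_diffeomorphism; have [oO _ _ [psi [_ fg gf]]] := D'.
split=> //.
- apply/seteqP; split=> [_ [m Om <-]|w]; first by rewrite -onto; exists (Phi m) => //; exact: (fg m Om).1.
  rewrite -onto => -[m Om <-]; have [Opm Ppm] := gf m Om.
  by exists (psi m) => //; rewrite /chart_proj Ppm.
- by apply: smooth_sub chart_proj_smooth => m [].
- move=> m Om; have dP := smooth_mx_diff chart_smooth Om.1.
  rewrite (jacobian_comp dP (orbit_proj_differentiable _)).
  have /row_fullP[X XJ] := submersion_orbit_proj (Phi m).
  have u := diffeomorphism_jacobian D' Om.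
  apply/row_fullP; exists (X *m invmx ('J Phi m)).
  by rewrite mulmxA mulmxKV.
- move=> m m' Om Om'.
  rewrite (same_orbit_diffeomorphism D' _ Om Om'); last by move=> z [Uz _]; exact: (mch_lift mch Uz).
  by apply: fib; [exact: (fg m Om).1|exact: (fg m' Om').1].
Qed.

Lemma chart_reduction : jones_tod_reduction U G k Ups chart_domain chart_proj W
  (model_h fA fB) (model_omega fB).
Proof.
split.
- by move=> m [].
- by move=> m /chart_domainE[].
- exact: chart_orbit_space.
- exact: weyl_pair_model.
- by move=> m /chart_domainE[Um N0]; rewrite chart_jones_tod_h.
- by move=> m /chart_domainE[Um N0]; rewrite chart_jones_tod_omega.
Qed.

End ChartReduction.

(** * Every reduction is locally of the normal form *)

Section Final.
Context {R : realType}.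

Lemma smooth_section n m (X : 'M[R]_(m, n)) (a : 'rV[R]_n) (w : 'rV[R]_m) (O : set 'rV[R]_m) :
  open O -> smooth_mx_on O (fun v => a + (v - w) *m X).
Proof.
move=> oO i j; rewrite [i]ord1.
apply: (smooth_eq oO (f := fun v => a 0 j + \sum_l (v 0 l + - w 0 l) * X l j)).
  by move=> v _; rewrite !mxE; congr (_ + _); apply: eq_bigr => l _; rewrite !mxE.
apply: smoothD => //; first exact: smooth_cst.
apply: smooth_sum => // l _; have c : smooth_on O (fun v : 'rV[R]_m => v 0 l) by exact: smooth_coord.
by smooth_tac.
Qed.

Lemma jacobian_section n m (X : 'M[R]_(m, n)) (a : 'rV[R]_n) (w v : 'rV[R]_m) :
  'J (fun v => a + (v - w) *m X) v = X.
Proof.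
have d := smooth_mx_diff (smooth_section X a w openT) (I : setT v).
apply/matrixP => i j; refine (etrans (jacobianE i j d) _).
have -> : (fun y => (a + (y - w) *m X) 0 j) = fun v => a 0 j + \sum_l (v 0 l + - w 0 l) * X l j.
  by apply/funext => y; rewrite !mxE; congr (_ + _); apply: eq_bigr => l _; rewrite !mxE.
have P l : is_partial i (fun v : 'rV[R]_m => (v 0 l + - w 0 l) * X l j) v ((l == i)%:R * X l j).
  have := is_partialM (is_partialD (is_partial_coord i l v) (is_partial_cst i (- w 0 l) v)) (is_partial_cst i (X l j) v).
  by rewrite !addr0 mulr0 addr0.
rewrite partialD; first last.
- have -> : (fun y : 'rV[R]_m => \sum_l (y 0 l + - w 0 l) * X l j)
      = \sum_l (fun y : 'rV[R]_m => (y 0 l + - w 0 l) * X l j).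
    by apply/funext => y; rewrite fct_sumE.
  by apply: differentiable_sum => l; have [] := P l.
- exact: differentiable_cst.
rewrite partial_cst add0r partial_sum; last by move=> l; have [] := P l.
rewrite (bigD1 i) //= (P i).2 eqxx mul1r big1 ?addr0// => l li.
by rewrite (P l).2 (negPf li) mul0r.
Qed.

(** Restricted to an affine slice on which its differential is the identity, pi is a
    local diffeomorphism. *)
Lemma local_section n m (O : set 'rV[R]_n) (pi : 'rV[R]_n -> 'rV[R]_m) x :
  open O -> smooth_mx_on O pi -> O x -> row_full ('J pi x) ->
  exists (V : set 'rV[R]_m) (F : 'rV[R]_m -> 'rV[R]_n),
    [/\ open V, V (pi x), smooth_mx_on V F, F (pi x) = x &
        forall v, V v -> O (F v) /\ pi (F v) = v].
Proof.
move=> oO pis Ox /row_fullP[X XJ]; set w := pi x.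
pose sec (v : 'rV[R]_m) : 'rV[R]_n := x + (v - w) *m X.
have secs : smooth_mx_on setT sec := smooth_section X x w openT.
have secw : sec w = x by rewrite /sec subrr mul0mx addr0.
pose S := [set v | setT v /\ O (sec v)].
have oS : open S by exact: (open_preim openT oO (fun v _ => smooth_mx_diff secs (I : setT v))).
have Sw : S w by split=> //; rewrite secw.
have fs : smooth_mx_on S (fun v => pi (sec v)).
  by apply: (smooth_mx_comp oS oO _ pis) => [v []//|]; apply: smooth_sub secs.
have dsec : differentiable sec w by exact: (smooth_mx_diff secs (I : setT w)).
have dpi : differentiable pi (sec w) by rewrite secw; exact: smooth_mx_diff pis Ox.
have Ju : 'J (fun v => pi (sec v)) w \in unitmx.
  by rewrite (jacobian_comp dsec dpi) jacobian_section secw XJ; exact: unitmx1.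
have [U1 [V1 [U1w U1S [oU1 oV1 _ [g [gs fg gf]]]]]] := inverse_function oS fs Sw Ju.
have [Vw gw] := fg w U1w; rewrite /= secw -/w in Vw gw.
exists V1, (fun v => sec (g v)); split=> //.
- by apply: (smooth_mx_comp oV1 openT _ secs gs).
- by rewrite gw.
- by move=> v /gf[/U1S[_ Og] pg].
Qed.

(** As phi pulls a tensor back to a nondegenerate one, its differential is invertible
    and phi is a local diffeomorphism. The factor rho is 1/V o phi, by which the normal
    form differs from the structure that the model induces. *)
Lemma conformal_equivalence (J : set R) (fA fB : R -> R) (V : set 'rV[R]_3)
    (h : 'rV[R]_3 -> 'M[R]_3) (om : 'rV[R]_3 -> 'rV[R]_3) (phi : 'rV[R]_3 -> 'rV[R]_3) w :
  open J -> smooth1_on J fA -> smooth1_on J fB ->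
  open V -> V w -> smooth_mx_on V phi -> (forall v, V v -> normal_domain J fB (phi v)) ->
  (forall v, V v -> h v \in unitmx) ->
  (forall v, V v -> pullback2 phi (model_h fA fB) v = h v) ->
  (forall v, V v -> pullback1 phi (model_omega fB) v = om v) ->
  locally_equivalent V h om w (normal_domain J fB) (normal_h fA fB) (normal_omega fB) (phi w).
Proof.
move=> oJ fAs fBs oV Vw phis VW hu ph pom.
have [Ns _ _ _] := normal_smooth oJ fAs fBs.
have oW := open_normal_domain oJ fBs.
have N0 v (Vv : V v) := nN_neq0 (VW v Vv).
have Ju : 'J phi w \in unitmx.
  have := hu w Vw; rewrite -ph// /pullback2 -mulmxA => u.
  have E := mulmxV u; rewrite -!mulmxA in E.
  by have [H _] := mulmx1_unit E; exact: H.
have [U1 [V1 [U1w U1V D]]] := inverse_function oV phis Vw Ju.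
have [oU1 oV1 _ [g [gs fg gf]]] := D.
exists U1, V1, phi, (fun v => nN fB (phi v)); split=> //.
- split=> // v /gf[/U1V Vg <-]; exact: VW.
- apply: (smooth_comp oU1 oW _ Ns) => [v /U1V|]; [exact: VW|exact: smooth_sub phis].
- by move=> v /U1V Vv; exact: N0.
move=> v /U1V Vv; have Wv := VW v Vv.
split; first by rewrite -ph// /pullback2 (normal_h_conformal fA Wv) -scalemxAr -scalemxAl.
rewrite -pom// /pullback1 (normal_omega_conformal fAs fBs Wv) mulmxDl.
congr (_ + _); rewrite -scalemxAl; congr (_ *: _); apply/rowP => i; rewrite mxE [RHS]mxE.
have dN := smooth_diff Ns Wv; have dphi := smooth_mx_diff phis Vv.
rewrite (partial_chain i dN dphi); apply: eq_bigr => j _.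
rewrite mxE [X in _ * X]mxE mulrC; congr (_ * _); exact: jacobianE.
Qed.

(** Along a local section F of pi, the tensors h and om on W are the pullbacks by F of
    the Jones-Tod tensors of M, which a chart identifies with the pullbacks from the
    model. Hence the coordinates (p, q, y) of the chart, composed with F, are the required
    map. *)
Lemma reduction_normal_form (U : set 'rV[R]_2) (G : @connection R 2) (k Ups : 'rV[R]_2 -> 'rV[R]_2)
    (O : set 'rV[R]_(2 + 2)) (pi : 'rV[R]_(2 + 2) -> 'rV[R]_3)
    (W : set 'rV[R]_3) (h : 'rV[R]_3 -> 'M[R]_3) (om : 'rV[R]_3 -> 'rV[R]_3) w :
  generic_projective_symmetry U G k Ups -> jones_tod_reduction U G k Ups O pi W h om ->
  W w -> exists (J : set R) (A B : R -> R) (w0 : 'rV[R]_3),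
    [/\ open J, smooth1_on J A, smooth1_on J B &
        locally_equivalent W h om w (normal_domain J B) (normal_h A B) (normal_omega B) w0].
Proof.
move=> gps [OU nonnull [oO oW onto pis sub _] [_ _ _ _ hu] ph pom].
rewrite -{1}onto => -[m Om piw].
have [U' [a [b [J [fA [fB [Phi [U'm UU mch]]]]]]]] := model_chart_exists gps (OU m Om).
have [oJ fAs fBs D] := And4 (mch_open mch) (mch_A mch) (mch_B mch) (mch_diffeo mch).
have oC := chart_open mch.
pose O1 := O `&` cotangent U'.
have oO1 : open O1 by exact: openI.
have [V [F [oV Vw Fs Fw FP]]] := local_section oO1 (smooth_sub (@subIsetl _ _ _) pis) (conj Om U'm) (sub m Om).
rewrite piw in Vw Fw.
pose phi v := chart_proj Phi (F v).
have dF v (Vv : V v) := smooth_mx_diff Fs Vv.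
have VO v : V v -> O (F v) by move=> /FP[[]].
have VC v : V v -> cotangent U' (F v) by move=> /FP[[]].
have VW v : V v -> W v by move=> Vv; rewrite -onto; exists (F v); [exact: VO|exact: (FP v Vv).2].
have dchart v (Vv : V v) := smooth_mx_diff (chart_proj_smooth mch) (VC v Vv).
have dpi v (Vv : V v) := smooth_mx_diff pis (VO v Vv).
have piF1 v : V v -> 'J F v *m 'J pi (F v) = 1%:M.
  move=> Vv; rewrite -(jacobian_comp (dF v Vv) (dpi v Vv)) -(jacobian_id v).
  apply: (jacobian_eq oV _ _ _ Vv); first by move=> u /FP[].
    exact: (@differentiable_comp _ _ _ _ F pi _ (dF v Vv) (dpi v Vv)).
  by apply: differentiable_mx => c d; rewrite [c]ord1; exact: differentiable_coord.
have E : locally_equivalent V h om w (normal_domain J fB) (normal_h fA fB) (normal_omega fB) (phi w).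
  apply: conformal_equivalence => //.
  - by apply: (smooth_mx_comp oV oC VC (chart_proj_smooth mch) Fs).
  - move=> v Vv; have [_ fib] := chart_domainE mch (F v).
    have := fib (conj (VC v Vv) (nonnull _ (VO v Vv))) => -[_ FD].
    exact: model_domain_proj FD.
  - by move=> v /VW; exact: hu.
  - move=> v Vv; rewrite (pullback2_comp _ (dF v Vv) (dchart v Vv)) {1}/pullback2.
    rewrite -(chart_jones_tod_h mch (VC v Vv) (nonnull _ (VO v Vv))) -(ph _ (VO v Vv)) /pullback2.
    rewrite !mulmxA piF1// mul1mx -mulmxA -trmx_mul piF1// trmx1 mulmx1.
    by rewrite (FP v Vv).2.
  - move=> v Vv; rewrite (pullback1_comp _ (dF v Vv) (dchart v Vv)) {1}/pullback1.
    rewrite -(chart_jones_tod_omega mch (VC v Vv) (nonnull _ (VO v Vv))) -(pom _ (VO v Vv)) /pullback1.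
    by rewrite -mulmxA -trmx_mul piF1// trmx1 mulmx1 (FP v Vv).2.
have [U1 [U2 [f [rho [[U1w U1V U2W fw] D1 D2 D3 D4]]]]] := E.
exists J, fA, fB, (phi w); split=> //; exists U1, U2, f, rho; split=> //.
by split=> // v /U1V /VW.
Qed.

End Final.

(** * Every normal form arises *)

Section Realisation.
Context {R : realType}.
Variables (a b : R) (J : set R) (fA fB : R -> R).
Hypotheses (ab : a < b) (oJ : open J) (fAs : smooth1_on J fA) (fBs : smooth1_on J fB).
Notation Gm := (model_connection fA fB).

Lemma smooth_id n (O : set 'rV[R]_n) : smooth_mx_on O id.
Proof. by move=> i j; rewrite [i]ord1; exact: smooth_coord. Qed.

Lemma smooth_model_connection : smooth_connection (box a b J) Gm.
Proof.
have oB := open_box (a := a) (b := b) oJ.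
have f (g : R -> R) : smooth1_on J g -> smooth_on (box a b J) (fun v => g (v 0 i1)).
  by move=> gs; apply: (smooth_comp1 oB gs) => [v []//|]; exact: smooth_coord.
have cst (x : R) : smooth_on (box a b J) (fun=> x) by exact: smooth_cst.
have Bs := smoothN oB (f _ fBs).
by apply: ord2P; apply: ord2P; apply: ord2P; rewrite /model_connection /=; first [exact: cst|exact: f|exact: Bs].
Qed.

Lemma partial0_model_connection c d e (x : 'rV[R]_2) : partial i0 (Gm c d e) x = 0.
Proof.
apply: partial_indep => y h; rewrite /model_connection.
by rewrite !mxE /= mulr0 add0r.
Qed.

Lemma model_projective : projective_field (box a b J) Gm model_field model_form.
Proof.
move=> c d e x _; rewrite /lie_connection sum2 !partial0_model_connection.
have k0 i l (y : 'rV[R]_2) : partial l (fun y => model_field y 0 i) y = 0 by exact: partial_cst.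
rewrite !k0 (_ : partial e (fun y => model_field y 0 c) = fun=> 0); last exact/funext/k0.
by rewrite partial_cst !mxE /= !mulr0 !(mul0r, mulr0, addr0, subr0).
Qed.

(** The integral curves are straight lines with constant velocity d_0, but
    nabla_0 d_0 = - d_1. *)
Lemma model_not_geodesic (s t : R) (c : R -> 'rV[R]_2) : s < t ->
  integral_curve model_field (box a b J) s t c -> ~ unparametrised_geodesic Gm s t c.
Proof.
move=> st ic [f geo]; pose r := 2^-1 * (s + t).
have rst : s < r < t by apply/andP; split; rewrite /r; lra.
have c1 u : s < u < t -> derive1 c u = delta_mx 0 i0.
  by move=> /ic[_ dc]; rewrite derive1E; case: dc.
have c2 : derive1n 2 c r = 0.
  rewrite derive1nS derive1n1 derive1E.
  transitivity ('D_1 (fun=> delta_mx 0 i0 : 'rV[R]_2) r); last exact: derive_cst.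
  apply: near_eq_derive.
  have oI : open (`]s, t[%classic : set R) by exact: interval_open.
  have Ir : `]s, t[%classic r by rewrite /= in_itv.
  by apply: filterS (open_nbhs_nbhs (conj oI Ir)) => u; rewrite /= in_itv; exact: c1.
have [_ _ _ /(_ i1)] := geo r rst.
rewrite c2 c1// !sum2 /model_connection !mxE /= !(mul0r, mulr0, mulr1, addr0, add0r).
by move/eqP; rewrite oppr_eq0 oner_eq0.
Qed.

Lemma model_generic : generic_projective_symmetry (box a b J) Gm model_field model_form.
Proof.
split.
- exact: open_box.
- exact: smooth_model_connection.
- by move=> c d e x _; move: d e; apply: ord2P; apply: ord2P; rewrite /model_connection /= ?andbF.
- by move=> i j; exact: smooth_cst.
- by move=> i j; exact: smooth_cst.
- exact: model_projective.
- by move=> x _; apply/eqP => /rowP/(_ i0) /eqP; rewrite !mxE /= oner_eq0.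
- exact: model_not_geodesic.
Qed.

Lemma model_chart_id : model_chart (box a b J) Gm model_field model_form a b J fA fB id.
Proof.
have oC := open_cotangent (open_box (a := a) (b := b) oJ).
split=> //.
- split=> //; first exact: smooth_id.
  by exists id; split=> //; exact: smooth_id.
- by move=> m _; rewrite jacobian_id mul1mx trmx1 mulmx1.
- by move=> m _; rewrite jacobian_id mulmx1.
- by move=> m _; rewrite jacobian_id det1.
Qed.

Lemma model_equivalent_normal w : normal_domain J fB w ->
  locally_equivalent (normal_domain J fB) (model_h fA fB) (model_omega fB) w
    (normal_domain J fB) (normal_h fA fB) (normal_omega fB) w.
Proof.
move=> Ww; apply: (conformal_equivalence (phi := id) oJ fAs fBs) => //.
- exact: open_normal_domain oJ fBs.
- exact: smooth_id.
- by move=> v Wv; exact: (wp_nondegenerate (weyl_pair_model oJ fAs fBs) Wv).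
- by move=> v _; rewrite /pullback2 jacobian_id mul1mx trmx1 mulmx1.
- by move=> v _; rewrite /pullback1 jacobian_id trmx1 mulmx1.
Qed.

End Realisation.

Theorem proposition3p1 (R : realType) :
  (* every reduction is locally of the normal form; reductions exist near every
     point with |K|^2 nonzero *)
  (forall (U : set 'rV[R]_2) (G : @connection R 2) (k Ups : 'rV[R]_2 -> 'rV[R]_2),
     generic_projective_symmetry U G k Ups ->
     (forall m : 'rV[R]_(2 + 2), cotangent U m -> killing_norm G k Ups m != 0 ->
        exists (O : set 'rV[R]_(2 + 2)) (pi : 'rV[R]_(2 + 2) -> 'rV[R]_3)
               (W : set 'rV[R]_3) (h : 'rV[R]_3 -> 'M[R]_3)
               (om : 'rV[R]_3 -> 'rV[R]_3),
          O m /\ jones_tod_reduction U G k Ups O pi W h om) /\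
     (forall (O : set 'rV[R]_(2 + 2)) (pi : 'rV[R]_(2 + 2) -> 'rV[R]_3)
             (W : set 'rV[R]_3) (h : 'rV[R]_3 -> 'M[R]_3)
             (om : 'rV[R]_3 -> 'rV[R]_3),
        jones_tod_reduction U G k Ups O pi W h om ->
        forall w : 'rV[R]_3, W w ->
        exists (J : set R) (A B : R -> R) (w0 : 'rV[R]_3),
          [/\ open J, smooth1_on J A, smooth1_on J B &
              locally_equivalent W h om w
                (normal_domain J B) (normal_h A B) (normal_omega B) w0])) /\
  (* for arbitrary A and B the normal form is Einstein-Weyl and arises as a
     reduction near each of its points *)
  (forall (J : set R) (A B : R -> R),
     open J -> smooth1_on J A -> smooth1_on J B ->
     einstein_weyl (normal_domain J B) (normal_h A B) (normal_omega B) /\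
     (forall w0 : 'rV[R]_3, normal_domain J B w0 ->
        exists (U : set 'rV[R]_2) (G : @connection R 2)
               (k Ups : 'rV[R]_2 -> 'rV[R]_2)
               (O : set 'rV[R]_(2 + 2)) (pi : 'rV[R]_(2 + 2) -> 'rV[R]_3)
               (W : set 'rV[R]_3) (h : 'rV[R]_3 -> 'M[R]_3)
               (om : 'rV[R]_3 -> 'rV[R]_3) (w : 'rV[R]_3),
          [/\ generic_projective_symmetry U G k Ups,
              jones_tod_reduction U G k Ups O pi W h om,
              W w &
              locally_equivalent W h om w
                (normal_domain J B) (normal_h A B) (normal_omega B) w0])).
Proof.
split=> [U G k Ups gps|J A B oJ As Bs].
  split=> [m Um N0|O pi W h om red w Ww]; last exact: reduction_normal_form gps red Ww.
  have [U' [a [b [J [A [B [Phi [U'm UU mch]]]]]]]] := model_chart_exists gps Um.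
  exists (chart_domain U' a b J B Phi), (chart_proj Phi), (normal_domain J B), (model_h A B), (model_omega B).
  have [sub nonnull orb wp ph pom] := chart_reduction mch.
  split; first exact/(chart_domainE mch).
  by split=> // m' /sub U'm'; exact: UU.
split; first exact: normal_einstein_weyl.
move=> w Ww; have lt : -1 < 1 :> R by lra.
have mch := model_chart_id lt oJ As Bs.
exists (box (-1) 1 J), (model_connection A B), model_field, model_form,
  (chart_domain (box (-1) 1 J) (-1) 1 J B id), (chart_proj id), (normal_domain J B),
  (model_h A B), (model_omega B), w.
split=> //.
- exact: model_generic.
- exact: chart_reduction mch.
- exact: model_equivalent_normal.
Qed.
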